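(* Let $\mathcal{T}$ be a compact 3-manifold triangulation formed from $n$ tetrahedra. An integer vector $\mathbf{w}\in\mathbb{R}^{6n}$ is the quadrilateral-octagon vector representation of an octagonal almost normal surface in $\mathcal{T}$ if and only if all of the following hold: (1) the coordinates of $\mathbf{w}$ are all non-negative; (2) $\mathbf{w}$ satisfies the quadrilateral-octagon matching equations for $\mathcal{T}$; (3) $\mathbf{w}$ satisfies the quadrilateral-octagon constraints for $\mathcal{T}$; (4) there is precisely one non-zero octagonal coordinate in $\mathbf{w}$, and this coordinate is equal to one.
   Context: Triangulations. A compact 3-manifold triangulation $\mathcal{T}$ is formed from $n$ tetrahedra $\Delta_1,\ldots,\Delta_n$ by identifying some of their faces in pairs, so that the result is a compact 3-manifold (possibly with boundary) and every vertex of $\mathcal{T}$ has a small neighbourhood whose frontier is a sphere or a disc (ideal triangulations are excluded). Different faces (or edges, or vertices) of the same tetrahedron may be identified with each other. An edge of $\mathcal{T}$ is a boundary edge if it lies entirely within the boundary of the 3-manifold, and a non-boundary edge otherwise. Normal discs and octagons. In a tetrahedron, a normal arc is an arc in a face joining the interiors of two distinct edges of that face. Normal discs are properly embedded discs of two kinds. Triangles have boundary consisting of three normal arcs crossing distinct faces; there are four types, each separating one vertex from the other three. Quadrilaterals have boundary consisting of four normal arcs crossing distinct faces; there are three types, each separating one pair of opposite edges, which it does not meet, and meeting each of the other four edges exactly once. A normal octagon is a properly embedded disc whose boundary consists of eight normal arcs; there are three types, each corresponding to a pair of opposite edges, which it meets twice each, while it meets each of the other four edges exactly once. Surfaces. An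 octagonal almost normal surface in $\mathcal{T}$ is a properly embedded surface (possibly disconnected) whose intersection with the tetrahedra of $\mathcal{T}$ consists of zero or more normal discs (triangles and quadrilaterals) together with, in precisely one tetrahedron, a single normal octagon (all pieces being pairwise disjoint within each tetrahedron). Vector representation. For an octagonal almost normal surface $S$, let $q_{i,1},q_{i,2},q_{i,3}$ and $k_{i,1},k_{i,2},k_{i,3}$ be the numbers of quadrilateral discs and octagonal discs of $S$, respectively, of each of the three types in $\Delta_i$. The quadrilateral-octagon vector representation of $S$ is $$\mathbf{k}(S)=\left(q_{1,1},q_{1,2},q_{1,3},\,k_{1,1},k_{1,2},k_{1,3};\ \ldots;\ q_{n,1},q_{n,2},q_{n,3},\,k_{n,1},k_{n,2},k_{n,3}\right)\in\mathbb{R}^{6n}.$$ The coordinates of an arbitrary $\mathbf{w}\in\mathbb{R}^{6n}$ are labelled in the same way; the $k_{i,j}$ are called octagonal coordinates and the $q_{i,j}$ quadrilateral coordinates. Quadrilateral-octagon matching equations. There is one equation for each non-boundary edge $e$ of $\mathcal{T}$. Arbitrarily label the two ends of $e$ as upper and lower. The tetrahedra containing $e$ are arranged in a cycle around $e$; choose a direction around this cycle and let $\Delta_{i_1},\ldots,\Delta_{i_t}$ be the tetrahedra encountered in order (a tetrahedron is listed once for each of its edges that is identified with $e$). In $\Delta_{i_j}$, write $U$ and $L$ for the upper and lower endpoints of the relevant edge, and $X,Y$ for the other two vertices, so that we enter $\Delta_{i_j}$ through face $LUX$ and leave through face $LUY$. Exactly two quadrilateral types and two octagon types in $\Delta_{i_j}$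 meet the edge $LU$ exactly once. At this intersection point the disc has two adjacent boundary arcs, one in face $LUX$ and one in face $LUY$. The disc type is upward if the arc in $LUX$ cuts off the vertex $L$ and the arc in $LUY$ cuts off the vertex $U$; it is downward if the arc in $LUX$ cuts off $U$ and the arc in $LUY$ cuts off $L$. Thus the upward quadrilateral separates $\{U,X\}$ from $\{L,Y\}$, the downward quadrilateral separates $\{U,Y\}$ from $\{L,X\}$, the upward octagon is the one that meets the edges $UY$ and $LX$ twice, and the downward octagon is the one that meets the edges $UX$ and $LY$ twice. If $q_{i_j,u_j}$, $k_{i_j,u'_j}$, $q_{i_j,d_j}$, $k_{i_j,d'_j}$ are the coordinates of the upward quadrilateral, upward octagon, downward quadrilateral and downward octagon types in $\Delta_{i_j}$ respectively, then the matching equation for $e$ is $$\sum_{j=1}^t q_{i_j,u_j}+\sum_{j=1}^t k_{i_j,u'_j}=\sum_{j=1}^t q_{i_j,d_j}+\sum_{j=1}^t k_{i_j,d'_j}.$$ Quadrilateral-octagon constraints. $\mathbf{w}\in\mathbb{R}^{6n}$ satisfies these if and only if (i) for every tetrahedron $\Delta_i$, at most one of the six coordinates $q_{i,1},q_{i,2},q_{i,3},k_{i,1},k_{i,2},k_{i,3}$ is non-zero; and (ii) in the entire triangulation, at most one of the $3n$ octagonal coordinates $k_{1,1},\ldots,k_{n,3}$ is non-zero. *)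

(* Defs.v *)
From HB Require Import structures.
From Stdlib Require Import Relation_Operators.
From mathcomp Require Import all_boot all_order all_algebra fingroup perm.
From mathcomp Require Import all_classical all_reals all_analysis.
Set Implicit Arguments.
Unset Strict Implicit.
Unset Printing Implicit Defensive.
Import Order.TTheory GRing.Theory Num.Theory.
Import numFieldNormedType.Exports.
Local Open Scope classical_set_scope.
Local Open Scope ring_scope.
Local Open Scope quotient_scope.

(* The data of a triangulation: [glue T i f = Some (j, s)] says that the face  *)
(* of the i-th tetrahedron opposite to its vertex f is identified, by the      *)
(* affine map sending each vertex c != f to s c, with the face of the j-th     *)
(* tetrahedron opposite to s f; [None] says that the face is left free.        *)
Record triangulation (n : nat) := Triangulation {
  glue : 'I_n -> 'I_4 -> option ('I_n * 'S_4);
  glueK : forall i f j s,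
    glue i f = Some (j, s) -> glue j (s f) = Some (i, s^-1%g);
  glue_neq : forall i f j s, glue i f = Some (j, s) -> (j, s f) != (i, f)
}.

Section Topology.
Variable R : realType.

Definition unit_ball (d : nat) : set 'rV[R]_d :=
  [set x | \sum_c x 0 c ^+ 2 <= 1].
Definition unit_sphere (d : nat) : set 'rV[R]_d :=
  [set x | \sum_c x 0 c ^+ 2 = 1].

Definition homeomorphic (X Y : topologicalType) (A : set X) (B : set Y) :=
  exists (f : X -> Y) (g : Y -> X),
    [/\ {within A, continuous f}, {within B, continuous g},
        f @` A `<=` B, g @` B `<=` A &
        {in A, cancel f g} /\ {in B, cancel g f}].

Definition frontier (X : topologicalType) (A : set X) : set X :=
  closure A `\` interior A.

(* Possibly with boundary, not necessarily connected. *)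
Definition compact_3_manifold (X : topologicalType) :=
  [/\ compact [set: X], hausdorff_space X, @second_countable X &
      forall x : X, exists (U : set X) (W : set 'rV[R]_3),
        [/\ open U, U x, open W &
            homeomorphic U (W `&` [set y | 0 <= y 0 0])]].

(* The standard tetrahedron, in barycentric coordinates. *)
Definition simplex : set 'rV[R]_4 :=
  [set x | (forall c, 0 <= x 0 c) /\ \sum_c x 0 c = 1].

Definition tetra : Type := set_type simplex.
HB.instance Definition _ := Topological.on tetra.

Definition bary (x : tetra) (c : 'I_4) : R := set_val x 0 c.

(* The open and the closed face of the tetrahedron spanned by V. *)
Definition open_face (V : {set 'I_4}) : set tetra :=
  [set x | forall c, (0 < bary x c) = (c \in V)].
Definition closed_face (V : {set 'I_4}) : set tetra :=
  [set x | forall c, c \notin V -> bary x c = 0].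

Definition tetra_boundary : set tetra := [set x | exists c, bary x c = 0].

End Topology.

Section Realization.
Variables (R : realType) (n : nat) (T : triangulation n).

Definition tetrahedra : Type := {i : 'I_n & tetra R}.
HB.instance Definition _ := Topological.on tetrahedra.

Definition glue_step (p q : tetrahedra) : Prop :=
  exists (f : 'I_4) (s : 'S_4),
    [/\ glue T (tag p) f = Some (tag q, s), bary (tagged p) f = 0 &
        forall c, bary (tagged q) (s c) = bary (tagged p) c].

Definition glue_eq (p q : tetrahedra) : bool :=
  `[< clos_refl_sym_trans _ glue_step p q >].

Lemma glue_eq_refl : reflexive glue_eq.
Proof. by move=> p; apply/asboolP; exact: rst_refl. Qed.

Lemma glue_eq_sym : symmetric glue_eq.
Proof.
by move=> p q; apply/asboolP/asboolP; exact: rst_sym.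
Qed.

Lemma glue_eq_trans : transitive glue_eq.
Proof.
by move=> q p r /asboolP pq /asboolP qr; apply/asboolP; exact: rst_trans pq qr.
Qed.

Canonical glue_equiv := EquivRel _ glue_eq_refl glue_eq_sym glue_eq_trans.

(* The space obtained from the disjoint union of the tetrahedra. *)
Definition realization : Type := {eq_quot glue_equiv}.
HB.instance Definition _ :=
  Topological.copy realization (quotient_topology realization).
HB.instance Definition _ := Quotient.on realization.

Definition pt (i : 'I_n) (x : tetra R) : realization :=
  \pi_realization (existT _ i x : tetrahedra).

Definition is_vertex (x : realization) :=
  exists (i : 'I_n) (v : 'I_4) (p : tetra R),
    open_face [set v]%SET p /\ x = pt i p.

(* Union of the e-corners of the tetrahedra at the vertex x. *)
Definition vertex_nbhd (x : realization) (e : R) : set realization :=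
  [set y | exists (i : 'I_n) (v : 'I_4) (p q : tetra R),
     [/\ open_face [set v]%SET p, x = pt i p, 1 - e < bary q v & y = pt i q]].

Definition manifold_triangulation :=
  compact_3_manifold R realization /\
  forall x, is_vertex x -> exists e : R, 0 < e < 2^-1 /\
    (homeomorphic (frontier (vertex_nbhd x e)) (@unit_sphere R 3) \/
     homeomorphic (frontier (vertex_nbhd x e)) (@unit_ball R 2)).

End Realization.

(* The pair of opposite edges number j consists of the edge {0, j + 1} and of *)
(* the edge joining the other two vertices; [paired j a b] says that ab is     *)
(* one of these two edges, and [pairing a b] is the number of the edge ab.     *)
Definition paired (j : 'I_3) (a b : 'I_4) : bool :=
  let P := [set ord0; lift ord0 j]%SET in (a \in P) == (b \in P).
Definition pairing (a b : 'I_4) : 'I_3 :=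
  if paired 0 a b then 0 else if paired 1 a b then 1 else 2.

(* [Tri v] cuts off the vertex v; [Quad j] separates the two edges of the j-th *)
(* pair of opposite edges; [Oct j] meets these two edges twice each.           *)
Inductive disc_type :=
  Tri of 'I_4 | Quad of 'I_3 | Oct of 'I_3.

Definition is_quad (j : 'I_3) (t : disc_type) : bool :=
  if t is Quad j' then j' == j else false.
Definition is_oct (j : 'I_3) (t : disc_type) : bool :=
  if t is Oct j' then j' == j else false.
Definition octagonal (t : disc_type) : bool :=
  if t is Oct _ then true else false.

Definition sides (t : disc_type) : nat :=
  match t with Tri _ => 3%N | Quad _ => 4%N | Oct _ => 8%N end.

(* Number of intersection points with the edge ab. *)
Definition crossings (t : disc_type) (a b : 'I_4) : nat :=
  match t with
  | Tri v => (v == a) || (v == b)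
  | Quad j => ~~ paired j a b
  | Oct j => if paired j a b then 2%N else 1%N
  end.

Section Surfaces.
Variable R : realType.

(* Arcs and discs are images of continuous injections, which are embeddings   *)
(* because [0, 1] and the unit disc are compact.                               *)
Definition normal_arc (f : 'I_4) (A : set (tetra R)) :=
  exists (e e' : {set 'I_4}) (h : R -> tetra R),
    [/\ [/\ #|e| = 2%N, #|e'| = 2%N, e != e', f \notin e & f \notin e'],
        {within `[0, 1], continuous h}, set_inj `[0, 1] h, A = h @` `[0, 1] &
        [/\ open_face e (h 0), open_face e' (h 1) &
            forall t, 0 < t < 1 -> open_face [set~ f]%SET (h t)]].

Definition proper_disc (D B : set (tetra R)) :=
  exists h : 'rV[R]_2 -> tetra R,
    [/\ {within @unit_ball R 2, continuous h}, set_inj (@unit_ball R 2) h,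
        D = h @` @unit_ball R 2, B = h @` @unit_sphere R 2 &
        D `&` @tetra_boundary R = B].

(* Arcs in the same face are disjoint, ends included: the boundary curve goes *)
(* across each edge that it meets. The type is read off from the edges met.    *)
Definition normal_disc (t : disc_type) (D : set (tetra R)) :=
  exists (arc : 'I_(sides t) -> set (tetra R)) (face : 'I_(sides t) -> 'I_4),
    [/\ proper_disc D (\bigcup_k arc k),
        forall k, normal_arc (face k) (arc k),
        forall k l, k != l -> face k = face l -> arc k `&` arc l = set0,
        ~~ octagonal t -> injective face &
        forall a b, a != b ->
          (D `&` @closed_face R [set a; b]%SET #= `I_(crossings t a b))%card].

(* There is no separate clause saying that the carrier is a properly embedded *)
(* surface: the pieces are properly embedded discs, disjoint in each          *)
(* tetrahedron, and they fit together along the identified faces because they *)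
(* are cut out by one subset of the realization. Around each of its points,   *)
(* the carrier is thus made of one piece, of two pieces glued along an arc,   *)
(* or of a cycle or a chain of sectors around an edge.                        *)
Record octagonal_surface (n : nat) (T : triangulation n) := OctagonalSurface {
  carrier : set (realization R T);
  npieces : 'I_n -> nat;
  piece_type : forall i, 'I_(npieces i) -> disc_type;
  piece : forall i, 'I_(npieces i) -> set (tetra R);
  piece_normal : forall i k, normal_disc (piece_type k) (@piece i k);
  piece_disjoint : forall i k l, k != l -> @piece i k `&` @piece i l = set0;
  piece_cover : forall i, [set x | carrier (pt T i x)] = \bigcup_k @piece i k;
  one_octagon :
    (\sum_i #|[set k | octagonal (@piece_type i k)]%SET| = 1)%N
}.

Definition qo_vector n (T : triangulation n) (S : octagonal_surface T) :
    'rV[R]_(n * (3 + 3)%N) :=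
  mxvec (\matrix_i row_mx
    (\row_j #|[set k | is_quad j (@piece_type n T S i k)]%SET|%:R)
    (\row_j #|[set k | is_oct j (@piece_type n T S i k)]%SET|%:R)).

End Surfaces.

Section Coordinates.
Variables (R : realType) (n : nat) (T : triangulation n).
Implicit Type w : 'rV[R]_(n * (3 + 3)%N).

Definition quad_coord w (i : 'I_n) (j : 'I_3) : R := vec_mx w i (lshift 3 j).
Definition oct_coord w (i : 'I_n) (j : 'I_3) : R := vec_mx w i (rshift 3 j).

(* Directed edges (i, (a, b)), up to the identifications. *)
Definition edge_step (p q : 'I_n * ('I_4 * 'I_4)) : bool :=
  let: (i, (a, b)) := p in
  [exists f : 'I_4, [&& f != a, f != b &
    if glue T i f is Some (j, s) then q == (j, (s a, s b)) else false]].

(* The boundary of the manifold is the union of the free faces. *)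
Definition boundary_edge (i : 'I_n) (a b : 'I_4) : bool :=
  [exists j : 'I_n, exists c : 'I_4, exists d : 'I_4, exists f : 'I_4,
    [&& connect edge_step (i, (a, b)) (j, (c, d)), f != c, f != d &
        glue T j f == None]].

(* A position (i, m) in the cycle around an edge: a tetrahedron together with *)
(* the labelling of its vertices by U, L, X, Y.                                *)
Definition position := ('I_n * 'S_4)%type.
Definition U_ : 'I_4 := @Ordinal 4 0 isT.
Definition L_ : 'I_4 := @Ordinal 4 1 isT.
Definition X_ : 'I_4 := @Ordinal 4 2 isT.
Definition Y_ : 'I_4 := @Ordinal 4 3 isT.

(* Leaving through the face LUY, i.e. the one opposite to X, one enters the   *)
(* next tetrahedron through the image of that face: the image of Y becomes X. *)
(* Around a non-boundary edge the [else] branch is never taken and [turn] is   *)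
(* a cyclic permutation of the positions; as no edge of a manifold            *)
(* triangulation is identified with its own reverse, each edge of a           *)
(* tetrahedron belonging to the class occurs exactly once in the cycle.       *)
Definition turn (p : position) : position :=
  let: (i, m) := p in
  if glue T i (m X_) is Some (j, s) then (j, (tperm X_ Y_ * m * s)%g) else p.

Definition upward w (p : position) : R :=
  let: (i, m) := p in
  quad_coord w i (pairing (m U_) (m X_)) + oct_coord w i (pairing (m U_) (m Y_)).
Definition downward w (p : position) : R :=
  let: (i, m) := p in
  quad_coord w i (pairing (m U_) (m Y_)) + oct_coord w i (pairing (m U_) (m X_)).

(* The equation of each non-boundary edge is required for every choice of the *)
(* upper end, of the direction and of the starting point; a change of choices *)
(* at most exchanges the two sides.                                           *)
Definition qo_matching w :=
  forall (i : 'I_n) (m : 'S_4), ~~ boundary_edge i (m U_) (m L_) ->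
    \sum_(p <- orbit turn (i, m)) upward w p =
    \sum_(p <- orbit turn (i, m)) downward w p.

Definition qo_constraints w :=
  (forall (i : 'I_n) (c d : 'I_(3 + 3)%N),
     vec_mx w i c != 0 -> vec_mx w i d != 0 -> c = d) /\
  (forall (i i' : 'I_n) (j j' : 'I_3),
     oct_coord w i j != 0 -> oct_coord w i' j' != 0 -> (i, j) = (i', j')).

Definition one_unit_octagon w :=
  exists (i : 'I_n) (j : 'I_3), oct_coord w i j = 1 /\
    forall (i' : 'I_n) (j' : 'I_3),
      oct_coord w i' j' != 0 -> (i', j') = (i, j).

End Coordinates.

(* Main.v *)
(* Let arcs(f, v) be the number of arcs of a normal surface that cut off the
   vertex v in the face f of a tetrahedron. It is the number of triangles at v
   plus a sum c(f, v) of quadrilateral and octagonal coordinates, and the two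
   sides of the matching equation of an edge differ by a telescoping sum of the
   numbers c around the edge.

   Necessity. The points of the surface on the edges of a face determine its
   numbers of arcs, so arcs(f, v) is unchanged by the gluing and the telescoping
   sum vanishes. Two quadrilaterals of different types, or a quadrilateral and
   an octagon, cannot be disjoint: on a common face or edge, an intermediate
   value argument (a winding number on a square) orders their points, and the
   orders found around the tetrahedron are incompatible.

   Sufficiency. The jumps of c across the faces define a system of integral
   differences for the numbers of triangles. The matching equations make it
   locally integrable on the vertex links, and these are spheres or discs, on
   which every locally integrable system has a global solution; adding a
   constant makes the numbers of triangles nonnegative. The pieces are then
   given in each tetrahedron by explicit piecewise linear equations, whose
   traces on a face depend only on the numbers arcs(f, v).                    *)

From HB Require Import structures.
From Stdlib Require Import Relation_Operators.
From mathcomp Require Import all_boot all_order all_algebra fingroup perm.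
From mathcomp Require Import all_classical all_reals all_analysis.
From mathcomp Require Import ring lra zify.
Require Import Defs.
Set Implicit Arguments.
Unset Strict Implicit.
Unset Printing Implicit Defensive.
Import Order.TTheory GRing.Theory Num.Theory.
Import numFieldNormedType.Exports.
Local Open Scope classical_set_scope.
Local Open Scope ring_scope.

(** * Torsors under locally constant integers *)

(** The link of a vertex is known only through a homeomorphism with a sphere or a disc, so the
    vanishing of its first cohomology has to be stated topologically, not on its triangulation by
    corners of tetrahedra. Numbers of triangles are not functions on the link: they belong to
    corners, and they jump across the identified faces. Only the differences of two local solutions
    descend to the link, where they are locally constant. Hence a local solution [F x] at each
    point, a region [W x] where it is meaningful, and conditions on differences alone. The same
    property of a square gives the winding argument for disjoint arcs: the local functions are then
    branches of a count of crossings with a ray. For the construction, each piece must be an image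
    of the round disc. All pieces are star-shaped around an interior point, which reduces this to a
    radial rescaling. The equations are calibrated so that the surface meets each edge in equally
    spaced points; this is why equal numbers of arcs on the two sides of a face force equal
    traces. *)

(* The vanishing of H^1(A; Z): local functions with locally constant differences
   come from a global function.                                              *)
Definition trivial_torsors (X : topologicalType) (A : set X) : Prop :=
  forall (W : X -> set X) (F : X -> X -> int),
    (forall x, A x -> \forall u \near x, A u -> W x u) ->
    (forall x y z, A x -> A y -> A z -> W x z -> W y z ->
       \forall u \near z, A u -> F x u - F y u = F x z - F y z) ->
  exists f : X -> int, forall x, A x ->
    \forall u \near x, A u -> f u - F x u = f x - F x x.

Lemma locally_constant_connected (X : topologicalType) (T : Type) (A : set X)
    (g : X -> T) :
  connected A ->
  (forall x, A x -> \forall u \near x, A u -> g u = g x) ->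
  forall x y, A x -> A y -> g x = g y.
Proof.
move=> cA gloc x y Ax Ay.
suff : A `&` [set u | g u = g x] = A by move=> /seteqP[_ /(_ y Ay)[]].
apply: cA.
- by exists x.
- exists (interior [set u | A u -> g u = g x]); first exact: open_interior.
  apply/seteqP; split=> u [Au] /=.
    move=> gu; split=> //; apply: filterS (gloc u Au).
    by move=> v /= vP Av; rewrite vP.
  by move=> /nbhs_singleton; split=> //; auto.
- exists (~` interior [set u | A u -> g u <> g x]).
    by apply: open_closedC; exact: open_interior.
  apply/seteqP; split=> u [Au] /=.
    by move=> gu; split=> // /nbhs_singleton/(_ Au); rewrite gu.
  move=> nu; split=> //; apply: contrapT => gu; apply: nu.
  by apply: filterS (gloc u Au) => v /= vP Av; rewrite vP.
Qed.

Lemma within_continuous_near (X Y : topologicalType) (A : set X) (f : X -> Y)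
    (x : X) (P : set Y) :
  {within A, continuous f} -> A x -> (\forall u \near f x, P u) ->
  \forall u \near x, A u -> P (f u).
Proof. by move=> /subspace_continuousP cf Ax; exact: cf. Qed.

Lemma near_within_continuous (X Y : topologicalType) (A : set X) (f : X -> Y) :
  (forall x P, A x -> (\forall u \near f x, P u) ->
     \forall u \near x, A u -> P (f u)) -> {within A, continuous f}.
Proof. by move=> cf; apply/subspace_continuousP => x Ax P; exact: cf. Qed.

Lemma trivial_torsors_homeomorphic (X Y : topologicalType) (A : set X)
    (B : set Y) :
  homeomorphic A B -> trivial_torsors B -> trivial_torsors A.
Proof.
move=> [f [g [cf cg fA gB [fK gK]]]] HB W F Wn Fc.
have fAx x : A x -> B (f x) by move=> Ax; apply: fA; exists x.
have gBx y : B y -> A (g y) by move=> By; apply: gB; exists y.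
have fKx x : A x -> g (f x) = x by move=> Ax; apply: fK; rewrite inE.
have cfx x P : A x -> (\forall u \near f x, B u -> P u) ->
    \forall u \near x, A u -> P (f u).
  move=> Ax /(within_continuous_near cf Ax).
  by apply: filterS => u /= H Au; apply: H => //; exact: fAx.
have cgx y P : B y -> (\forall u \near g y, A u -> P u) ->
    \forall u \near y, B u -> P (g u).
  move=> By /(within_continuous_near cg By).
  by apply: filterS => u /= H Bu; apply: H => //; exact: gBx.
have [f' f'P] := HB (fun y => g @^-1` W (g y)) (fun y u => F (g y) (g u))
  (fun y By => cgx y _ By (Wn _ (gBx _ By)))
  (fun x y z Bx By Bz Wx Wy =>
     cgx z _ Bz (Fc _ _ _ (gBx _ Bx) (gBx _ By) (gBx _ Bz) Wx Wy)).
exists (f' \o f) => x Ax.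
have := cfx x (fun u => f' u - F x (g u) = f' (f x) - F x x) Ax.
have := f'P _ (fAx _ Ax); rewrite fKx // => H /(_ H).
by apply: filterS => u /= H' Au; rewrite -{2}(fKx u Au) H'.
Qed.

(** * Compact convex sets *)

Section Convex.
Variables (R : realType) (V : normedModType R).
Implicit Types (K : set V).

Definition convex_in K :=
  forall x y (t : R), K x -> K y -> 0 <= t <= 1 -> K (x + t *: (y - x)).

(** The segment from [x] to [y] is connected, and [P] need only describe a region around this
    segment in which [g] is controlled. *)
Lemma convex_ball_connected K x y (T : Type) (g : V -> T) (P : set V) :
  convex_in K -> K x -> K y ->
  (forall t : R, 0 <= t <= 1 -> P (x + t *: (y - x))) ->
  (forall z, K z -> P z -> \forall u \near z, K u -> g u = g z) -> g x = g y.
Proof.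
move=> cK Kx Ky Pxy gloc.
pose l (t : R) := x + t *: (y - x).
have lc : continuous l.
  move=> t; apply: cvgD; first exact: cvg_cst.
  by apply: cvgZr_tmp; exact: cvg_id.
have cl := @segment_connected R 0 1.
have l01 (t : R) : `[0, 1]%classic t -> 0 <= t <= 1 by rewrite /= in_itv.
have loc (t : R) : `[0, 1]%classic t ->
    \forall u \near t, `[0, 1]%classic u -> (g \o l) u = (g \o l) t.
  move=> /l01 t01.
  have H : \forall u \near l t, K u -> g u = g (l t).
    by apply: gloc; [exact: cK|exact: Pxy].
  have {}H : \forall u \near t, K (l u) -> g (l u) = g (l t) := lc t _ H.
  apply: filterS H.
  move=> u /= H /l01 u01; apply: H.
  exact: cK.
have := locally_constant_connected cl loc (x := 0) (y := 1).
by rewrite /= !bound_itvE /l scale0r scale1r addr0 subrKC; apply.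
Qed.

Lemma lebesgue_number K (W : V -> set V) :
  compact K -> (forall x, K x -> \forall u \near x, K u -> W x u) ->
  exists2 d : R, 0 < d &
    forall x, K x -> exists2 c, K c & forall u, K u -> `|x - u| < d -> W c u.
Proof.
move=> /compact_near_coveringP cK Wn.
pose P (d : R) x := exists2 c, K c & forall u, K u -> `|x - u| < d -> W c u.
have [x Kx|] := cK R (at_right 0) P _.
  have /nbhs_ballP[r /= r0 rW] := Wn x Kx.
  exists (ball x (r / 2), [set d | d < r / 2]).
    split; first by apply: nbhsx_ballx; rewrite divr_gt0.
    by apply: nbhs_right_lt; rewrite divr_gt0.
  move=> [y d] /= [xy dr]; exists x => // u Ku yu; apply: rW => //.
  move: xy; rewrite -!ball_normE /= => xy.
  rewrite -(subrKA y) (le_lt_trans (ler_normD _ _)) // (splitr r) ltrD //.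
  exact: lt_trans dr.
move=> e /= e0 eP; exists (e / 2); first by rewrite divr_gt0.
apply: eP => /=; last by rewrite divr_gt0.
by rewrite sub0r normrN ger0_norm ?ltr_pdivrMr ?divr_ge0 ?ltr_pMr ?(ltW e0) ?ltr1n.
Qed.

(** Integration along rays. Each [x] is reached from a base point in the same number of small steps,
    and [f x] adds up the increments of local functions that are valid on these steps. The rays to
    two close points bound a ladder of small squares, so the two sums differ by the increment along
    the last rung. *)
Lemma trivial_torsors_convex K :
  compact K -> convex_in K -> trivial_torsors K.
Proof.
move=> coK cK W F Wn Fc.
have [[x0 Kx0]|K0] := pselect (K !=set0); last first.
  by exists (fun=> 0) => x Kx; exfalso; apply: K0; exists x.
have [d d0 dP] := lebesgue_number coK Wn.
(* [F (c x)] is valid on the whole ball of radius [d] around [x], whereas [F x] may be valid only on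
   a smaller one. *)
have {dP} /choice[c cP] : forall x, exists c, K x ->
    K c /\ forall u, K u -> `|x - u| < d -> W c u.
  move=> x; have [/dP[c Kc cW]|nKx] := pselect (K x); first by exists c.
  by exists x.
have Kc x : K x -> K (c x) by move=> /cP[].
have Wc x u : K x -> K u -> `|x - u| < d -> W (c x) u by move=> /cP[_]; exact.
pose D x y := F (c x) y - F (c x) x.
have Dxx x : D x x = 0 by rewrite /D subrr.
have hd0 : 0 < d / 2 by rewrite divr_gt0.
have hdd : d / 2 < d by rewrite ltr_pdivrMr // ltr_pMr // ltr1n.
(* Increments are additive on small triangles: [F (c x) - F (c y)] is constant along the segment
   from [y] to [z], which stays within [d] of both [x] and [y]. *)
have DD x y z : K x -> K y -> K z -> `|x - y| < d / 2 -> `|y - z| < d / 2 ->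
    D x z = D x y + D y z.
  move=> Kx Ky Kz xy yz.
  pose P u := `|x - u| < d /\ `|y - u| < d.
  have : F (c x) y - F (c y) y = F (c x) z - F (c y) z.
    apply: (@convex_ball_connected K y z _ (fun u => F (c x) u - F (c y) u) P)
      => // [t /andP[t0 t1]|u Ku [xu yu]].
      have yt : `|y - (y + t *: (z - y))| < d / 2.
        rewrite opprD addrA subrr sub0r normrN normrZ (ger0_norm t0).
        by rewrite (le_lt_trans _ yz) // distrC ler_piMl.
      split; last exact: lt_trans hdd.
      by rewrite -(subrKA y) (le_lt_trans (ler_normD _ _)) // (splitr d) ltrD.
    by apply: Fc; auto.
  by rewrite /D; move: (F _ _) (F _ _) (F _ _) (F _ _) (F _ _) => ? ? ? ? ?; lia.
have [B B0 BP] : exists2 B : R, 0 < B & forall x, K x -> `|x - x0| <= B.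
  have [M [_ MP]] := compact_bounded coK.
  exists (`|M| + 1 + `|x0|) => [|x Kx].
    by rewrite -addrA ltr_wpDl // ltr_pwDl.
  rewrite (le_trans (ler_normB _ _)) // lerD2r; apply: MP => //.
  by rewrite (le_lt_trans (ler_norm _)) // ltrDl.
(* The number of steps is the same for all points, so that two rays can be compared step by step. *)
have [M MP] : exists M : nat, B / M.+1%:R < d / 4.
  exists (Num.Def.truncn (B / (d / 4))).
  rewrite ltr_pdivrMr // mulrC -ltr_pdivrMr ?divr_gt0 //.
  by rewrite truncnS_gt.
pose p k x := x0 + (k%:R / M.+1%:R) *: (x - x0).
have p0 x : p 0%N x = x0 by rewrite /p mul0r scale0r addr0.
have pM x : p M.+1 x = x by rewrite /p divff // scale1r subrKC.
have Kp k x : (k <= M.+1)%N -> K x -> K (p k x).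
  move=> kM Kx; apply: cK => //; rewrite divr_ge0 //=.
  by rewrite ler_pdivrMr // mul1r ler_nat.
have hd4 : d / 4 + d / 4 = d / 2 by field.
have hd42 : d / 4 < d / 2 by rewrite -hd4 ltrDl divr_gt0.
have ppS k x : K x -> `|p k x - p k.+1 x| < d / 4.
  move=> Kx; rewrite /p opprD addrACA subrr add0r -scalerBl -mulrBl.
  rewrite -natr1 opprD addrA subrr sub0r normrZ normrM normrN1 mul1r.
  by rewrite (le_lt_trans _ MP) // normfV mulrC ger0_norm // ler_wpM2r ?BP.
have pxy k x y : (k <= M.+1)%N -> `|x - y| < d / 4 -> `|p k x - p k y| < d / 4.
  move=> kM xy; rewrite /p opprD addrACA subrr add0r -scalerBr.
  rewrite opprB addrA subrK normrZ (le_lt_trans _ xy) // ger0_norm ?divr_ge0 //.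
  by rewrite ler_piMl // ler_pdivrMr // mul1r ler_nat.
pose f x := \sum_(k < M.+1) D (p k x) (p k.+1 x).
exists f => x Kx.
have fD : \forall u \near x, K u -> f u - f x = D x u.
  near=> u => Ku.
  have xu : `|x - u| < d / 4.
    near: u; apply/nbhs_ballP; exists (d / 4); first by rewrite /= divr_gt0.
    by move=> u; rewrite -ball_normE.
  (* Both ways around each square of the ladder give the same increment by [DD]. The first rung is
     degenerate, as all rays start at [x0]. *)
  suff H m : (m <= M.+1)%N ->
      \sum_(k < m) D (p k u) (p k.+1 u) - \sum_(k < m) D (p k x) (p k.+1 x) =
      D (p m x) (p m u) by rewrite /f H // !pM.
  elim: m => [_|m IHm mM]; first by rewrite !big_ord0 !p0 Dxx.
  rewrite !big_ord_recr /= opprD addrACA IHm ?(ltnW mM) //.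
  have := DD (p m x) (p m u) (p m.+1 u) (Kp _ _ (ltnW mM) Kx)
    (Kp _ _ (ltnW mM) Ku) (Kp _ _ mM Ku) (lt_trans (pxy _ _ _ (ltnW mM) xu) hd42)
    (lt_trans (ppS m u Ku) hd42).
  rewrite (DD (p m x) (p m.+1 x) (p m.+1 u) (Kp _ _ (ltnW mM) Kx)
    (Kp _ _ mM Kx) (Kp _ _ mM Ku) (lt_trans (ppS m x Kx) hd42)
    (lt_trans (pxy _ _ _ mM xu) hd42)) => E.
  by rewrite addrA -E addrAC subrr add0r.
(* [fD] compares [f] with [F (c x)]; the condition on differences at [x] replaces it by [F x]. *)
have Wcx : W (c x) x by apply: Wc => //; rewrite subrr normr0.
have Wx : W x x by apply: (nbhs_singleton (Wn _ Kx)).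
apply: filterS2 fD (Fc (c x) x x (Kc _ Kx) Kx Kx Wcx Wx) => u fu Fu Ku.
by move: (fu Ku) (Fu Ku); rewrite /D; move: (f u) (f x) (F _ _) (F _ _) (F _ _) (F _ _) => ? ? ? ? ? ?; lia.
Unshelve. all: by end_near.
Qed.

End Convex.

Section Rows.
Variable R : realType.

Lemma cvg_row (T : Type) (F : set_system T) {FF : Filter F} m
    (f : T -> 'rV[R]_m) (l : 'rV[R]_m) :
  (forall j, (fun x => f x 0 j) @ F --> l 0 j) -> f @ F --> l.
Proof.
move=> fl; apply/cvg_ballP => e e0.
have : \forall x \near F, forall j, ball (l 0 j) e (f x 0 j).
  by apply: filter_forall => j; move/cvg_ballP: (fl j); exact.
apply: filterS => x H; split=> // i j; rewrite ord1; exact: H.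
Qed.

Lemma continuous_row (T : topologicalType) m (f : T -> 'rV[R]_m) :
  (forall j, continuous (fun x => f x 0 j)) -> continuous f.
Proof. by move=> fc x; apply: cvg_row => j; exact: fc. Qed.

Lemma cvg_sumr (T : Type) (F : set_system T) {FF : Filter F} (I : Type)
    (r : seq I) (P : pred I) (f : I -> T -> R) (a : I -> R) :
  (forall i, P i -> f i @ F --> a i) ->
  (fun x => \sum_(i <- r | P i) f i x) @ F --> \sum_(i <- r | P i) a i.
Proof.
by move=> H; apply: (@cvg_big R I +%R 0 P _ T F r f a) => //; exact: add_continuous.
Qed.

Lemma continuous_sumr (T : topologicalType) (I : Type) (r : seq I)
    (P : pred I) (f : I -> T -> R) :
  (forall i, P i -> continuous (f i)) ->
  continuous (fun x => \sum_(i <- r | P i) f i x).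
Proof.
by move=> H x; apply: (@cvg_sumr T (nbhs x) (nbhs_filter x) I r P f) => i /H; exact.
Qed.

Lemma continuous_sumsq d : continuous (fun x : 'rV[R]_d => \sum_c x 0 c ^+ 2).
Proof.
apply: continuous_sumr => c _ x.
apply: (@continuous_comp _ _ _ (fun x : 'rV[R]_d => x 0 c) (fun r => r ^+ 2)); first exact: coord_continuous.
exact: exprn_continuous.
Qed.

Lemma unit_ball_compact d : compact (@unit_ball R d.+1).
Proof.
apply: bounded_closed_compact.
  exists 1; split => // M M1 x /= xb.
  rewrite /Num.norm /= mx_normrE (le_trans _ (ltW M1)) //.
  apply: bigmax_le => // -[i c] _ /=; rewrite ord1.
  rewrite -(ler_pXn2r (n := 2)) ?nnegrE // expr1n (le_trans _ xb) //.
  rewrite real_normK ?num_real // (bigD1 c) //= lerDl.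
  by apply: sumr_ge0 => j _; exact: sqr_ge0.
rewrite (_ : @unit_ball R d.+1 = (fun x : 'rV[R]_d.+1 => \sum_c x 0 c ^+ 2) @^-1` [set r | r <= 1]) //.
apply: closed_comp; last exact: closed_le.
by move=> x _; exact: continuous_sumsq.
Qed.

Lemma unit_ball_convex d : convex_in (@unit_ball R d.+1).
Proof.
move=> x y t xb yb /andP[t0 t1]; rewrite /unit_ball /=.
have -> : 1 = (1 - t) * 1 + t * 1 :> R by ring.
apply: (@le_trans _ _ ((1 - t) * (\sum_c x 0 c ^+ 2) + t * \sum_c y 0 c ^+ 2)).
  rewrite !mulr_sumr -big_split /= ler_sum // => c _; rewrite !mxE.
  rewrite -subr_ge0 [leRHS](_ : _ = t * (1 - t) * (x 0 c - y 0 c) ^+ 2); last by ring.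
  by rewrite mulr_ge0 ?sqr_ge0 // mulr_ge0 // subr_ge0.
by rewrite lerD // ler_wpM2l // subr_ge0.
Qed.

Lemma unit_ball_torsors d : trivial_torsors (@unit_ball R d.+1).
Proof. exact: trivial_torsors_convex (@unit_ball_compact d) (@unit_ball_convex d). Qed.

Definition row2 (x y : R) : 'rV[R]_2 := \row_j (if j == 0 then x else y).

Lemma row2E (z : 'rV[R]_2) : z = row2 (z 0 0) (z 0 1).
Proof.
apply/rowP => j; rewrite mxE; case: eqP => [->//|/eqP j0].
by congr (z _ _); apply/val_inj; case: j j0 => [[|[|]]].
Qed.

Lemma sum_row2 (z : 'rV[R]_2) : \sum_c z 0 c ^+ 2 = z 0 0 ^+ 2 + z 0 1 ^+ 2.
Proof. by rewrite !big_ord_recl big_ord0 addr0; congr (_ + z _ _ ^+ 2); apply/val_inj. Qed.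

Lemma row2_0 x y : row2 x y 0 0 = x. Proof. by rewrite mxE. Qed.
Lemma row2_1 x y : row2 x y 0 1 = y. Proof. by rewrite mxE. Qed.

Lemma continuous_row2 (T : topologicalType) (f g : T -> R) :
  continuous f -> continuous g -> continuous (fun x => row2 (f x) (g x)).
Proof.
move=> fc gc; apply: continuous_row => j.
by rewrite (_ : (fun x => _) = if j == 0 then f else g); [case: ifP|
  apply/funext => x; rewrite mxE; case: ifP].
Qed.

(** The circle is the union of two graphs over an interval, the upper and the lower half, which
    share the point (1, 0). *)
Lemma unit_circle_connected : connected (@unit_sphere R 2).
Proof.
pose arc s (x : R) := row2 x (s * Num.sqrt (1 - x ^+ 2)).
have arcc s : continuous (arc s).
  apply: continuous_row2 => x; first exact: cvg_id.
  apply: (@cvgM _ _ (nbhs x)); first exact: cvg_cst.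
  apply: (@continuous_comp _ _ _ (fun x : R => 1 - x ^+ 2) Num.sqrt); last exact: sqrt_continuous.
  by apply: cvgB; [exact: cvg_cst|exact: exprn_continuous].
have -> : @unit_sphere R 2 = arc 1 @` `[-1, 1] `|` arc (-1) @` `[-1, 1].
  apply/seteqP; split=> [z|z].
    rewrite /unit_sphere /= sum_row2 => z1.
    have z0 : -1 <= z 0 0 <= 1.
      rewrite -ler_norml -(ler_pXn2r (n := 2)) ?nnegrE // expr1n.
      by rewrite real_normK ?num_real // -z1 lerDl sqr_ge0.
    have E : 1 - z 0 0 ^+ 2 = z 0 1 ^+ 2 by rewrite -z1; ring.
    have [z10|z10] := leP 0 (z 0 1); [left|right]; exists (z 0 0);
      rewrite /= ?in_itv //= {2}(row2E z) /arc E sqrtr_sqr.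
      by rewrite ger0_norm // mul1r.
    by rewrite ltr0_norm // mulN1r opprK.
  have H s x : s ^+ 2 = 1 -> -1 <= x <= 1 -> @unit_sphere R 2 (arc s x).
    move=> s1 x1; rewrite /unit_sphere /= sum_row2 row2_0 row2_1 exprMn s1 mul1r.
    rewrite sqr_sqrtr; first by ring.
    by rewrite subr_ge0 -(real_normK (num_real _)) exprn_ile1 // ler_norml.
  by case=> -[x /=]; rewrite in_itv /= => x1 <-; apply: H => //; ring.
apply: connectedU.
- exists (row2 1 0); split; exists 1; rewrite /= ?in_itv /= ?lexx ?andbT ?ge0_cp //;
    by rewrite /arc expr1n subrr sqrtr0 mulr0.
- apply: connected_continuous_connected; first exact: segment_connected.
  exact: continuous_subspaceT.
- apply: connected_continuous_connected; first exact: segment_connected.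
  exact: continuous_subspaceT.
Qed.

End Rows.

(** * The sphere *)

Section Sphere.
Variable R : realType.

Definition row3 (x y z : R) : 'rV[R]_3 :=
  \row_j (if j == 0 then x else if j == 1 then y else z).

Lemma row3E (u : 'rV[R]_3) : u = row3 (u 0 0) (u 0 1) (u 0 2%:R).
Proof.
apply/rowP => j; rewrite mxE; case: eqP => [->//|/eqP j0]; case: eqP => [->//|/eqP j1].
by congr (u _ _); apply/val_inj; case: j j0 j1 => [[|[|[|]]]].
Qed.

Lemma row3_0 x y z : row3 x y z 0 0 = x. Proof. by rewrite mxE. Qed.
Lemma row3_1 x y z : row3 x y z 0 1 = y. Proof. by rewrite mxE. Qed.
Lemma row3_2 x y z : row3 x y z 0 2%:R = z. Proof. by rewrite mxE. Qed.

Lemma continuous_row3 (T : topologicalType) (f g h : T -> R) :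
  continuous f -> continuous g -> continuous h ->
  continuous (fun x => row3 (f x) (g x) (h x)).
Proof.
move=> fc gc hc; apply: continuous_row => j.
rewrite (_ : (fun x => _) = if j == 0 then f else if j == 1 then g else h).
  by case: ifP => // _; case: ifP.
by apply/funext => x; rewrite mxE; case: ifP => // _; case: ifP.
Qed.

Lemma sum_row3 (u : 'rV[R]_3) :
  \sum_c u 0 c ^+ 2 = u 0 0 ^+ 2 + u 0 1 ^+ 2 + u 0 2%:R ^+ 2.
Proof.
rewrite !big_ord_recl big_ord0 addr0 addrA.
by congr (_ + u _ _ ^+ 2 + u _ _ ^+ 2); apply/val_inj.
Qed.

Definition cap (s : R) (z : 'rV[R]_2) : 'rV[R]_3 :=
  row3 (z 0 0) (z 0 1) (s * Num.sqrt (1 - (z 0 0 ^+ 2 + z 0 1 ^+ 2))).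

Definition shadow (u : 'rV[R]_3) : 'rV[R]_2 := row2 (u 0 0) (u 0 1).

Lemma continuous_cap s : continuous (cap s).
Proof.
have c0 : continuous (fun z : 'rV[R]_2 => z 0 0) by exact: coord_continuous.
have c1 : continuous (fun z : 'rV[R]_2 => z 0 1) by exact: coord_continuous.
have sq : continuous (fun r : R => r ^+ 2) by exact: exprn_continuous.
apply: continuous_row3 => //.
move=> z; apply: (@cvgM _ _ (nbhs z)); first exact: cvg_cst.
apply: (@continuous_comp _ _ _ (fun z : 'rV[R]_2 => 1 - (z 0 0 ^+ 2 + z 0 1 ^+ 2)) Num.sqrt);
  last exact: sqrt_continuous.
apply: (@cvgB _ _ _ (nbhs z)); first exact: cvg_cst.
apply: (@cvgD _ _ _ (nbhs z)).
- exact: (continuous_comp (c0 z) (sq _)).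
- exact: (continuous_comp (c1 z) (sq _)).
Qed.

Lemma continuous_shadow : continuous shadow.
Proof. by apply: continuous_row2; exact: coord_continuous. Qed.

Lemma cap_sphere s z : s ^+ 2 = 1 -> unit_ball z -> unit_sphere (cap s z).
Proof.
rewrite /unit_ball /unit_sphere /= sum_row2 sum_row3 => s1 z1.
rewrite row3_0 row3_1 row3_2 exprMn s1 mul1r sqr_sqrtr ?subr_ge0 //.
by ring.
Qed.

Lemma shadow_ball u : unit_sphere u -> unit_ball (shadow u).
Proof.
rewrite /unit_ball /unit_sphere /= sum_row2 sum_row3 row2_0 row2_1 => <-.
by rewrite lerDl sqr_ge0.
Qed.

Lemma shadowK s u : `|s| = 1 -> unit_sphere u -> 0 <= s * u 0 2%:R -> cap s (shadow u) = u.
Proof.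
rewrite /unit_sphere /= sum_row3 => s1 u1 su.
rewrite [RHS]row3E /cap /shadow row2_0 row2_1; congr row3.
have -> : 1 - (u 0 0 ^+ 2 + u 0 1 ^+ 2) = u 0 2%:R ^+ 2 by rewrite -u1; ring.
have ss : s * s = 1 by rewrite -expr2 -(real_normK (num_real _)) s1 expr1n.
by rewrite sqrtr_sqr -(mul1r `|_|) -s1 -normrM ger0_norm // mulrA ss mul1r.
Qed.

Lemma equator z s : unit_sphere z -> cap s z = row3 (z 0 0) (z 0 1) 0.
Proof.
by rewrite /unit_sphere /= sum_row2 /cap => ->; rewrite subrr sqrtr0 mulr0.
Qed.

Lemma circle_ball z : @unit_sphere R 2 z -> unit_ball z.
Proof. by rewrite /unit_sphere /unit_ball /= => ->. Qed.

(** A Mayer-Vietoris argument: the torsor is trivial on each hemisphere, a copy of the disc, and the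
    two trivialisations differ on the equator by a locally constant function, hence by a single
    integer since the circle is connected. *)
Lemma unit_sphere_torsors : trivial_torsors (@unit_sphere R 3).
Proof.
move=> W F Wn Fc.
have [sg1 sg2] : `|1 : R| = 1 /\ `|-1 : R| = 1 by rewrite normrN normr1.
have nsq (s : R) : `|s| = 1 -> s ^+ 2 = 1.
  by move=> s1; rewrite -(real_normK (num_real _)) s1 expr1n.
have capn (s : R) (z : 'rV[R]_2) (P : set 'rV[R]_3) : `|s| = 1 ->
    (\forall u \near cap s z, unit_sphere u -> P u) ->
    \forall v \near z, unit_ball v -> P (cap s v).
  move=> /nsq s1 H.
  have {}H : \forall v \near z, unit_sphere (cap s v) -> P (cap s v) :=
    continuous_cap H.
  by apply: filterS H => v /= H vb; apply: H; exact: cap_sphere.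
have sec (s : R) : `|s| = 1 -> exists f : 'rV[R]_2 -> int, forall z, unit_ball z ->
    \forall v \near z, unit_ball v ->
      f v - F (cap s z) (cap s v) = f z - F (cap s z) (cap s z).
  move=> s1; have s2 := nsq _ s1.
  apply: (@unit_ball_torsors R 1 (fun z => cap s @^-1` W (cap s z))
    (fun z v => F (cap s z) (cap s v))).
    by move=> z zb; apply: capn => //; apply: Wn; exact: cap_sphere.
  move=> x y z xb yb zb Wx Wy.
  apply: (capn s z (fun u => F (cap s x) u - F (cap s y) u = _)) => //.
  by apply: Fc => //; exact: cap_sphere.
have [f1 f1P] := sec 1 sg1.
have [f2 f2P] := sec (-1) sg2.
have eqn (z : 'rV[R]_2) (P : set 'rV[R]_2) : (\forall v \near z, unit_ball v -> P v) ->
    \forall v \near z, unit_sphere v -> P v.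
  by apply: filterS => v H /circle_ball.
have Wxx x : unit_sphere x -> W x x.
  by move=> xs; apply: (nbhs_singleton (Wn _ xs)).
have f12 z z' : unit_sphere z -> unit_sphere z' -> f1 z - f2 z = f1 z' - f2 z'.
  apply: (@locally_constant_connected _ _ _ (fun z => f1 z - f2 z)
    (@unit_circle_connected R)) => {z'}{}z zs.
  have := f1P z (circle_ball zs) => /eqn H1.
  have := f2P z (circle_ball zs) => /eqn H2.
  apply: filterS2 H1 H2 => v /= H1 H2 vs.
  move: (H1 vs) (H2 vs); rewrite !(equator _ vs) !(equator _ zs).
  by move: (F _ _) (F _ _) (f1 _) (f1 _) (f2 _) (f2 _) => *; lia.
pose e0 := row2 (1 : R) 0.
have e0s : unit_sphere e0.
  by rewrite /unit_sphere /= sum_row2 row2_0 row2_1 expr1n expr0n addr0.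
(* The section on the lower hemisphere is shifted by the constant found on the equator, so that both
   formulas agree there. *)
pose c0 := f1 e0 - f2 e0.
pose f (u : 'rV[R]_3) : int := if 0 <= u 0 2%:R then f1 (shadow u) else f2 (shadow u) + c0.
have shn (u : 'rV[R]_3) (P : set 'rV[R]_2) :
    (\forall v \near shadow u, unit_ball v -> P v) ->
    \forall w \near u, unit_sphere w -> P (shadow w).
  move=> H.
  have {}H : \forall w \near u, unit_ball (shadow w) -> P (shadow w) :=
    continuous_shadow H.
  by apply: filterS H => w /= H /shadow_ball.
have c2 : continuous (fun u : 'rV[R]_3 => u 0 2%:R) by exact: coord_continuous.
have loc1 x : unit_sphere x -> 0 <= x 0 2%:R ->
    \forall u \near x, unit_sphere u -> 0 <= u 0 2%:R ->
      f1 (shadow u) - F x u = f1 (shadow x) - F x x.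
  move=> xs x0; have := shn x _ (f1P _ (shadow_ball xs)).
  apply: filterS => u /= H us u0; move: (H us).
  by rewrite !shadowK ?mul1r.
have loc2 x : unit_sphere x -> x 0 2%:R <= 0 ->
    \forall u \near x, unit_sphere u -> u 0 2%:R <= 0 ->
      f2 (shadow u) - F x u = f2 (shadow x) - F x x.
  move=> xs x0; have := shn x _ (f2P _ (shadow_ball xs)).
  apply: filterS => u /= H us u0; move: (H us).
  by rewrite !shadowK ?mulN1r ?oppr_ge0.
exists f => x xs.
have [x0|x0|x0] := ltgtP 0 (x 0 2%:R).
- have pos : \forall u \near x, 0 < (u : 'rV[R]_3) 0 2%:R.
    exact: (c2 x [set r : R | 0 < r] (lt_nbhsr x0)).
  apply: filterS2 pos (loc1 x xs (ltW x0)) => u u0 H us.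
  by rewrite /f !ltW // H // ltW.
- have neg : \forall u \near x, (u : 'rV[R]_3) 0 2%:R < 0.
    exact: (c2 x [set r : R | r < 0] (lt_nbhsl x0)).
  apply: filterS2 neg (loc2 x xs (ltW x0)) => u u0 H us.
  by rewrite /f !leNgt u0 x0 /= addrAC H ?(ltW u0) // addrAC.
- have := loc2 x xs; have := loc1 x xs; rewrite -x0 lexx => /(_ isT) H1 /(_ isT) H2.
  apply: filterS2 H1 H2 => u H1 H2 us; rewrite /f -x0 lexx.
  case: ifPn => [u0|]; first exact: H1.
  rewrite -ltNge => u0.
  have zs : unit_sphere (shadow x).
    move: xs; rewrite /unit_sphere /= sum_row3 sum_row2 row2_0 row2_1 -x0.
    by rewrite expr0n addr0.
  move: (H2 us (ltW u0)) (f12 _ _ zs e0s); rewrite /c0.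
  by move: (F _ _) (F _ _) (f1 _) (f1 _) (f2 _) (f2 _) (f2 _) => *; lia.
Qed.

End Sphere.

(** * Paths in a face *)

Lemma near_all (T : topologicalType) (x : T) (P : set T) :
  (forall u, P u) -> \forall u \near x, P u.
Proof. by move=> H; apply: nearW. Qed.

Ltac reorder :=
  match goal with H : is_true (uniq [:: ?a; ?b; ?c; ?d]) |- _ =>
    first [exact: H | rewrite (@perm_uniq _ _ [:: a; b; c; d]) //; apply/seq.permP => ? /=; ring]
  end.

Section Tetra.
Variable R : realType.

Lemma continuous_bary c : continuous (fun x : tetra R => bary x c).
Proof.
move=> x; apply: (@continuous_comp _ _ _ (fun x : tetra R => set_val x)
  (fun v : 'rV[R]_4 => v 0 c)); first exact: initial_continuous.
exact: coord_continuous.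
Qed.

Lemma bary_ge0 (x : tetra R) c : 0 <= bary x c.
Proof. by have [] := set_valP x; move=> /(_ c). Qed.

Lemma sum_bary (x : tetra R) : \sum_c bary x c = 1.
Proof. by have [] := set_valP x. Qed.

Lemma bary_inj (x y : tetra R) : bary x =1 bary y -> x = y.
Proof. by move=> E; apply/val_inj/rowP => c; exact: E. Qed.

Lemma mem_uniq4 (s : seq 'I_4) : uniq s -> size s = 4%N -> s =i predT.
Proof.
move=> us s4; apply/subset_cardP; last by apply/fintype.subsetP.
by rewrite (card_uniqP us) s4 card_ord.
Qed.

Lemma sum_bary4 (x : tetra R) (a b c d : 'I_4) : uniq [:: a; b; c; d] ->
  bary x a + bary x b + bary x c + bary x d = 1.
Proof.
move=> abcd; rewrite -(sum_bary x).
rewrite (eq_bigl (mem [:: a; b; c; d])).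
  by rewrite -big_uniq // !big_cons big_nil /= addr0 !addrA.
by move=> i; rewrite [RHS](mem_uniq4 abcd).
Qed.

End Tetra.

(** * Signed crossings on a square *)

Section Crossing.
Variable R : realType.

Definition square : set 'rV[R]_2 :=
  [set z | 0 <= z 0 0 <= 1 /\ 0 <= z 0 1 <= 1].

Lemma square_compact : compact square.
Proof.
apply: bounded_closed_compact.
  exists 1; split => // M M1 z /= [/andP[z0 z01] /andP[z1 z11]].
  rewrite /Num.norm /= mx_normrE (le_trans _ (ltW M1)) //.
  apply: bigmax_le => // -[i c] _ /=; rewrite ord1 (row2E z) mxE.
  by case: ifP => _; rewrite ger0_norm.
have c0 : continuous (fun z : 'rV[R]_2 => z 0 0) by exact: coord_continuous.
have c1 : continuous (fun z : 'rV[R]_2 => z 0 1) by exact: coord_continuous.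
rewrite (_ : square = (fun z : 'rV[R]_2 => z 0 0) @^-1` `[0, 1] `&`
  (fun z : 'rV[R]_2 => z 0 1) @^-1` `[0, 1]); last first.
  by apply/seteqP; split=> z /=; rewrite /square /= !in_itv.
by apply: closedI; apply: closed_comp => //; exact: itv_closed.
Qed.

Lemma convex_interval (a b x y t : R) : a <= x <= b -> a <= y <= b ->
  0 <= t <= 1 -> a <= x + t * (y - x) <= b.
Proof.
move=> /andP[x0 x1] /andP[y0 y1] /andP[t0 t1]; apply/andP; split; nra.
Qed.

Lemma square_convex : convex_in square.
Proof.
move=> x y t [x0 x1] [y0 y1] t01; rewrite /square /= !mxE.
by split; exact: convex_interval.
Qed.

Variables (X Y : 'rV[R]_2 -> R).
Hypotheses (Xc : {within square, continuous X})
  (Yc : {within square, continuous Y}).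
Hypothesis XY0 : forall z, square z -> X z != 0 \/ Y z != 0.

(* The potential counts signed crossings of the curve (X, Y) with the ray
   X < 0, Y = 0: it increases by one when the ray is crossed downwards.      *)
Definition below (z u : 'rV[R]_2) : int := ((X z < 0) && (Y u < 0))%R%:Z.

Lemma near_lt0 (h : 'rV[R]_2 -> R) z : {within square, continuous h} ->
  square z -> h z < 0 -> \forall u \near z, square u -> h u < 0.
Proof.
by move=> hc Kz hz; exact: (within_continuous_near hc Kz (lt_nbhsl hz)).
Qed.

Lemma near_gt0 (h : 'rV[R]_2 -> R) z : {within square, continuous h} ->
  square z -> 0 < h z -> \forall u \near z, square u -> 0 < h u.
Proof.
by move=> hc Kz hz; exact: (within_continuous_near hc Kz (lt_nbhsr hz)).
Qed.

Lemma near_sign (h : 'rV[R]_2 -> R) z : {within square, continuous h} ->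
  square z -> h z != 0 -> \forall u \near z, square u ->
  (h u < 0) = (h z < 0) /\ h u != 0.
Proof.
move=> hc Kz; rewrite neq_lt => /orP[] hz.
  by apply: filterS (near_lt0 hc Kz hz) => u H /H hu; rewrite hu hz; split=> //; rewrite lt_eqF.
by apply: filterS (near_gt0 hc Kz hz) => u H /H hu;
  rewrite (lt_gtF hu) (lt_gtF hz) (gt_eqF hu).
Qed.

(** The local model is the indicator of [Y < 0] if [X z < 0], and zero otherwise. The first kind is
    used only where [X < 0], the second only off the closed ray [X <= 0], [Y = 0]; where they
    overlap [Y] does not vanish, so they differ by a locally constant function. *)
Lemma crossing_potential : exists f : 'rV[R]_2 -> int, forall z, square z ->
  \forall u \near z, square u -> f u - below z u = f z - below z z.
Proof.
apply: (trivial_torsors_convex square_compact square_convex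
  (W := fun z u => if X z < 0 then X u < 0 else (0 < X u) || (Y u != 0))).
  move=> z Kz; have [Xz|] := ltP (X z) 0; first exact: near_lt0.
  rewrite le_eqVlt => /orP[/eqP Xz|Xz].
    have [|Yz] := XY0 Kz; first by rewrite -Xz eqxx.
    by apply: filterS (near_sign Yc Kz Yz) => u H /H [_ ->]; rewrite orbT.
  by apply: filterS (near_gt0 Xc Kz Xz) => u H /H ->.
move=> x y z Kx Ky Kz; rewrite /below.
have [Xz|Xz] := ltP (X z) 0; last first.
  by move: (X x < 0)%R (X y < 0)%R => [] [] // _ _; apply: near_all => u _.
have [Yz|Yz] := eqVneq (Y z) 0.
  rewrite /= orbF (ltNge 0) (ltW Xz) /=.
  by move: (X x < 0)%R (X y < 0)%R => [] [] // _ _; apply: near_all => u _; rewrite !subrr.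
move=> _ _; apply: filterS (near_sign Yc Kz Yz) => u H /H[-> _].
by [].
Qed.

Variable f : 'rV[R]_2 -> int.
Hypothesis fP : forall z, square z ->
  \forall u \near z, square u -> f u - below z u = f z - below z z.

(** Reduces a side of the square to a local check: any [g] that varies locally like [below z] has
    the same total variation as [f]. *)
Lemma potential_side (S : set 'rV[R]_2) (g : 'rV[R]_2 -> int) p q :
  convex_in S -> S p -> S q -> S `<=` square ->
  (forall z, S z -> \forall u \near z, S u -> below z u - below z z = g u - g z) ->
  f p - g p = f q - g q.
Proof.
move=> cS Sp Sq SK H.
apply: (@convex_ball_connected _ _ S p q _ (fun u => f u - g u) setT) => //.
move=> z Sz _; apply: filterS2 (H z Sz) (fP (SK _ Sz)) => u {}H fu Su.
move: (H Su) (fu (SK _ Su)).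
by move: (f _) (f _) (g _) (g _) (below _ _) (below _ _) => *; lia.
Qed.

Section Side.
Variables (S : set 'rV[R]_2) (p q : 'rV[R]_2).
Hypotheses (cS : convex_in S) (Sp : S p) (Sq : S q) (SK : S `<=` square).

Lemma side_below : (forall z, S z -> X z < 0 -> Y z < 0) -> f p = f q.
Proof.
move=> H; apply: (addIr (- 0)); apply: (@potential_side S (fun=> 0) p q) => // z Sz.
rewrite /below; have [Xz|Xz] := ltP (X z) 0; last by apply: near_all.
apply: filterS (near_lt0 Xc (SK Sz) Xz) => u Xu Su.
by rewrite !H // Xu //; exact: SK.
Qed.

Lemma side_above : (forall z, S z -> X z < 0 -> 0 <= Y z) -> f p = f q.
Proof.
move=> H; apply: (addIr (- 0)); apply: (@potential_side S (fun=> 0) p q) => // z Sz.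
rewrite /below; have [Xz|Xz] := ltP (X z) 0; last by apply: near_all.
apply: filterS (near_lt0 Xc (SK Sz) Xz) => u Xu Su.
by rewrite !(ltNge (Y _)) !H // Xu //; exact: SK.
Qed.

(** The curve stays in the closed lower half plane, so [f] changes only on reaching or leaving the
    ray itself, and the indicator of the ray compensates. *)
Lemma side_down : (forall z, S z -> Y z <= 0) ->
  f p + ((X p < 0) && (Y p == 0))%:Z = f q + ((X q < 0) && (Y q == 0))%:Z.
Proof.
move=> H.
pose g u : int := - ((X u < 0) && (Y u == 0))%:Z.
have := @potential_side S g p q cS Sp Sq SK; rewrite /g !opprK; apply => z Sz.
rewrite /below; have [Xz|Xz] := ltP (X z) 0.
  apply: filterS (near_lt0 Xc (SK Sz) Xz) => u Xu Su.
  rewrite (Xu (SK Su)) /= !lt_neqAle !H // !andbT.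
  by case: (Y u == 0); case: (Y z == 0).
move: Xz; rewrite le_eqVlt => /orP[/eqP Xz|Xz].
  have [|Yz] := XY0 (SK Sz); first by rewrite -Xz eqxx.
  apply: filterS (near_sign Yc (SK Sz) Yz) => u Yu Su.
  by have [_ /negPf ->] := Yu (SK Su); rewrite (negPf Yz) !andbF.
apply: filterS (near_gt0 Xc (SK Sz) Xz) => u Xu Su.
by rewrite (lt_gtF (Xu (SK Su))).
Qed.

(** At the points where [X = 0] the local model is zero, but [Y] keeps a constant nonzero sign
    there, so the indicator of [Y < 0] is still a primitive. *)
Lemma side_left : (forall z, S z -> X z <= 0) ->
  f p - (Y p < 0)%R%:Z = f q - (Y q < 0)%R%:Z.
Proof.
move=> H.
apply: (@potential_side S (fun u => (Y u < 0)%R%:Z) p q) => // z Sz.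
rewrite /below; have [Xz|Xz] := ltP (X z) 0; first by apply: near_all.
have {}Xz : X z = 0 by apply/eqP; rewrite eq_le Xz H.
have [|Yz] := XY0 (SK Sz); first by rewrite Xz eqxx.
apply: filterS (near_sign Yc (SK Sz) Yz) => u Yu Su.
by have [-> _] := Yu (SK Su); rewrite !subrr.
Qed.

End Side.

End Crossing.

Section DisjointPaths.
Variables (R : realType) (p q : R -> tetra R).
Hypotheses (pc : {within `[0, 1], continuous p})
  (qc : {within `[0, 1], continuous q}).
Hypothesis pq : forall s t : R, 0 <= s <= 1 -> 0 <= t <= 1 -> p s <> q t.
Variables f u b c : 'I_4.
Hypothesis fubc : uniq [:: f; u; b; c].
Hypotheses (pf : forall t : R, 0 <= t <= 1 -> bary (p t) f = 0)
  (qf : forall t : R, 0 <= t <= 1 -> bary (q t) f = 0).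

(** The difference [p s - q t] maps the square of the parameters to a plane and avoids the origin
    because the paths are disjoint. Its winding number along the boundary of the square is therefore
    zero. *)
Let D (e : 'I_4) (z : 'rV[R]_2) := bary (p (z 0 0)) e - bary (q (z 0 1)) e.

Lemma difference_continuous e : {within @square R, continuous (D e)}.
Proof.
have coord (h : R -> tetra R) (j : 'I_2) : {within `[0, 1], continuous h} ->
    {within @square R, continuous (fun z : 'rV[R]_2 => bary (h (z 0 j)) e)}.
  move=> hc; apply: near_within_continuous => z P Kz PP.
  have z01 (w : 'rV[R]_2) : square w -> `[0, 1]%classic (w 0 j).
    rewrite /square /= in_itv /= => -[w0 w1].
    by case: j {hc PP} => [[|[|//]] ij]; [rewrite (_ : Ordinal _ = 0)|
      rewrite (_ : Ordinal _ = 1)] => //; exact/val_inj.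
  have H1 : \forall x \near h (z 0 j), P (bary x e) := continuous_bary PP.
  have H2 := within_continuous_near hc (z01 _ Kz) H1.
  have H3 : \forall w \near z, `[0, 1]%classic ((w : 'rV[R]_2) 0 j) ->
    P (bary (h (w 0 j)) e) := @coord_continuous _ _ _ 0 j z _ H2.
  by apply: filterS H3 => w H /z01.
by move=> z; apply: (@cvgB _ _ _ (nbhs z)); exact: coord.
Qed.

Lemma difference_sum z : square z -> D u z + D b z + D c z = 0.
Proof.
move=> [z0 z1]; have := sum_bary4 (p (z 0 0)) fubc.
have := sum_bary4 (q (z 0 1)) fubc; rewrite pf // qf // /D.
by move: (bary _ _) (bary _ _) (bary _ _) (bary _ _) (bary _ _) (bary _ _) => *; lra.
Qed.

Lemma difference_neq0 z : square z -> D u z = 0 -> D b z = 0 -> D c z = 0 -> False.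
Proof.
move=> [z0 z1] /subr0_eq Du /subr0_eq Db /subr0_eq Dc.
apply: (pq z0 z1); apply: bary_inj => i.
have := mem_uniq4 fubc erefl i; rewrite !inE.
by case/or4P => /eqP -> //; rewrite pf ?qf.
Qed.

Let sq (s t : R) : 0 <= s <= 1 -> 0 <= t <= 1 -> @square R (row2 s t).
Proof. by rewrite /square /= row2_0 row2_1. Qed.

Let le00 : 0 <= (0:R) <= 1. Proof. by rewrite lexx ler01. Qed.
Let le11 : 0 <= (1:R) <= 1. Proof. by rewrite ler01 lexx. Qed.

Let side j (r : R) : set 'rV[R]_2 := [set z | square z /\ z 0 j = r].

Let side_convex j r : convex_in (side j r).
Proof.
move=> x y t [Kx xr] [Ky yr] t01; split; first exact: square_convex.
by rewrite !mxE xr yr subrr mulr0 addr0.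
Qed.

Let side_square j r : side j r `<=` @square R. Proof. by move=> z []. Qed.

Let side0 (s t : R) : 0 <= s <= 1 -> 0 <= t <= 1 -> side 0 s (row2 s t).
Proof. by split; [exact: sq|exact: row2_0]. Qed.

Let side1 (s t : R) : 0 <= s <= 1 -> 0 <= t <= 1 -> side 1 t (row2 s t).
Proof. by split; [exact: sq|exact: row2_1]. Qed.

(** In the triangle [u b c], the path [p] cuts off [c], the path [q] cuts off [b], and both end on
    [bc]. On each side of the square one of the points is on an edge of the triangle, which confines
    the difference to a half plane. If the ends were in the wrong order, the boundary would cross
    the ray exactly once and the potential would not return to its value. *)
Lemma disjoint_paths_across :
  bary (p 0) b = 0 -> bary (p 1) u = 0 -> bary (q 0) c = 0 ->
  bary (q 1) u = 0 -> 0 < bary (q 0) u -> bary (p 1) b < bary (q 1) b.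
Proof.
move=> p0 p1 q0 q1 q0u; rewrite ltNge; apply/negP => le_qp.
have Xc : {within @square R, continuous (fun z => - D b z)}.
  by move=> z; apply: (@cvgN _ _ _ (nbhs z)); exact: difference_continuous.
have Yc := @difference_continuous u.
have XY0 z : square z -> - D b z != 0 \/ D u z != 0.
  move=> Kz; rewrite oppr_eq0; have [Db|_] := eqVneq (D b z) 0; last by left.
  have [Du|_] := eqVneq (D u z) 0; last by right.
  by have := difference_sum Kz; rewrite Db Du !add0r => /(difference_neq0 Kz Du Db).
have [g gP] := crossing_potential Xc Yc XY0.
have E1 : g (row2 0 0) = g (row2 0 1).
  apply: (side_below Xc gP (@side_convex 0 0) (side0 le00 le00)
    (side0 le00 le11) (@side_square 0 0)).
  move=> z [_ z0]; rewrite /D z0 p0 sub0r opprK => H.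
  by move: (le_lt_trans (bary_ge0 _ _) H); rewrite ltxx.
have E2 : g (row2 0 1) = g (row2 1 1).
  apply: (side_above Xc gP (@side_convex 1 1) (side1 le00 le11)
    (side1 le11 le11) (@side_square 1 1)).
  by move=> z [_ z1] _; rewrite /D z1 q1 subr0 bary_ge0.
have E3 : g (row2 1 0) = g (row2 0 0).
  apply: (side_below Xc gP (@side_convex 1 0) (side1 le11 le00)
    (side1 le00 le00) (@side_square 1 0)).
  move=> z [Kz z1]; have := difference_sum Kz.
  have : 0 <= D c z by rewrite /D z1 q0 subr0 bary_ge0.
  by move: (D _ _) (D _ _) (D _ _) => *; lra.
have side_p1 z : side 0 1 z -> D u z <= 0.
  by move=> [_ z0]; rewrite /D z0 p1 sub0r oppr_le0 bary_ge0.
have := side_down Xc Yc XY0 gP (@side_convex 0 1) (side0 le11 le11)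
  (side0 le11 le00) (@side_square 0 1) side_p1.
have same_end : bary (p 1) b != bary (q 1) b.
  apply/eqP => Eb; apply: (@difference_neq0 (row2 1 1)); rewrite ?/D ?row2_0 ?row2_1.
  - exact: sq.
  - by rewrite p1 q1 subrr.
  - by rewrite Eb subrr.
  - have := difference_sum (sq le11 le11); rewrite /D !row2_0 !row2_1.
    by rewrite p1 q1 Eb !subrr !add0r.
rewrite E3 E1 E2 /D !row2_0 !row2_1 p1 q1 subrr eqxx andbT !sub0r oppr_eq0.
rewrite (gt_eqF q0u) andbF oppr_lt0 subr_gt0 lt_neqAle eq_sym same_end le_qp /=.
by move: (g _); clear=> *; lia.
Qed.

(** Both paths go around [b], from the edge [ub] to the edge [bc]. Exchanging their order on the way
    would again make the difference wind once around the origin; the ray is now taken in the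
    coordinates of [u] and [c]. *)
Lemma disjoint_paths_parallel :
  bary (p 0) c = 0 -> bary (p 1) u = 0 -> bary (q 0) c = 0 ->
  bary (q 1) u = 0 -> 0 < bary (p 1) c -> 0 < bary (q 1) c ->
  bary (q 0) b < bary (p 0) b -> bary (q 1) b < bary (p 1) b.
Proof.
move=> p0 p1 q0 q1 p1c q1c lt_qp; rewrite ltNge; apply/negP => le_pq.
have Xc := @difference_continuous u.
have Yc := @difference_continuous c.
have XY0 z : square z -> D u z != 0 \/ D c z != 0.
  move=> Kz; have [Du|_] := eqVneq (D u z) 0; last by left.
  have [Dc|_] := eqVneq (D c z) 0; last by right.
  by have := difference_sum Kz; rewrite Dc Du add0r addr0 =>
    /(difference_neq0 Kz Du)/(_ Dc).
have [g gP] := crossing_potential Xc Yc XY0.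
have E1 : g (row2 0 1) = g (row2 1 1).
  apply: (side_below Xc gP (@side_convex 1 1) (side1 le00 le11)
    (side1 le11 le11) (@side_square 1 1)).
  move=> z [_ z1]; rewrite /D z1 q1 subr0 => H.
  by move: (le_lt_trans (bary_ge0 _ _) H); rewrite ltxx.
have E2 : g (row2 1 0) = g (row2 0 0).
  apply: (side_above Xc gP (@side_convex 1 0) (side1 le11 le00)
    (side1 le00 le00) (@side_square 1 0)).
  by move=> z [_ z1] _; rewrite /D z1 q0 subr0 bary_ge0.
have side_q1 z : side 0 1 z -> D u z <= 0.
  by move=> [_ z0]; rewrite /D z0 p1 sub0r oppr_le0 bary_ge0.
have side_p0 z : side 0 0 z -> D c z <= 0.
  by move=> [_ z0]; rewrite /D z0 p0 sub0r oppr_le0 bary_ge0.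
have := side_left Yc XY0 gP (@side_convex 0 1)
  (side0 le11 le11) (side0 le11 le00) (@side_square 0 1) side_q1.
have := side_down Xc Yc XY0 gP (@side_convex 0 0)
  (side0 le00 le00) (side0 le00 le11) (@side_square 0 0) side_p0.
have S0 := difference_sum (sq le00 le00).
have S1 := difference_sum (sq le11 le11).
have same_end : bary (p 1) b != bary (q 1) b.
  apply/eqP => Eb; apply: (@difference_neq0 (row2 1 1)); rewrite ?/D ?row2_0 ?row2_1.
  - exact: sq.
  - by rewrite p1 q1 subrr.
  - by rewrite Eb subrr.
  - by move: S1; rewrite /D !row2_0 !row2_1 p1 q1 Eb !subrr !add0r.
have X0 : D u (row2 0 0) < 0.
  move: S0 lt_qp; rewrite /D !row2_0 !row2_1 p0 q0.
  by move: (bary _ _) (bary _ _) (bary _ _) (bary _ _) => *; lra.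
have Y1 : 0 < D c (row2 1 1).
  have {}le_pq : bary (p 1) b < bary (q 1) b by rewrite lt_neqAle same_end.
  move: S1 le_pq; rewrite /D !row2_0 !row2_1 p1 q1.
  by move: (bary _ _) (bary _ _) (bary _ _) (bary _ _) => *; lra.
rewrite X0 (lt_gtF Y1) E1 E2 /D !row2_0 !row2_1 p0 q0 !subrr eqxx !sub0r !subr0.
rewrite oppr_eq0 (gt_eqF q1c) andbF (lt_gtF p1c) /=.
by move: (g _) (g _); clear=> *; lia.
Qed.

End DisjointPaths.

(** * Arcs of normal discs *)

Section Cuts.

(* In the face opposite to [f], a disc of type [t] has an arc that cuts off the
   vertex [v] (and at most one such arc).                                    *)
Definition cuts (t : disc_type) (f v : 'I_4) : bool :=
  (f != v) && match t with
  | Tri u => v == u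
  | Quad j => paired j f v
  | Oct j => ~~ paired j f v
  end.

Lemma pairedE j a b : paired j a b =
  (((a == ord0) || (a == lift ord0 j)) == ((b == ord0) || (b == lift ord0 j))).
Proof. by rewrite /paired !inE. Qed.

Lemma crossingsE t f a b : a != b -> f != a -> f != b ->
  crossings t a b = (cuts t f a + cuts t f b)%N.
Proof.
case: t => [u|j|j] /=; rewrite /cuts ?pairedE.
- case: u => [[|[|[|[|//]]]] ?]; case: a => [[|[|[|[|//]]]] ?];
  case: b => [[|[|[|[|//]]]] ?] => // _; by case: f => [[|[|[|[|//]]]] ?].
- case: j => [[|[|[|//]]] ?]; case: a => [[|[|[|[|//]]]] ?];
  case: b => [[|[|[|[|//]]]] ?] => // _; by case: f => [[|[|[|[|//]]]] ?].
- case: j => [[|[|[|//]]] ?]; case: a => [[|[|[|[|//]]]] ?];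
  case: b => [[|[|[|[|//]]]] ?] => // _; by case: f => [[|[|[|[|//]]]] ?].
Qed.

Lemma sum_uniq4 (V : nmodType) (F : 'I_4 -> V) (a b c d : 'I_4) :
  uniq [:: a; b; c; d] -> \sum_i F i = F a + F b + F c + F d.
Proof.
move=> abcd; rewrite (eq_bigl (mem [:: a; b; c; d])).
  by rewrite -big_uniq // !big_cons big_nil /= addr0 !addrA.
by move=> i; rewrite [RHS](mem_uniq4 abcd).
Qed.

Lemma sum_cuts t : (\sum_f \sum_v cuts t f v)%N = sides t.
Proof.
rewrite !big_ord_recl !big_ord0 /cuts.
case: t => [[[|[|[|[|//]]]] ?]|j|j] //=; rewrite ?pairedE;
case: j => [[|[|[|//]]] ?]; by rewrite ?pairedE.
Qed.

Lemma uniq4_complete (f v : 'I_4) : f != v ->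
  exists a b, uniq [:: f; v; a; b].
Proof.
move=> fv; have : #|~: [set f; v]%SET| == 2%N by rewrite cardsCs finset.setCK cards2 fv card_ord.
case/cards2P => a [b [ab E]]; exists a, b.
have : a \in ~: [set f; v]%SET by rewrite E !inE eqxx.
have : b \in ~: [set f; v]%SET by rewrite E !inE eqxx orbT.
rewrite !inE !negb_or /= !inE !negb_or fv ab.
by rewrite !(eq_sym f) !(eq_sym v) => /andP[-> ->] /andP[-> ->].
Qed.

End Cuts.

Section Arcs.
Variable R : realType.

(** All that the comparison of disjoint arcs needs from an arc: a path across the corner at [v], in
    either direction since [a] and [b] may be exchanged. *)
Definition cut_arc (f v : 'I_4) (A : set (tetra R)) :=
  forall a b, uniq [:: f; v; a; b] -> exists h : R -> tetra R,
    [/\ {within `[0, 1], continuous h},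
        forall t : R, 0 <= t <= 1 -> A (h t) /\ bary (h t) f = 0,
        open_face [set v; a]%SET (h 0) & open_face [set v; b]%SET (h 1)].

Lemma open_faceP (x : tetra R) a b c d : uniq [:: a; b; c; d] ->
  open_face [set a; b]%SET x <-> [/\ 0 < bary x a, 0 < bary x b, bary x c = 0 & bary x d = 0].
Proof.
move=> abcd; split=> [xab|[xa xb xc xd] i].
  have z i : i \notin [set a; b]%SET -> bary x i = 0.
    by rewrite -xab lt_neqAle bary_ge0 andbT negbK eq_sym => /eqP.
  split; rewrite ?xab ?z // !inE ?eqxx ?orbT //.
    by move: abcd; rewrite /= !inE !negb_or !(eq_sym c) => /and4P[/and3P[_ -> _] /andP[-> _]].
  by move: abcd; rewrite /= !inE !negb_or !(eq_sym d) => /and4P[/and3P[_ _ ->] /andP[_ ->]].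
move: abcd; rewrite /= !inE !negb_or !andbT => /and3P[/and3P[ab ac ad] /andP[bc bd] cd].
have := mem_uniq4 (s := [:: a; b; c; d]).
rewrite /= !inE !negb_or ab ac ad bc bd cd => /(_ isT erefl i).
rewrite !inE => /or4P[]/eqP ->; rewrite ?eqxx ?orbT ?xa ?xb //.
  by rewrite xc ltxx !(eq_sym c) (negPf ac) (negPf bc).
by rewrite xd ltxx !(eq_sym d) (negPf ad) (negPf bd).
Qed.

Lemma path_reverse (h : R -> tetra R) : {within `[0, 1], continuous h} ->
  {within `[0, 1], continuous (fun t => h (1 - t))}.
Proof.
move=> hc; apply: near_within_continuous => t P /=; rewrite in_itv /= => t01.
have t01' : `[0, 1]%classic (1 - t) by rewrite /= in_itv /=; lra.
move=> /(within_continuous_near hc t01') H.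
have cm : continuous (fun t : R => 1 - t).
  by move=> u; apply: cvgB; [exact: cvg_cst|exact: cvg_id].
have {}H : \forall u \near t, `[0, 1]%classic (1 - u) -> P (h (1 - u)) := cm t _ H.
apply: filterS H => u; rewrite /= !in_itv /= => H u01; apply: H; lra.
Qed.

Lemma edge_pair (f : 'I_4) (e e' : {set 'I_4}) : #|e| = 2%N -> #|e'| = 2%N ->
  e != e' -> f \notin e -> f \notin e' ->
  exists v a b, [/\ uniq [:: f; v; a; b], e = [set v; a]%SET & e' = [set v; b]%SET].
Proof.
move=> /eqP/cards2P[x [y [xy ->]]] /eqP/cards2P[z [w [zw ->]]] ee' fe fe'.
have U v a b : v != a -> v != b -> [set v; a]%SET != [set v; b]%SET -> f \notin [set v; a]%SET ->
    f \notin [set v; b]%SET -> uniq [:: f; v; a; b].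
  move=> va vb ab; rewrite !inE !negb_or /= !inE !negb_or va vb => /andP[-> ->] /andP[_ ->].
  by rewrite !andbT /=; apply: contra ab => /eqP ->.
have [xz|xz] := eqVneq x z.
  by exists x, y, w; subst z; split=> //; exact: U.
have [xw|xw] := eqVneq x w.
  subst w; rewrite (finset.setUC [set z]%SET) in ee' fe' *.
  by exists x, y, z; split=> //; apply: U => //; rewrite eq_sym.
have [yz|yz] := eqVneq y z.
  subst z; rewrite (finset.setUC [set x]%SET) in ee' fe *.
  by exists y, x, w; split=> //; apply: U => //; rewrite eq_sym.
have [yw|yw] := eqVneq y w.
  subst w; rewrite (finset.setUC [set x]%SET) (finset.setUC [set z]%SET) in ee' fe fe' *.
  by exists y, x, z; split=> //; apply: U => //; rewrite eq_sym.
have U4 : uniq [:: x; y; z; w] by rewrite /= !inE !negb_or xy xz xw yz yw zw.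
have := mem_uniq4 U4 erefl f; move: fe fe'; rewrite !inE !negb_or.
by case/andP => /negPf -> /negPf -> /andP[/negPf -> /negPf ->].
Qed.

Lemma normal_arc_cut f (A : set (tetra R)) : normal_arc f A ->
  exists2 v, f != v & cut_arc f v A.
Proof.
move=> [e [e' [h [[e2 e2' ee' fe fe'] hc hi AE [h0 h1 ht]]]]].
have [v [a [b [fvab E E']]]] := edge_pair e2 e2' ee' fe fe'.
have Ah (t : R) : 0 <= t <= 1 -> A (h t) /\ bary (h t) f = 0.
  move=> t01; split; first by rewrite AE; exists t => //=; rewrite in_itv.
  have z (V : {set 'I_4}) : f \notin V -> open_face V (h t) -> bary (h t) f = 0.
    by move=> + /(_ f) => /negPf ->; rewrite lt_neqAle bary_ge0 andbT => /negbFE/eqP.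
  move: t01; rewrite !le_eqVlt => /andP[/orP[/eqP t0|t0] /orP[/eqP t1|t1]].
  - by move: t1; rewrite -t0 => /eqP; rewrite eq_sym oner_eq0.
  - by rewrite -t0 in z *; exact: z h0.
  - by rewrite t1 in z *; exact: z h1.
  - by apply: z (ht _ _); rewrite ?t0 ?t1 // !inE eqxx.
exists v.
  by move: fvab; rewrite /= !inE !negb_or => /andP[/andP[]].
move=> a' b' fvab'.
have [aa'|aa'] := eqVneq a' a.
  have bb' : b' = b.
    have := mem_uniq4 fvab erefl b'; rewrite !inE.
    move: fvab'; rewrite aa' /= !inE !negb_or !(eq_sym _ b') => /and4P[].
    by move=> /and3P[_ _ /negPf ->] /andP[_ /negPf ->] /negPf -> _ /eqP.
  by exists h; split=> //; rewrite ?aa' ?bb' -?E -?E'.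
have ba' : a' = b.
  have := mem_uniq4 fvab erefl a'; rewrite !inE (negPf aa').
  move: fvab'; rewrite /= !inE !negb_or !(eq_sym _ a') => /and4P[].
  by move=> /and3P[_ /negPf -> _] /andP[/negPf -> _] _ _ /eqP.
have ab' : b' = a.
  have := mem_uniq4 fvab erefl b'; rewrite !inE.
  move: fvab'; rewrite ba' /= !inE !negb_or !(eq_sym _ b') => /and4P[].
  by move=> /and3P[_ _ /negPf ->] /andP[_ /negPf ->] /negPf ->; rewrite orbF => _ /eqP.
exists (fun t => h (1 - t)); split.
- exact: path_reverse.
- by move=> t t01; apply: Ah; lra.
- by rewrite subr0 ba' -E'.
- by rewrite subrr ab' -E.
Qed.

Lemma card_le_crossings (T : finType) (P : {set T}) (D : set (tetra R)) (m : nat)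
    (e : T -> tetra R) :
  (D #= `I_m)%card -> (forall k, k \in P -> D (e k)) ->
  {in P &, injective e} -> (#|P| <= m)%N.
Proof.
move=> /pcard_eqP/bijPex[g gb] De ei.
case: m gb => [|m] gb.
  rewrite leqn0 cards_eq0; apply/eqP/setP => k; rewrite inE; apply/negP => kP.
  by case: gb => /(_ _ (De _ kP)).
pose h k : 'I_m.+1 := inord (g (e k)).
have hi : {in P &, injective h}.
  move=> k l kP lP /(congr1 val); case: gb => g1 gi _.
  rewrite /h /= !inordK; [|exact: (g1 _ (De _ lP))|exact: (g1 _ (De _ kP))].
  by move=> /(gi _ _ (mem_set (De _ kP)) (mem_set (De _ lP))); exact: ei.
by rewrite -(card_in_imset hi) (leq_trans (max_card _)) // card_ord.
Qed.

(** The type of a disc is given by its intersections with the edges; this recovers its arcs. Arcs of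
    a face have distinct ends, so on each edge of the face there are at most as many ends as
    crossings. Since the number of arcs is [sides t], all these inequalities are equalities, and in
    each face they determine the number of arcs at each vertex. *)
Lemma normal_disc_arcs t (D : set (tetra R)) : normal_disc t D ->
  exists A : 'I_4 -> 'I_4 -> set (tetra R),
  (forall f v, cuts t f v -> A f v `<=` D /\ cut_arc f v (A f v)) /\
  (forall f v v', cuts t f v -> cuts t f v' -> v != v' ->
     A f v `&` A f v' = set0).
Proof.
move=> [arc [face [[hh [_ _ _ _ DB]] arcN arcD _ cr]]].
have arcsub k x : arc k x -> D x.
  move=> ax; have : (\bigcup_k arc k) x by exists k.
  by rewrite -DB => -[].
have /choice[cv cvP] : forall k, exists v, face k != v /\ cut_arc (face k) v (arc k).
  by move=> k; have [v] := normal_arc_cut (arcN k); exists v.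
pose P f v := [set k | (face k == f) && (cv k == v)]%SET.
have P0 f : P f f = finset.set0.
  apply/setP => k; rewrite !inE; apply/negP => /andP[/eqP fk /eqP ck].
  by have [] := cvP k; rewrite fk ck eqxx.
have cross f a b c : uniq [:: f; a; b; c] ->
    (#|P f a| + #|P f b| <= cuts t f a + cuts t f b)%N.
  move=> fabc; have fabc' := fabc.
  move: fabc'; rewrite /= !inE !negb_or => /and3P[/and3P[fa fb fc] /andP[ab ac] /andP[bc _]].
  rewrite -crossingsE //.
  have PD : P f a :&: P f b = finset.set0.
    apply/setP => k; rewrite !inE; apply/negP => /andP[/andP[_ /eqP ->] /andP[_]].
    by rewrite (negPf ab).
  rewrite -cardsUI PD cards0 addn0.
  have ends k : k \in (P f a :|: P f b)%SET -> exists x,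
      arc k x /\ (D `&` @closed_face R [set a; b]%SET) x.
    have abfc : uniq [:: a; b; f; c].
      by rewrite /= !inE !negb_or ab ac bc !(eq_sym _ f) fa fb fc.
    rewrite !inE -andb_orr => /andP[/eqP fk cvk].
    have [x [Ax xf]] : exists x, arc k x /\ open_face [set a; b]%SET x.
      have [_] := cvP k; rewrite fk; case/orP: cvk => /eqP ->.
        move=> /(_ b c fabc)[h [_ hA h0 _]]; exists (h 0); split=> //.
        by have [] := hA 0; rewrite ?lexx ?ler01.
      have fbac : uniq [:: f; b; a; c].
        by rewrite /= !inE !negb_or fa fb fc ac bc eq_sym ab.
      move=> /(_ a c fbac)[h [_ hA h0 _]]; exists (h 0); split=> //.
        by have [] := hA 0; rewrite ?lexx ?ler01.
      by rewrite finset.setUC.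
    exists x; split=> //; split; first exact: arcsub Ax.
    by move=> i iab; have := xf i; rewrite (negPf iab) lt_neqAle bary_ge0 andbT => /negbFE/eqP.
  have /choice[e eP] : forall k, exists x, k \in (P f a :|: P f b)%SET ->
      arc k x /\ (D `&` @closed_face R [set a; b]%SET) x.
    move=> k; have [/ends[x xP]|_] := boolP (k \in (P f a :|: P f b)%SET).
      by exists x.
    have [x _] : exists x : tetra R, True.
      by case: (arcN k) => ? [? [h _]]; exists (h 0).
    by exists x.
  apply: (@card_le_crossings _ (P f a :|: P f b)%SET _ _ e (cr a b ab)).
    by move=> k /eP[].
  move=> k l kP lP ekl; apply: contrapT => /eqP kl.
  have [ak _] := eP k kP; have [al _] := eP l lP.
  have fkl : face k = face l.
    by move: kP lP; rewrite !inE -!andb_orr => /andP[/eqP -> _] /andP[/eqP -> _].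
  have : (arc k `&` arc l) (e k) by split; rewrite // ekl.
  by rewrite (arcD _ _ kl fkl).
have total : (\sum_f \sum_v #|P f v| = \sum_f \sum_v cuts t f v)%N.
  rewrite sum_cuts; transitivity (\sum_(k < sides t) 1)%N; last first.
    by rewrite sum1_card card_ord.
  transitivity (\sum_f \sum_v \sum_(k < sides t) ((face k == f) && (cv k == v)))%N.
    apply: eq_bigr => f _; apply: eq_bigr => v _.
    rewrite -sum1_card big_mkcond /=; apply: eq_bigr => k _; rewrite inE.
    by case: ifP.
  under eq_bigr do rewrite exchange_big /=.
  rewrite exchange_big /=; apply: eq_bigr => k _.
  rewrite (bigD1 (face k)) //= (bigD1 (cv k)) //= !eqxx /= big1 ?big1 // => [f|v].
    by rewrite eq_sym => /negPf fk; rewrite big1 // => v _; rewrite fk.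
  by rewrite eq_sym => /negPf ->.
have ex f v : cuts t f v -> exists k, face k = f /\ cv k = v.
  move=> c; have fv : f != v by case/andP: c.
  suff : (0 < #|P f v|)%N.
    by move=> /card_gt0P[k]; rewrite inE => /andP[/eqP ? /eqP ?]; exists k.
  have [a [b fvab]] := uniq4_complete fv.
  (* Twelve inequalities, one for each edge of each face, are confronted with the total number of
     arcs. *)
  move: total; rewrite !(sum_uniq4 _ fvab) !P0 c.
  have cff i : cuts t i i = false by rewrite /cuts eqxx.
  rewrite !cff.
  have [u1 u2 u3] : [/\ uniq [:: f; v; a; b], uniq [:: f; v; b; a] & uniq [:: f; a; b; v]].
    by split; reorder.
  have [u4 u5 u6] : [/\ uniq [:: v; f; a; b], uniq [:: v; f; b; a] & uniq [:: v; a; b; f]].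
    by split; reorder.
  have [u7 u8 u9] : [/\ uniq [:: a; v; f; b], uniq [:: a; v; b; f] & uniq [:: a; f; b; v]].
    by split; reorder.
  have [v1 v2 v3] : [/\ uniq [:: b; v; a; f], uniq [:: b; v; f; a] & uniq [:: b; a; f; v]].
    by split; reorder.
  move: (cross _ _ _ _ u1) (cross _ _ _ _ u2) (cross _ _ _ _ u3).
  move: (cross _ _ _ _ u4) (cross _ _ _ _ u5) (cross _ _ _ _ u6).
  move: (cross _ _ _ _ u7) (cross _ _ _ _ u8) (cross _ _ _ _ u9).
  move: (cross _ _ _ _ v1) (cross _ _ _ _ v2) (cross _ _ _ _ v3).
  rewrite c !cards0 /= !addr0 ?add0r /GRing.add /=.
  do 11!move: (#|P _ _|) => ?; move: #|P f v| => ?.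
  do 11!move: (nat_of_bool (cuts _ _ _)) => ?.
  clear; lia.
pose A f v := if [pick k | (face k == f) && (cv k == v)] is Some k then arc k else set0.
exists A; split=> [f v /ex[k [fk cvk]]|f v v' /ex[k [fk cvk]] /ex[k' [fk' cvk']] vv'].
  rewrite /A; case: pickP => [l /andP[/eqP <- /eqP <-]|/(_ k)]; last by rewrite fk cvk !eqxx.
  by split; [exact: arcsub|have [] := cvP l].
rewrite /A; case: pickP => [l /andP[/eqP fl /eqP cl]|/(_ k)]; last by rewrite fk cvk !eqxx.
case: pickP => [l' /andP[/eqP fl' /eqP cl']|/(_ k')]; last by rewrite fk' cvk' !eqxx.
apply: arcD; last by rewrite fl fl'.
by apply: contra vv' => /eqP ll'; rewrite -cl -cl' ll'.
Qed.

End Arcs.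

(** * Incompatible types of discs in one tetrahedron *)

Section DisjointDiscs.
Variable R : realType.
Implicit Types (D A : set (tetra R)) (x y : tetra R).

Lemma cut_across f u b c A1 A2 : uniq [:: f; u; b; c] ->
  cut_arc f c A1 -> cut_arc f b A2 -> A1 `&` A2 = set0 ->
  exists x y, [/\ A1 x, A2 y, open_face [set b; c]%SET x,
    open_face [set b; c]%SET y & bary x b < bary y b].
Proof.
move=> fubc c1 c2 A12.
have u1 : uniq [:: f; c; u; b] by reorder.
have u2 : uniq [:: f; b; u; c] by reorder.
have u3 : uniq [:: c; u; b; f] by reorder.
have u4 : uniq [:: c; b; u; f] by reorder.
have u5 : uniq [:: b; u; c; f] by reorder.
have u6 : uniq [:: b; c; u; f] by reorder.
have [p [pc pA p0 p1]] := c1 _ _ u1.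
have [q [qc qA q0 q1]] := c2 _ _ u2.
have le11 : 0 <= (1:R) <= 1 by rewrite ler01 lexx.
exists (p 1), (q 1); split => //.
- by have [] := pA 1 le11.
- by have [] := qA 1 le11.
- by rewrite finset.setUC.
have [_ _ p0b _] := (open_faceP _ u3).1 p0.
have [_ _ p1u _] := (open_faceP _ u4).1 p1.
have [_ q0u q0c _] := (open_faceP _ u5).1 q0.
have [_ _ q1u _] := (open_faceP _ u6).1 q1.
apply: (disjoint_paths_across pc qc _ fubc) => // [s t s01 t01 pq|t t01|t t01].
- have : (A1 `&` A2) (p s) by split; [have [] := pA s s01|rewrite pq; have [] := qA t t01].
  by rewrite A12.
- by have [] := pA t t01.
- by have [] := qA t t01.
Qed.

Lemma cut_parallel f u b c A1 A2 : uniq [:: f; u; b; c] ->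
  cut_arc f b A1 -> cut_arc f b A2 -> A1 `&` A2 = set0 ->
  exists x1 y1 x2 y2, [/\ A1 x1 /\ A1 y1, A2 x2 /\ A2 y2,
    open_face [set b; u]%SET x1 /\ open_face [set b; c]%SET y1,
    open_face [set b; u]%SET x2 /\ open_face [set b; c]%SET y2 &
    (bary x2 b < bary x1 b -> bary y2 b < bary y1 b)].
Proof.
move=> fubc c1 c2 A12.
have u2 : uniq [:: f; b; u; c] by reorder.
have u5 : uniq [:: b; u; c; f] by reorder.
have u6 : uniq [:: b; c; u; f] by reorder.
have [p [pc pA p0 p1]] := c1 _ _ u2.
have [q [qc qA q0 q1]] := c2 _ _ u2.
have le11 : 0 <= (1:R) <= 1 by rewrite ler01 lexx.
have le00 : 0 <= (0:R) <= 1 by rewrite ler01 lexx.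
have [p0A _] := pA 0 le00; have [p1A _] := pA 1 le11.
have [q0A _] := qA 0 le00; have [q1A _] := qA 1 le11.
exists (p 0), (p 1), (q 0), (q 1); split => //.
have [_ _ p0c _] := (open_faceP _ u5).1 p0.
have [_ p1c p1u _] := (open_faceP _ u6).1 p1.
have [_ _ q0c _] := (open_faceP _ u5).1 q0.
have [_ q1c q1u _] := (open_faceP _ u6).1 q1.
apply: (disjoint_paths_parallel pc qc _ fubc) => // [s t s01 t01 pq|t t01|t t01].
- have : (A1 `&` A2) (p s) by split; [have [] := pA s s01|rewrite pq; have [] := qA t t01].
  by rewrite A12.
- by have [] := pA t t01.
- by have [] := qA t t01.
Qed.

Lemma open_face_closed (V : {set 'I_4}) x : open_face V x -> closed_face V x.
Proof.
by move=> xV c cV; have := xV c; rewrite (negPf cV) lt_neqAle bary_ge0 andbT => /negbFE/eqP.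
Qed.

Section Crossings.
Variables (t : disc_type) (D : set (tetra R)) (a b : 'I_4).
Hypotheses (tD : normal_disc t D) (ab : a != b).

Lemma crossing_unique x y : crossings t a b = 1%N -> D x -> D y ->
  open_face [set a; b]%SET x -> open_face [set a; b]%SET y -> x = y.
Proof.
have [? [? [_ _ _ _ /(_ a b ab) cr]]] := tD => c1 Dx Dy /open_face_closed xab /open_face_closed yab.
rewrite c1 in cr; apply: contrapT => xy.
have := @card_le_crossings R bool [set: bool]%SET _ 1 (fun k => if k then x else y) cr.
rewrite cardsT card_bool => H; suff : (2 <= 1)%N by [].
by apply: H => [[] _ //|[] [] _ _ // E]; exfalso; apply: xy.
Qed.

Lemma crossing_double x y z : crossings t a b = 2%N -> D x -> D y -> D z ->
  open_face [set a; b]%SET x -> open_face [set a; b]%SET y ->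
  open_face [set a; b]%SET z -> x <> y -> z <> x -> z = y.
Proof.
have [? [? [_ _ _ _ /(_ a b ab) cr]]] := tD.
move=> c2 Dx Dy Dz /open_face_closed xab /open_face_closed yab /open_face_closed zab xy zx.
rewrite c2 in cr; apply: contrapT => zy.
have := @card_le_crossings R (option bool) [set: option bool]%SET _ 2
  (fun k => if k is Some k then if k then x else y else z) cr.
rewrite cardsT card_option card_bool => H; suff : (3 <= 2)%N by [].
apply: H => [[[]|] _ //|[[]|] [[]|] _ _ // E]; exfalso; by [apply: xy|apply: zx|apply: zy].
Qed.

End Crossings.

Lemma pairedC j a b : paired j a b = paired j b a.
Proof. by rewrite !pairedE eq_sym. Qed.

Lemma pairing_labels (j1 j2 : 'I_3) : j1 != j2 -> exists a b c d,
  [/\ uniq [:: a; b; c; d],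
   [/\ paired j1 a b, paired j1 c d, ~~ paired j1 a c, ~~ paired j1 a d &
     ~~ paired j1 b c /\ ~~ paired j1 b d] &
   [/\ paired j2 a c, paired j2 b d, ~~ paired j2 a b, ~~ paired j2 a d &
     ~~ paired j2 b c /\ ~~ paired j2 c d]].
Proof.
move=> j12; have [k [k1 k2]] : exists k : 'I_3, k != j1 /\ k != j2.
  by move: j1 j2 j12 => [[|[|[|//]]] ?] [[|[|[|//]]] ?] // _;
    [exists (@Ordinal 3 2 isT)|exists (@Ordinal 3 1 isT)|exists (@Ordinal 3 2 isT)
    |exists (@Ordinal 3 0 isT)|exists (@Ordinal 3 1 isT)|exists (@Ordinal 3 0 isT)].
exists ord0, (lift ord0 j1), (lift ord0 j2), (lift ord0 k).
rewrite !pairedE.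
by move: j1 j2 k j12 k1 k2 => [[|[|[|//]]] ?] [[|[|[|//]]] ?] [[|[|[|//]]] ?].
Qed.

(** Let the types separate [ab] from [cd] and [ac] from [bd]; both discs meet [bc] once. In the face
    [abc] the first cuts off [c] and the second [b]; in the face [bcd] it is the other way round.
    The two points on [bc] would be in both orders. *)
Lemma disjoint_quads j1 j2 D1 D2 : normal_disc (Quad j1) D1 ->
  normal_disc (Quad j2) D2 -> D1 `&` D2 = set0 -> j1 = j2.
Proof.
move=> nD1 nD2 D12; apply/eqP; apply: contraT => j12.
have [a [b [c [d [abcd [ab1 cd1 ac1 ad1 [bc1 bd1]] [ac2 bd2 ab2 ad2 [bc2 cd2]]]]]]] :=
  pairing_labels j12.
have [A1 [A1P _]] := normal_disc_arcs nD1.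
have [A2 [A2P _]] := normal_disc_arcs nD2.
have A12 f v f' v' : cuts (Quad j1) f v -> cuts (Quad j2) f' v' -> A1 f v `&` A2 f' v' = set0.
  move=> /A1P[A1D _] /A2P[A2D _]; apply/seteqP; split=> // x [/A1D x1 /A2D x2].
  by rewrite -D12.
move: (abcd); rewrite /= !inE !negb_or !andbT => /and3P[/and3P[ab ac ad] /andP[bc bd] cd].
have c1 : cuts (Quad j1) d c by rewrite /cuts eq_sym cd pairedC.
have c2 : cuts (Quad j2) d b by rewrite /cuts eq_sym bd pairedC.
have c3 : cuts (Quad j1) a b by rewrite /cuts ab.
have c4 : cuts (Quad j2) a c by rewrite /cuts ac.
have u1 : uniq [:: d; a; b; c] by reorder.
have u2 : uniq [:: a; d; b; c] by reorder.
have [A1D1 A1c1] := A1P _ _ c1; have [A2D2 A2c2] := A2P _ _ c2.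
have [A1D3 A1c3] := A1P _ _ c3; have [A2D4 A2c4] := A2P _ _ c4.
have [x1 [x2 [x1A x2A x1o x2o lt1]]] := cut_across u1 A1c1 A2c2 (A12 _ _ _ _ c1 c2).
have [y2 [y1 [y2A y1A y2o y1o lt2]]] := cut_across u2 A2c4 A1c3
  (etrans (setIC _ _) (A12 _ _ _ _ c3 c4)).
have E1 : x1 = y1 by apply: (crossing_unique nD1 bc) => //=; rewrite ?bc1 //; auto.
have E2 : x2 = y2 by apply: (crossing_unique nD2 bc) => //=; rewrite ?bc2 //; auto.
by rewrite E1 E2 in lt1; move: (lt_trans lt1 lt2); rewrite ltxx.
Qed.

(** Both discs meet [ac] once, and the faces [abc] and [acd] put their two points in opposite
    orders. *)
Lemma disjoint_quad_octagon_same j D1 D2 : normal_disc (Quad j) D1 ->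
  normal_disc (Oct j) D2 -> D1 `&` D2 = set0 -> False.
Proof.
move=> nD1 nD2 D12.
have [j' jj'] : exists j', j != j' by case: j {nD1 nD2} => [[|i] ?]; [exists (@Ordinal 3 1 isT)|exists ord0].
have [a [b [c [d [abcd [ab1 cd1 ac1 ad1 [bc1 bd1]] _]]]]] := pairing_labels jj'.
have [A1 [A1P _]] := normal_disc_arcs nD1.
have [A2 [A2P _]] := normal_disc_arcs nD2.
have A12 f v f' v' : cuts (Quad j) f v -> cuts (Oct j) f' v' -> A1 f v `&` A2 f' v' = set0.
  move=> /A1P[A1D _] /A2P[A2D _]; apply/seteqP; split=> // x [/A1D x1 /A2D x2].
  by rewrite -D12.
move: (abcd); rewrite /= !inE !negb_or !andbT => /and3P[/and3P[ab ac ad] /andP[bc bd] cd].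
have c1 : cuts (Quad j) d c by rewrite /cuts eq_sym cd pairedC.
have c2 : cuts (Oct j) d a by rewrite /cuts eq_sym ad pairedC.
have c3 : cuts (Quad j) b a by rewrite /cuts eq_sym ab pairedC.
have c4 : cuts (Oct j) b c by rewrite /cuts bc.
have u1 : uniq [:: d; b; a; c] by reorder.
have u2 : uniq [:: b; d; a; c] by reorder.
have [A1D1 A1c1] := A1P _ _ c1; have [A2D2 A2c2] := A2P _ _ c2.
have [A1D3 A1c3] := A1P _ _ c3; have [A2D4 A2c4] := A2P _ _ c4.
have [x1 [x2 [x1A x2A x1o x2o lt1]]] := cut_across u1 A1c1 A2c2 (A12 _ _ _ _ c1 c2).
have [y2 [y1 [y2A y1A y2o y1o lt2]]] := cut_across u2 A2c4 A1c3
  (etrans (setIC _ _) (A12 _ _ _ _ c3 c4)).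
have E1 : x1 = y1 by apply: (crossing_unique nD1 ac) => //=; rewrite ?ac1 //; auto.
have E2 : x2 = y2 by apply: (crossing_unique nD2 ac) => //=; rewrite ?(negPf ac1) //; auto.
by rewrite E1 E2 in lt1; move: (lt_trans lt1 lt2); rewrite ltxx.
Qed.

(** On [ab] the faces [abc] and [abd] place the point of the quadrilateral between the two points of
    the octagon. The one nearer to [b] is the end of an arc of the octagon around [b] in the face
    [abc], parallel to an arc of the quadrilateral, which carries the order over to [bc]. *)
Lemma quad_octagon_order j1 j2 D1 D2 a b c d : uniq [:: a; b; c; d] ->
  normal_disc (Quad j2) D1 -> normal_disc (Oct j1) D2 -> D1 `&` D2 = set0 ->
  paired j2 a c -> paired j2 b d -> ~~ paired j2 a b -> ~~ paired j2 b c ->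
  paired j1 a b -> ~~ paired j1 b c -> ~~ paired j1 a d -> ~~ paired j1 b d ->
  exists x y, [/\ D1 x, D2 y, open_face [set b; c]%SET x,
    open_face [set b; c]%SET y & bary x b < bary y b].
Proof.
move=> abcd nD1 nD2 D12 ac2 bd2 ab2 bc2 ab1 bc1 ad1 bd1.
have [A1 [A1P _]] := normal_disc_arcs nD1.
have [A2 [A2P A2d]] := normal_disc_arcs nD2.
have A12 f v f' v' : cuts (Quad j2) f v -> cuts (Oct j1) f' v' -> A1 f v `&` A2 f' v' = set0.
  move=> /A1P[A1D _] /A2P[A2D _]; apply/seteqP; split=> // x [/A1D x1 /A2D x2].
  by rewrite -D12.
move: (abcd); rewrite /= !inE !negb_or !andbT => /and3P[/and3P[ab ac ad] /andP[bc bd] cd].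
have c1 : cuts (Oct j1) d a by rewrite /cuts eq_sym ad pairedC.
have c2 : cuts (Quad j2) d b by rewrite /cuts eq_sym bd pairedC.
have c3 : cuts (Quad j2) c a by rewrite /cuts eq_sym ac pairedC.
have c4 : cuts (Oct j1) c b by rewrite /cuts eq_sym bc pairedC.
have c5 : cuts (Oct j1) d b by rewrite /cuts eq_sym bd pairedC.
have u1 : uniq [:: d; c; b; a] by reorder.
have u2 : uniq [:: c; d; b; a] by reorder.
have u3 : uniq [:: d; a; b; c] by reorder.
have [A2D1 A2c1] := A2P _ _ c1; have [A1D2 A1c2] := A1P _ _ c2.
have [A1D3 A1c3] := A1P _ _ c3; have [A2D4 A2c4] := A2P _ _ c4.
have [A2D5 A2c5] := A2P _ _ c5.
have [p1 [q [p1A qA p1o qo lt1]]] := cut_across u1 A2c1 A1c2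
  (etrans (setIC _ _) (A12 _ _ _ _ c2 c1)).
have [q' [p2' [qA' p2A' qo' p2o' lt2]]] := cut_across u2 A1c3 A2c4 (A12 _ _ _ _ c3 c4).
have [p2 [y1 [q'' [y2 [[p2A y1A] [qA'' y2A] [p2o y1o] [qo'' y2o] par]]]]] :=
  cut_parallel u3 A2c5 A1c2 (etrans (setIC _ _) (A12 _ _ _ _ c2 c5)).
have ba : b != a by rewrite eq_sym.
have Eq : q' = q.
  by apply: (crossing_unique nD1 ba) => //=; rewrite 1?pairedC ?ab2 //; auto.
have Eq' : q'' = q.
  by apply: (crossing_unique nD1 ba) => //=; rewrite 1?pairedC ?ab2 //; auto.
(* The face [abc] already shows both points of the octagon on [ab]. The one found in [abd] lies
   beyond the quadrilateral, so it is not [p1]. *)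
have Ep : p2' = p2.
  apply: (crossing_double nD2 ba (x := p1)) => //=; rewrite 1?pairedC ?ab1 //; auto.
    move=> E; have : (A2 d a `&` A2 d b) p1 by split=> //; rewrite E.
    by rewrite (A2d _ _ _ c1 c5 ab).
  by move=> E; move: lt2; rewrite Eq E => /(lt_trans lt1); rewrite ltxx.
exists y2, y1; split; auto.
by apply: par; rewrite Eq' -Eq -Ep.
Qed.

(** For different pairs of edges, the labels [d], [c], [b], [a] satisfy the same conditions as [a],
    [b], [c], [d]. So on [bc], which both discs meet once, the octagon would be nearer than the
    quadrilateral to [b] and to [c]. *)
Lemma disjoint_quad_octagon j1 j2 D1 D2 : normal_disc (Quad j2) D1 ->
  normal_disc (Oct j1) D2 -> D1 `&` D2 = set0 -> False.
Proof.
move=> nD1 nD2 D12; have [j12|j12] := eqVneq j1 j2.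
  by rewrite -j12 in nD1; exact: disjoint_quad_octagon_same nD1 nD2 D12.
have [a [b [c [d [abcd [ab1 cd1 ac1 ad1 [bc1 bd1]] [ac2 bd2 ab2 ad2 [bc2 cd2]]]]]]] :=
  pairing_labels j12.
have [x [y [xD yD xo yo lt1]]] := quad_octagon_order abcd nD1 nD2 D12 ac2 bd2 ab2 bc2 ab1 bc1 ad1 bd1.
have dcba : uniq [:: d; c; b; a] by reorder.
rewrite (pairedC j2 a) in ac2; rewrite (pairedC j2 b) in bd2.
rewrite (pairedC j2 c) in cd2; rewrite (pairedC j2 b c) in bc2.
rewrite (pairedC j1 c) in cd1; rewrite (pairedC j1 b c) in bc1.
rewrite (pairedC j1 a d) in ad1; rewrite (pairedC j1 a c) in ac1.
have [x' [y' [xD' yD' xo' yo' lt2]]] := quad_octagon_order dcba nD1 nD2 D12 bd2 ac2 cd2 bc2 cd1 bc1 ad1 ac1.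
rewrite finset.setUC in xo'; rewrite finset.setUC in yo'.
move: (abcd); rewrite /= !inE !negb_or !andbT => /and3P[/and3P[ab ac ad] /andP[bc bd] cd].
have E1 : x' = x.
  by apply: (crossing_unique nD1 bc) => //=; rewrite 1?pairedC ?bc2.
have E2 : y' = y.
  by apply: (crossing_unique nD2 bc) => //=; rewrite 1?pairedC ?(negPf bc1).
have bcad : uniq [:: b; c; a; d] by reorder.
have := sum_bary4 x bcad; have := sum_bary4 y bcad.
have [_ _ -> ->] := (open_faceP _ bcad).1 xo.
have [_ _ -> ->] := (open_faceP _ bcad).1 yo.
by move: lt1 lt2; rewrite E1 E2; move: (bary _ _) (bary _ _) (bary _ _) (bary _ _); clear=> *; lra.
Qed.

End DisjointDiscs.

Lemma eq_traject (A : Type) (f g : A -> A) x N :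
  (forall k, iter k f x = iter k g x) -> traject f x N = traject g x N.
Proof. by move=> E; elim: N => // N IH; rewrite !trajectSr IH E. Qed.

(** * Edge cycles and matching equations *)

Section Positions.
Variables (n : nat) (T : triangulation n).
Implicit Type p q : position n.

Definition flip p : position n := (p.1, (tperm X_ Y_ * p.2)%g).

(* The other side of the face opposite to X; a free face is its own other side. *)
Definition across p : position n :=
  if glue T p.1 (p.2 X_) is Some (j, s) then (j, (p.2 * s)%g) else p.

(* Like [turn], but bouncing off the free faces: always a bijection. *)
Definition bounce p := flip (across p).

Lemma flipK : involutive flip.
Proof. by move=> [i m]; rewrite /flip /= mulgA tperm2 mul1g. Qed.

Lemma flip_X p : (flip p).2 X_ = p.2 Y_.
Proof. by rewrite /flip /= permM tpermL. Qed.

Lemma flip_U p : (flip p).2 U_ = p.2 U_.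
Proof. by rewrite /flip /= permM tpermD. Qed.

Lemma flip_L p : (flip p).2 L_ = p.2 L_.
Proof. by rewrite /flip /= permM tpermD. Qed.

Lemma acrossK : involutive across.
Proof.
move=> [i m]; rewrite /across /=.
case E: (glue T i (m X_)) => [[j s]|] /=; last by rewrite E.
by rewrite permM (glueK E) /= -mulgA mulgV mulg1.
Qed.

Lemma bounce_inj : injective bounce.
Proof. exact: inj_comp (can_inj flipK) (can_inj acrossK). Qed.

(** [flip] conjugates [bounce] to its inverse: it reverses the direction of rotation around the
    edge. *)
Lemma flip_bounce p : bounce (flip (bounce p)) = flip p.
Proof. by rewrite /bounce flipK acrossK. Qed.

Lemma bounce_turn p : glue T p.1 (p.2 X_) <> None -> bounce p = turn T p.
Proof.
by case: p => i m; rewrite /bounce /across /turn /=; case: (glue _ _ _) => [[j s]|//] _;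
  rewrite /flip /= mulgA.
Qed.

Lemma sum_orbit (V : zmodType) (F : position n -> V) (f : position n -> position n) p :
  injective f -> \sum_(q <- orbit f p) F (f q) = \sum_(q <- orbit f p) F q.
Proof.
move=> fI; rewrite !big_uniq ?orbit_uniq //= [RHS](reindex_inj fI) /=.
by apply: eq_bigl => q; rewrite -!fconnect_orbit -same_fconnect1_r.
Qed.

Lemma orbit_bounce p :
  (forall q, fconnect bounce p q -> glue T q.1 (q.2 X_) <> None) ->
  orbit (turn T) p = orbit bounce p.
Proof.
move=> H.
have E k : iter k (turn T) p = iter k bounce p.
  elim: k => //= k ->; rewrite bounce_turn //; apply: H; exact: fconnect_iter.
have C : fingraph.order (turn T) p = fingraph.order bounce p.
  apply: eq_card => q; apply/idP/idP => /iter_findex <-.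
    by rewrite E; exact: fconnect_iter.
  by rewrite -E; exact: fconnect_iter.
by rewrite /orbit C; exact: eq_traject.
Qed.

Lemma perm_X_U (m : 'S_4) : m X_ != m U_. Proof. by rewrite (inj_eq perm_inj). Qed.
Lemma perm_X_L (m : 'S_4) : m X_ != m L_. Proof. by rewrite (inj_eq perm_inj). Qed.

Lemma edge_step_across p : glue T p.1 (p.2 X_) <> None ->
  edge_step T (p.1, (p.2 U_, p.2 L_)) ((across p).1, ((across p).2 U_, (across p).2 L_)).
Proof.
case: p => i m /=; rewrite /across /=; case E: (glue _ _ _) => [[j s]|//] _ /=.
by apply/existsP; exists (m X_); rewrite perm_X_U perm_X_L E !permM eqxx.
Qed.

Lemma boundary_edgeP i a b : reflect
  (exists j c d f, connect (edge_step T) (i, (a, b)) (j, (c, d)) /\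
     [/\ f != c, f != d & glue T j f = None])
  (boundary_edge T i a b).
Proof.
apply: (iffP existsP) => [[j /existsP[c /existsP[d /existsP[f /and4P[? ? ? /eqP ?]]]]]|].
  by exists j, c, d, f.
move=> [j [c [d [f [? [? ? ?]]]]]]; exists j; apply/existsP; exists c.
by apply/existsP; exists d; apply/existsP; exists f; apply/and4P; split=> //; apply/eqP.
Qed.

(** Rotation stays in the class of the edge, so a free face met on the way would make it a boundary
    edge. *)
Lemma interior_edge_glued p : ~~ boundary_edge T p.1 (p.2 U_) (p.2 L_) ->
  forall q, fconnect bounce p q -> glue T q.1 (q.2 X_) <> None.
Proof.
move=> nb q /iter_findex <-; move: (findex _ _ _) => k.
have C : connect (edge_step T) (p.1, (p.2 U_, p.2 L_))
   ((iter k bounce p).1, ((iter k bounce p).2 U_, (iter k bounce p).2 L_)).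
  elim: k => [|k IH] /=; first exact: connect0.
  apply: (connect_trans IH); rewrite /bounce flip_U flip_L /=.
  move: (iter k bounce p) => {IH}{}q.
  case E: (glue T q.1 (q.2 X_)) => [[j s]|].
    by apply: connect1; apply: edge_step_across; rewrite E.
  by rewrite /across E connect0.
move=> E; move/boundary_edgeP: nb; apply.
by do 4!eexists; split; [exact: C|split; [exact: perm_X_U|exact: perm_X_L|exact: E]].
Qed.

End Positions.

Section ArcCounts.
Variable R : realType.

Lemma pairingP j a b : a != b -> paired j a b = (j == pairing a b).
Proof.
rewrite /pairing !pairedE.
by case: a => [[|[|[|[|//]]]] ?]; case: b => [[|[|[|[|//]]]] ?] // _;
  case: j => [[|[|[|//]]] ?].
Qed.

Lemma pairingC a b : pairing a b = pairing b a.
Proof. by rewrite /pairing !(pairedC _ a). Qed.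

Lemma pairing_neq a b u : a != b -> a != u -> b != u -> pairing a u != pairing b u.
Proof.
move=> ab au bu; apply/eqP => E.
have := pairingP (pairing b u) au; have := pairingP (pairing b u) bu.
rewrite E eqxx !pairedE; move: (pairing b u) ab au bu => j; clear E.
by case: a => [[|[|[|[|//]]]] ?]; case: b => [[|[|[|[|//]]]] ?] // _; case: u => [[|[|[|[|//]]]] ?] // _ _;
  case: j => [[|[|[|//]]] ?].
Qed.

Variables (n : nat) (T : triangulation n).

(* The contribution of the quadrilaterals and octagons to the number of arcs
   that cut off [v] in the face opposite to [f].                             *)
Definition arc_coord (w : 'rV[R]_(n * (3 + 3)%N)) i (f v : 'I_4) : R :=
  quad_coord w i (pairing f v) + \sum_(j | j != pairing f v) oct_coord w i j.

(** The octagons that meet the edge [UL] twice occur in both sums on the right and cancel. *)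
Lemma upward_downward w (p : position n) : upward w p - downward w p =
  arc_coord w p.1 (p.2 X_) (p.2 U_) - arc_coord w p.1 (p.2 Y_) (p.2 U_).
Proof.
case: p => i m /=; rewrite /arc_coord !(pairingC (m U_)).
set x := pairing (m X_) _; set y := pairing (m Y_) _.
have xy : x != y by apply: pairing_neq; rewrite ?(inj_eq perm_inj).
rewrite (bigD1 y) 1?eq_sym //= [in RHS](bigD1 x (P := fun j => j != y)) //=.
rewrite (eq_bigl (fun j => (j != x) && (j != y))) // [\sum_(j | (j != y) && (j != x)) _]
  (eq_bigl (fun j => (j != x) && (j != y))); last by move=> j; rewrite andbC.
ring.
Qed.

End ArcCounts.

Local Open Scope quotient_scope.

Section Gluing.
Variable R : realType.

Lemma tetraP (g : 'I_4 -> R) : (forall c, 0 <= g c) -> \sum_c g c = 1 ->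
  exists x : tetra R, forall c, bary x c = g c.
Proof.
move=> g0 g1; have H : simplex (\row_c g c).
  split=> [c|]; first by rewrite mxE.
  by rewrite -[RHS]g1; apply: eq_bigr => c _; rewrite mxE.
by exists (@exist 'rV[R]_4 (fun v => v \in @simplex R) _ (mem_set H)) => c; rewrite /bary /= mxE.
Qed.

Lemma perm_tetraP (s : 'S_4) (x : tetra R) :
  exists y : tetra R, forall c, bary y (s c) = bary x c.
Proof.
have [||y yP] := @tetraP (fun c => bary x (s^-1%g c)).
- by move=> c; exact: bary_ge0.
- by rewrite -(sum_bary x) [RHS](reindex_inj (@perm_inj _ s^-1%g)).
by exists y => c; rewrite yP permK.
Qed.

Definition perm_tetra s x := sval (cid (perm_tetraP s x)).

Lemma bary_perm s x c : bary (perm_tetra s x) (s c) = bary x c.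
Proof. by rewrite /perm_tetra; case: cid. Qed.

Lemma perm_tetra_inj s : injective (perm_tetra s).
Proof. by move=> x y xy; apply: bary_inj => c; rewrite -(bary_perm s x) -(bary_perm s y) xy. Qed.

Variables (n : nat) (T : triangulation n).

Lemma pt_eqP (p q : tetrahedra R n) :
  (\pi_(realization R T) p = \pi_(realization R T) q) <->
  clos_refl_sym_trans _ (@glue_step R n T) p q.
Proof.
split=> [/eqmodP/asboolP //|H].
by apply/eqmodP/asboolP.
Qed.

Lemma pt_glue i f j s (x : tetra R) : glue T i f = Some (j, s) ->
  bary x f = 0 -> pt T i x = pt T j (perm_tetra s x).
Proof.
move=> E xf; apply/pt_eqP; apply: rst_step; exists f, s; split => //.
by move=> c; rewrite bary_perm.
Qed.

End Gluing.

(** * Arc numbers and vector of a surface *)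

Section SurfaceCounts.
Variables (R : realType) (n : nat) (T : triangulation n) (S : octagonal_surface R T).

Let type i (k : 'I_(npieces S i)) := @piece_type _ _ _ S i k.

Definition surface_arcs i (f v : 'I_4) : nat := (\sum_k cuts (@type i k) f v)%N.
Definition surface_crossings i (a b : 'I_4) : nat := (\sum_k crossings (@type i k) a b)%N.

Lemma surface_crossingsE i f a b : a != b -> f != a -> f != b ->
  surface_crossings i a b = (surface_arcs i f a + surface_arcs i f b)%N.
Proof.
by move=> ab fa fb; rewrite -big_split /=; apply: eq_bigr => k _; exact: crossingsE.
Qed.

Lemma normal_disc_edge t (D : set (tetra R)) a b : a != b -> normal_disc t D ->
  exists e : 'I_(crossings t a b) -> tetra R, injective e /\
    forall x, D x /\ closed_face [set a; b]%SET x <-> exists k, e k = x.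
Proof.
move=> ab [? [? [_ _ _ _ /(_ a b ab)/pcard_eqP/bijPex[g [g1 gi gs]]]]].
have H (k : 'I_(crossings t a b)) : exists x,
   (D x /\ closed_face [set a; b]%SET x) /\ g x = k.
  by have [x xD gx] := gs k (ltn_ord k); exists x.
have [e eP] := choice H; exists e; split=> [k l kl|x].
  by apply/val_inj; rewrite /= -(eP k).2 -(eP l).2 kl.
split=> [xD|[k <-]]; last by case: (eP k).
exists (Ordinal (g1 _ xD)); have [yD gy] := eP (Ordinal (g1 _ xD)).
by apply: gi; rewrite ?inE.
Qed.

Lemma surface_edge i a b : a != b ->
  exists e : {k : 'I_(npieces S i) & 'I_(crossings (type k) a b)} -> tetra R,
  injective e /\ forall x,
    carrier S (pt T i x) /\ closed_face [set a; b]%SET x <-> exists k, e k = x.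
Proof.
move=> ab.
pose E (k : 'I_(npieces S i)) := cid (normal_disc_edge ab (@piece_normal _ _ _ S i k)).
pose e (u : {k : 'I_(npieces S i) & 'I_(crossings (type k) a b)}) :=
  sval (E (tag u)) (tagged u).
have eP k x : @piece _ _ _ S i k x /\ closed_face [set a; b]%SET x <-> exists l, sval (E k) l = x.
  by case: (svalP (E k)).
pose tg (k : 'I_(npieces S i)) (l : 'I_(crossings (type k) a b)) :=
  Tagged (fun k => 'I_(crossings (type k) a b)) l.
exists e; split=> [[k l] [k' l'] kl|x].
  have [xk xl] := (eP k (e (tg k l))).2 (ex_intro _ l erefl).
  have [xk' _] := (eP k' (e (tg k' l'))).2 (ex_intro _ l' erefl).
  have kk' : k = k'.
    apply: contrapT => /eqP kk'; have := @piece_disjoint _ _ _ S i _ _ kk'.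
    by move=> /seteqP[/(_ (e (tg k l)))+ _]; apply; split=> //; rewrite kl.
  subst k'; congr Tagged; have [ei _] := svalP (E k).
  exact: ei.
have := piece_cover S i => /seteqP[c1 c2]; split.
  move=> [/c1[k _ xk] xab]; have [l lx] := (eP k x).1 (conj xk xab).
  by exists (tg k l).
move=> [[k l] <-]; have [xk xl] := (eP k (e (tg k l))).2 (ex_intro _ l erefl).
by split=> //; apply: c2; exists k.
Qed.

Lemma card_crossings i a b :
  #|{: {k : 'I_(npieces S i) & 'I_(crossings (type k) a b)}}| = surface_crossings i a b.
Proof.
rewrite card_tagged sumnE big_map /surface_crossings big_enum /=.
by apply: eq_bigr => k _; rewrite card_ord.
Qed.

(** The carrier lives in the quotient, so the gluing map sends its points on an edge injectively to
    its points on the image edge. The inverse gluing gives the other inequality. *)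
Lemma surface_crossings_le i f j s a b : glue T i f = Some (j, s) ->
  a != b -> f != a -> f != b ->
  (surface_crossings i a b <= surface_crossings j (s a) (s b))%N.
Proof.
move=> gl ab fa fb; rewrite -!card_crossings.
have [e [ei eP]] := surface_edge i ab.
have sab : s a != s b by rewrite (inj_eq perm_inj).
have [e' [ei' eP']] := surface_edge j sab.
have /choice[h hP] u : exists u', e' u' = perm_tetra s (e u).
  have [xS xab] := (eP (e u)).2 (ex_intro _ u erefl).
  apply/eP'; split.
    rewrite -(pt_glue gl) //; apply: xab.
    by rewrite !inE negb_or fa fb.
  move=> c; rewrite -(permKV s c) bary_perm !inE !(inj_eq perm_inj) => H.
  by apply: xab; rewrite !inE.
apply: (@leq_card _ _ h) => u v /(congr1 e'); rewrite !hP => /perm_tetra_inj; exact: ei.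
Qed.

Lemma surface_crossings_glue i f j s a b : glue T i f = Some (j, s) ->
  a != b -> f != a -> f != b ->
  surface_crossings i a b = surface_crossings j (s a) (s b).
Proof.
move=> gl ab fa fb; apply/eqP; rewrite eqn_leq (surface_crossings_le gl) //=.
have := @surface_crossings_le j (s f) i s^-1%g (s a) (s b) (glueK gl).
by rewrite !(inj_eq perm_inj) !permK; apply.
Qed.

(** The crossings of the three edges of a face are the pairwise sums of its three arc numbers, and
    these sums determine the arc numbers. *)
Lemma surface_arcs_glue i f j s v : glue T i f = Some (j, s) -> f != v ->
  surface_arcs i f v = surface_arcs j (s f) (s v).
Proof.
move=> gl fv; have [a [b fvab]] := uniq4_complete fv.
move: fvab; rewrite /= !inE !negb_or !andbT => /and3P[/and3P[_ fa fb] /andP[va vb] ab].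
have := surface_crossings_glue gl va fv fa.
have := surface_crossings_glue gl vb fv fb.
have := surface_crossings_glue gl ab fa fb.
rewrite (surface_crossingsE i va fv fa) (surface_crossingsE i vb fv fb) (surface_crossingsE i ab fa fb).
have sE (x y : 'I_4) : (s x != s y) = (x != y) by rewrite (inj_eq perm_inj).
rewrite (@surface_crossingsE j (s f) (s v) (s a)) ?sE //.
rewrite (@surface_crossingsE j (s f) (s v) (s b)) ?sE //.
rewrite (@surface_crossingsE j (s f) (s a) (s b)) ?sE //.
move: (surface_arcs _ _ _) (surface_arcs _ _ _) (surface_arcs _ _ _)
  (surface_arcs _ _ _) (surface_arcs _ _ _) (surface_arcs _ _ _).
by clear; lia.
Qed.

Lemma qo_quad i j : quad_coord (qo_vector S) i j =
  (#|[set k | is_quad j (@piece_type _ _ _ S i k)]%SET|)%:R.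
Proof. by rewrite /quad_coord /qo_vector mxvecK mxE row_mxEl mxE. Qed.

Lemma qo_oct i j : oct_coord (qo_vector S) i j =
  (#|[set k | is_oct j (@piece_type _ _ _ S i k)]%SET|)%:R.
Proof. by rewrite /oct_coord /qo_vector mxvecK mxE row_mxEr mxE. Qed.

Definition is_tri (v : 'I_4) (t : disc_type) : bool :=
  if t is Tri v' then v' == v else false.

Lemma cuts_coord t f v : f != v -> (cuts t f v : nat) =
  (is_tri v t + (is_quad (pairing f v) t + \sum_(j | j != pairing f v) is_oct j t))%N.
Proof.
move=> fv; case: t => [u|j|j]; rewrite /cuts fv /=.
- by rewrite big1 // addn0 eq_sym addn0.
- by rewrite big1 // addn0 pairingP.
- rewrite pairingP //; have [->|jp] := eqVneq j (pairing f v).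
    by rewrite big1 // => k /negPf; rewrite eq_sym => ->.
  rewrite (bigD1 j) //= eqxx big1 // => k /andP[_].
  by rewrite eq_sym => /negPf ->.
Qed.

Lemma surface_arcs_coord i f v : f != v -> (surface_arcs i f v)%:R =
  (\sum_k is_tri v (@type i k))%:R + arc_coord (qo_vector S) i f v.
Proof.
move=> fv; have cE (P : pred disc_type) : #|[set k | P (@piece_type _ _ _ S i k)]%SET| =
    (\sum_(k < npieces S i) P (@piece_type _ _ _ S i k))%N.
  rewrite -sum1_card big_mkcond; apply: eq_bigr => k _; rewrite inE.
  by case: (P _).
rewrite /arc_coord qo_quad cE.
have -> : \sum_(j | j != pairing f v) oct_coord (qo_vector S) i j =
    (\sum_(j | j != pairing f v) \sum_k is_oct j (@type i k))%N%:R.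
  by rewrite natr_sum; apply: eq_bigr => j _; rewrite qo_oct cE.
rewrite -!natrD; congr (_%:R).
rewrite exchange_big /= -!big_split /=; apply: eq_bigr => k _.
exact: cuts_coord.
Qed.

(** The triangles at [U] count equally in all faces at [U], so each term is the difference of the
    arc numbers in the faces by which the tetrahedron is left and entered. The face left is
    identified with the next one entered. *)
Lemma surface_matching : qo_matching T (qo_vector S).
Proof.
move=> i m nb; apply/eqP; rewrite -subr_eq0 -sumrB; apply/eqP.
have gl := interior_edge_glued (p := (i, m)) nb.
rewrite (orbit_bounce gl).
pose A (f : 'I_4) (p : position n) : R := (surface_arcs p.1 (p.2 f) (p.2 U_))%:R.
rewrite (eq_bigr (fun p => A X_ p - A Y_ p)); last first.
  move=> p _; rewrite upward_downward /A !surface_arcs_coord ?(inj_eq perm_inj) //.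
  by move: (arc_coord _ _ _ _) (arc_coord _ _ _ _) (_%:R) => *; ring.
rewrite sumrB -(sum_orbit (A Y_) _ (@bounce_inj _ T)) -sumrB big_seq big1 // => p.
rewrite -fconnect_orbit => /gl.
case: p => j m'; rewrite /A /bounce /across /=.
case E: (glue _ _ _) => [[j' s]|//] _ /=.
by rewrite !permM tpermR tpermD // (surface_arcs_glue E) ?perm_X_U ?subrr.
Qed.

Lemma surface_oct_unique i i' (k : 'I_(npieces S i)) (k' : 'I_(npieces S i')) :
  octagonal (type k) -> octagonal (type k') ->
  Tagged (fun i => 'I_(npieces S i)) k = Tagged (fun i => 'I_(npieces S i)) k'.
Proof.
move=> ok ok'; have := one_octagon S.
pose P i := [set k | octagonal (@piece_type _ _ _ S i k)]%SET.
have Pk : k \in P i by rewrite inE.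
have Pk' : k' \in P i' by rewrite inE.
have P0 : (0 < #|P i|)%N by apply/card_gt0P; exists k.
have P0' : (0 < #|P i'|)%N by apply/card_gt0P; exists k'.
rewrite (bigD1 i) //=; have [ii'|ii'] := eqVneq i' i; last first.
  rewrite (bigD1 i') //= => H; move: P0 P0' H; rewrite /P.
  by move: (#|_|) (#|_|) (\sum_(_ | _) _)%N; clear => *; lia.
subst i' => /eqP H; congr Tagged.
have : (#|P i| <= 1)%N by rewrite -(eqP H) leq_addr.
by move=> /card_le1_eqP/(_ k k' Pk Pk').
Qed.

Lemma qo_ge0 c : 0 <= qo_vector S 0 c.
Proof.
rewrite /qo_vector; case/mxvec_indexP: c => i j; rewrite mxvecE mxE.
by case: (split_ordP j) => k ->; rewrite ?row_mxEl ?row_mxEr mxE ler0n.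
Qed.

Lemma card_neq0 (I : finType) (P : pred I) : (#|[set k | P k]%SET|)%:R != 0 :> R ->
  exists k, P k.
Proof.
by rewrite pnatr_eq0 cards_eq0 => /set0Pn[k]; rewrite inE; exists k.
Qed.

Lemma is_quadE j t : is_quad j t -> t = Quad j.
Proof. by case: t => //= j' /eqP ->. Qed.

Lemma is_octE j t : is_oct j t -> t = Oct j.
Proof. by case: t => //= j' /eqP ->. Qed.

Lemma surface_one_octagon : one_unit_octagon (qo_vector S).
Proof.
have [i [k ok]] : exists i (k : 'I_(npieces S i)), octagonal (type k).
  apply: contrapT => H; have := one_octagon S; rewrite big1 // => i _.
  apply/eqP; rewrite cards_eq0; apply/eqP/setP => k; rewrite !inE.
  by apply/negP => ok; apply: H; exists i, k.
have [j kj] : exists j, type k = Oct j by case: (type k) ok => // j _; exists j.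
have jk : is_oct j (type k) by rewrite kj /= eqxx.
exists i, j; split=> [|i' j'].
  rewrite qo_oct (_ : #|_| = 1%N) //; apply/eqP/cards1P; exists k; apply/setP => l.
  rewrite !inE; apply/idP/eqP => [lj|->]; last exact: jk.
  have ol : octagonal (type l) by rewrite /type (is_octE lj).
  by have /eqP := surface_oct_unique ok ol; rewrite eq_Tagged => /eqP.
rewrite qo_oct => /card_neq0[l lj].
have ol : octagonal (type l) by rewrite /type (is_octE lj).
have E := surface_oct_unique ol ok.
have ii' : i' = i := congr1 (fun u => tag u) E.
subst i'; congr pair.
move/eqP: E; rewrite eq_Tagged => /eqP /= E; rewrite E in lj.
by have : type k = Oct j' := is_octE lj; rewrite kj => -[].
Qed.

Lemma surface_constraints : qo_constraints (qo_vector S).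
Proof.
have oct i i' j j' : oct_coord (qo_vector S) i j != 0 ->
    oct_coord (qo_vector S) i' j' != 0 -> (i, j) = (i', j').
  by have [i0 [j0 [_ H]]] := surface_one_octagon => /H -> /H ->.
split=> // i c d.
case: (split_ordP c) => j ->; case: (split_ordP d) => j' ->.
- rewrite -!/(quad_coord _ _ _) !qo_quad => /card_neq0[k /is_quadE kj] /card_neq0[l /is_quadE lj].
  have [->//|kl'] := eqVneq j j'; congr lshift.
  have nk := @piece_normal _ _ _ S i k; have nl := @piece_normal _ _ _ S i l.
  rewrite kj in nk; rewrite lj in nl.
  apply: (disjoint_quads nk nl); apply: piece_disjoint.
  by apply: contra kl' => /eqP klE; move: kj; rewrite klE lj => -[->].
- rewrite -/(quad_coord _ _ _) -/(oct_coord _ _ _) qo_quad qo_oct.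
  move=> /card_neq0[k /is_quadE kj] /card_neq0[l /is_octE lj]; exfalso.
  have nk := @piece_normal _ _ _ S i k; have nl := @piece_normal _ _ _ S i l.
  rewrite kj in nk; rewrite lj in nl.
  apply: (disjoint_quad_octagon nk nl); apply: piece_disjoint.
  by apply/eqP => klE; move: kj; rewrite klE lj.
- rewrite -/(quad_coord _ _ _) -/(oct_coord _ _ _) qo_quad qo_oct.
  move=> /card_neq0[l /is_octE lj] /card_neq0[k /is_quadE kj]; exfalso.
  have nk := @piece_normal _ _ _ S i k; have nl := @piece_normal _ _ _ S i l.
  rewrite kj in nk; rewrite lj in nl.
  apply: (disjoint_quad_octagon nk nl); apply: piece_disjoint.
  by apply/eqP => klE; move: kj; rewrite klE lj.
- by rewrite -!/(oct_coord _ _ _) => cj dj; have [->] := oct _ _ _ _ cj dj.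
Qed.

End SurfaceCounts.

(** A discrete primitive: [g] is summed along the orbit from its root, and the vanishing total makes
    the formula hold on the return to the root. *)
Lemma orbit_potential (A : finType) (f : A -> A) (g : A -> int) : injective f ->
  (forall x, \sum_(y <- orbit f x) g y = 0) ->
  exists P : A -> int, forall x, P (f x) = P x + g x.
Proof.
move=> fI g0.
pose P x := \sum_(k < findex f (froot f x) x) g (iter k f (froot f x)).
exists P => x; set r := froot f x.
have rx : fconnect f r x by rewrite fconnect_sym // connect_root.
have rfx : froot f (f x) = r.
  by apply/eqP; rewrite eq_sym root_connect ?fconnect1 //; exact: fconnect_sym.
have xE : iter (findex f r x) f r = x by exact: iter_findex.
have mN := findex_max rx.
rewrite /P rfx -/r.
have [mN'|] := ltnP (findex f r x).+1 (fingraph.order f r).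
  have -> : findex f r (f x) = (findex f r x).+1.
    by rewrite -{1}xE -iterS findex_iter.
  by rewrite big_ord_recr /= xE.
move=> Nm; have Nm' : fingraph.order f r = (findex f r x).+1 by apply/eqP; rewrite eqn_leq Nm mN.
have fxr : f x = r by rewrite -{1}xE -iterS -Nm' iter_order.
rewrite fxr findex0 big_ord0 -[LHS](g0 r).
rewrite (big_nth r) size_orbit Nm' big_mkord big_ord_recr /=.
congr (_ + _); last by rewrite /orbit Nm' nth_traject // xE.
by apply: eq_bigr => k _; rewrite /orbit Nm' nth_traject // ltnS ltnW.
Qed.

(** * Numbers of triangles as potentials on the vertex links *)

Section EdgePotential.
Variables (n : nat) (T : triangulation n).
Variable a : 'I_n -> 'I_4 -> 'I_4 -> int.
Implicit Type p q : position n.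

(* [a i f v] plays the part of the number of arcs that are not in triangles. *)
Definition jump i (f v : 'I_4) : int :=
  if glue T i f is Some (j, s) then a i f v - a j (s f) (s v) else 0.

Definition turn_jump p := jump p.1 (p.2 X_) (p.2 U_).

Lemma turn_jump_across p : turn_jump (across T p) = - turn_jump p.
Proof.
case: p => i m; rewrite /turn_jump /jump /across /=.
case E: (glue T i (m X_)) => [[j s]|] /=; last by rewrite E oppr0.
by rewrite !permM (glueK E) !permK opprB.
Qed.

Lemma turn_jump_flip p : turn_jump (flip (bounce T p)) = - turn_jump p.
Proof. by rewrite /bounce flipK turn_jump_across. Qed.

Notation bc := (bounce T).
Let bI := @bounce_inj n T.

Lemma fconnect_bounce_l p q : fconnect bc (bc p) q = fconnect bc p q.
Proof. by rewrite -same_fconnect1. Qed.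

Lemma fconnect_bounce_r p q : fconnect bc p (bc q) = fconnect bc p q.
Proof. by rewrite -same_fconnect1_r. Qed.

Lemma orbit_flip p : fconnect bc p (flip p) ->
  forall q, fconnect bc p q -> fconnect bc p (flip q).
Proof.
move=> pf q /iter_findex <-; elim: (findex _ _ _) => //= k IH.
by rewrite -fconnect_bounce_r flip_bounce.
Qed.

(** At a free face [bounce] acts as [flip], so an orbit that meets one is closed under [flip]. *)
Lemma orbit_glued p : ~~ fconnect bc p (flip p) ->
  forall q, fconnect bc p q -> glue T q.1 (q.2 X_) <> None.
Proof.
move=> npf q pq E; move/negP: npf; apply.
have bq : bc q = flip q by rewrite /bounce /across E.
rewrite (same_connect (fconnect_sym bI) pq).
apply: orbit_flip; last by rewrite fconnect_sym.
by rewrite -bq fconnect1.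
Qed.

(** [boundary_edge] looks at the whole class of the edge. One orbit reaches this class, because
    steps through the faces opposite to [X_] and [Y_] are made by [bounce] and its inverse. A free
    face opposite to [X_] contradicts [orbit_glued]; one opposite to [Y_] is met in the reverse
    direction. *)
Lemma orbit_interior p : ~~ fconnect bc p (flip p) ->
  ~~ boundary_edge T p.1 (p.2 U_) (p.2 L_).
Proof.
move=> npf; apply/boundary_edgeP => -[j [c [d [f [C [fc fd jf]]]]]].
pose edge q := (q.1, (q.2 U_, q.2 L_)) : 'I_n * ('I_4 * 'I_4).
have bk q : bc (across T (flip q)) = q by rewrite /bounce acrossK flipK.
have edge_across q : edge (across T q) = edge (bc q).
  by rewrite /edge /bounce flip_U flip_L.
have edge_flip q : edge (flip q) = edge q by rewrite /edge flip_U flip_L.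
have XorY (m : 'S_4) g : g != m U_ -> g != m L_ -> g = m X_ \/ g = m Y_.
  move=> gU gL; have U4 : uniq [:: m U_; m L_; m X_; m Y_].
    by rewrite -[X in uniq X]/([seq m i | i <- [:: U_; L_; X_; Y_]]) (map_inj_uniq perm_inj).
  have := mem_uniq4 U4 erefl g; rewrite !inE (negPf gU) (negPf gL) /=.
  by case/orP => /eqP; auto.
have step q g j' s : glue T q.1 (q.2 X_) = Some (j', s) -> g = q.2 X_ ->
    edge (across T q) = (j', (s (q.2 U_), s (q.2 L_))).
  by move=> E _; rewrite /edge /across E /= !permM.
have cl x y : edge_step T x y -> (exists2 q, fconnect bc p q & edge q = x) ->
    exists2 q, fconnect bc p q & edge q = y.
  move=> xy [q pq qx]; subst x; case: q pq xy => i m pq /existsP[g /and3P[gU gL]].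
  case E: (glue T i g) => [[j' s]|//] /eqP ->.
  have [gX|gY] := XorY m g gU gL.
    exists (bc (i, m)); first by rewrite fconnect_bounce_r.
    by rewrite -edge_across; apply: step => //=; rewrite -gX.
  exists (across T (flip (i, m))).
    by rewrite -fconnect_bounce_r bk.
  rewrite (step (flip (i, m)) g j' s) ?flip_X ?flip_U ?flip_L //=.
  by rewrite -gY.
have [q pq] : exists2 q, fconnect bc p q & edge q = (j, (c, d)).
  have {}C : connect (edge_step T) (edge p) (j, (c, d)) by exact: C.
  have base : exists2 q, fconnect bc p q & edge q = edge p by exists p.
  case/connectP: C => s; elim: s (edge p) base
    => [|y s IH] x [q pq qx] /=; first by move=> _ ->; exists q.
  by move=> /andP[xy ys]; apply: IH => //; apply: (cl x y) => //; exists q.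
rewrite /edge => -[Ej Ec Ed]; subst j c d.
have [fX|fY] := XorY q.2 f fc fd.
  by rewrite fX in jf; exact: orbit_glued npf q pq jf.
have bq : bc (flip q) = q.
  by rewrite /bounce /across flip_X /= -fY jf flipK.
move/negP: npf; apply.
have qf : fconnect bc q (flip q) by rewrite -{1}bq fconnect_bounce_l connect0.
have := orbit_flip qf; rewrite (same_connect (fconnect_sym bI) pq); apply.
by rewrite fconnect_sym.
Qed.

Hypothesis matching : forall p, ~~ boundary_edge T p.1 (p.2 U_) (p.2 L_) ->
  \sum_(q <- orbit (turn T) p) (a q.1 (q.2 X_) (q.2 U_) - a q.1 (q.2 Y_) (q.2 U_)) = 0.

(** An orbit that is not closed under [flip] is the cycle of a non-boundary edge, and the sum is its
    matching equation. On an orbit closed under [flip], [across] is an involution that changes the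
    sign of the jump. *)
Lemma sum_turn_jump p : \sum_(q <- orbit bc p) turn_jump q = 0.
Proof.
have [pf|npf] := boolP (fconnect bc p (flip p)).
  have S : \sum_(q <- orbit bc p) turn_jump q = - \sum_(q <- orbit bc p) turn_jump q.
    have E : \sum_(q <- orbit bc p) turn_jump q =
        \sum_(q <- orbit bc p) turn_jump (across T q).
      rewrite !big_uniq ?orbit_uniq //= (reindex_inj (can_inj (@acrossK n T))) /=.
      apply: eq_bigl => q; rewrite -!fconnect_orbit.
      have H q' : fconnect bc p q' -> fconnect bc p (across T q').
        move=> pq; rewrite (_ : across T q' = flip (bc q')); last by rewrite /bounce flipK.
        by apply: orbit_flip => //; rewrite fconnect_bounce_r.
      by apply/idP/idP => /H //; rewrite acrossK.
    rewrite {1}E -sumrN; apply: eq_bigr => q _; exact: turn_jump_across.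
  by move: S; move: (\sum_(_ <- _) _) => x; lia.
have gl := orbit_glued npf.
rewrite -[RHS](matching (orbit_interior npf)) (orbit_bounce gl) sumrB.
rewrite -(sum_orbit (fun q => a q.1 (q.2 Y_) (q.2 U_)) p bI) -sumrB.
rewrite big_seq [RHS]big_seq; apply: eq_bigr => q; rewrite -fconnect_orbit => /gl.
rewrite /turn_jump /jump /bounce /across; case: q => i m /=.
case E: (glue _ _ _) => [[j s]|//] _ /=.
by rewrite !permM tpermR tpermD.
Qed.

(** The second property is needed because [p] and [flip p] stand for the same points of an edge. The
    difference of [P] between a position and its reverse is invariant under [bounce] and changes
    sign under [flip], so it vanishes on an orbit closed under [flip]. *)
Lemma edge_potential : exists P : position n -> int,
  (forall p, P (bc p) = P p + turn_jump p) /\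
  forall p, fconnect bc p (flip p) -> P (flip p) = P p.
Proof.
have [P PP] := orbit_potential bI sum_turn_jump.
exists P; split=> // p pf.
pose D q := P q - P (flip q).
have DE q : D (bc q) = D q.
  have := PP (flip (bc q)); rewrite flip_bounce turn_jump_flip /D PP.
  by move: (P q) (P (flip q)) (P (flip (bc q))) (turn_jump q); clear=> *; lia.
have DD : D (flip p) = D p.
  move/iter_findex: pf => <-; elim: (findex _ _ _) => //= k IH.
  by rewrite DE.
by move: DD; rewrite /D flipK; move: (P p) (P (flip p)); clear=> *; lia.
Qed.

End EdgePotential.

(** * Potentials on the fibres of the quotient map *)

Section Fibres.
Variables (R : realType) (n : nat) (T : triangulation n).
Implicit Type p : tetrahedra R n.

Lemma glue_step_sym p p' : @glue_step R n T p p' -> @glue_step R n T p' p.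
Proof.
move=> [f [s [gl pf pp']]]; exists (s f), s^-1%g; split.
- exact: glueK gl.
- by rewrite pp'.
- by move=> c; rewrite -(permKV s c) pp' permKV.
Qed.

Lemma class_closed (C : set (tetrahedra R n)) p0 :
  (forall p p', C p -> @glue_step R n T p p' -> C p') -> C p0 ->
  forall p, clos_refl_sym_trans _ (@glue_step R n T) p0 p -> C p.
Proof.
move=> Cs C0 p H; suff : C p0 <-> C p by case=> + _; apply.
elim: H => {p0 C0 p} [x y xy|//|x y _ IH|x y z _ IH1 _ IH2].
- by split=> [/Cs/(_ xy)|/Cs/(_ (glue_step_sym xy))].
- by split=> /IH.
- by split=> [/IH1/IH2|/IH2/IH1].
Qed.

Variables (a : 'I_n -> 'I_4 -> 'I_4 -> int) (e : R).
Hypothesis e01 : 0 < e < 2^-1.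

Lemma near_vertex_unique (x : tetra R) u v : bary x v = 1 - e -> 2^-1 < bary x u -> u = v.
Proof.
move=> xv xu; apply: contrapT => /eqP uv.
have : bary x u + bary x v <= 1.
  rewrite -(sum_bary x) (bigD1 u) //= (bigD1 v) 1?eq_sym //= addrA lerDl.
  by apply: sumr_ge0 => c _; exact: bary_ge0.
by move: e01 xv xu; move: (bary _ _) (bary _ _) => *; lra.
Qed.

(* Around a point at distance [e] from a vertex, the difference between the two
   sides of an identified face is the jump of the number of triangles.       *)
Definition potential_on (C : set (tetrahedra R n)) (g : tetrahedra R n -> int) :=
  forall p p' f s v, C p -> glue T (tag p) f = Some (tag p', s) ->
    bary (tagged p) f = 0 ->
    (forall c, bary (tagged p') (s c) = bary (tagged p) c) ->
    bary (tagged p) v = 1 - e ->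
    g p' = g p + (a (tag p) f v - a (tag p') (s f) (s v)).

Section Profile.
Variable H : tetra R.
Hypotheses (HU : bary H U_ = 1 - e) (HL : bary H L_ != 0).
Hypothesis HYX : bary H Y_ = 0 -> bary H X_ = 0.

(** The points of a fibre have the same coordinates up to order; [H] lists them for the labels U, L,
    X, Y and a position places them in a tetrahedron. By [HYX] a zero is put on [X_] first: the
    point is inside the tetrahedron, inside a face or inside an edge when none, one or both of the
    coordinates at [X_] and [Y_] vanish. *)
Definition point_at (q : position n) : tetrahedra R n :=
  existT _ q.1 (perm_tetra q.2 H).

Lemma bary_point_at q c : bary (tagged (point_at q)) (q.2 c) = bary H c.
Proof. exact: bary_perm. Qed.

Lemma point_at_eq (q : position n) p' : tag p' = q.1 ->
  (forall c, bary (tagged p') (q.2 c) = bary H c) -> p' = point_at q.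
Proof.
case: p' => i x /= -> E; congr existT; apply: bary_inj => c.
by rewrite -(permKV q.2 c) E bary_perm.
Qed.

Lemma point_at_flip q : bary H Y_ = bary H X_ -> point_at (flip q) = point_at q.
Proof.
move=> YX; apply: point_at_eq => // c.
have -> : q.2 c = (flip q).2 (tperm X_ Y_ c) by rewrite /= permM tpermK.
rewrite bary_point_at.
by case: tpermP => // ->.
Qed.

Lemma point_at_across (q : position n) j s p' : glue T q.1 (q.2 X_) = Some (j, s) -> tag p' = j ->
  (forall c, bary (tagged p') (s c) = bary (tagged (point_at q)) c) ->
  p' = point_at (across T q).
Proof.
move=> E pj ps; rewrite /across E; apply: point_at_eq => //= c.
by rewrite permM ps bary_point_at.
Qed.

Lemma zero_XY (q : position n) f : bary (tagged (point_at q)) f = 0 ->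
  f = q.2 X_ /\ bary H X_ = 0 \/ f = q.2 Y_ /\ bary H Y_ = 0.
Proof.
rewrite -(permKV q.2 f) bary_point_at; set c := (_ f).
have := mem_uniq4 (s := [:: U_; L_; X_; Y_]) isT erefl c.
rewrite !inE => /or4P[]/eqP -> H0; try by [left|right].
  by move: H0 e01; rewrite HU => H0; lra.
by move: HL; rewrite H0 eqxx.
Qed.

Variables (S : set (position n)) (P : position n -> int) (q0 : position n).
Hypothesis Sq0 : S q0.
Hypothesis Sacross : forall q, S q -> bary H X_ = 0 ->
  glue T q.1 (q.2 X_) <> None ->
  exists q', [/\ S q', point_at q' = point_at (across T q) &
    P q' = P q + turn_jump T a q].
Hypothesis Sflip : forall q, S q -> bary H X_ = 0 -> bary H Y_ = 0 ->
  glue T q.1 (q.2 Y_) <> None ->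
  exists q', [/\ S q', point_at q' = point_at (across T (flip q)) &
    P q' = P q + turn_jump T a (flip q)].
Hypothesis Sinj : forall q q', S q -> S q' -> point_at q = point_at q' -> P q = P q'.

Lemma fibre_step (q : position n) p' f s : S q -> glue T q.1 f = Some (tag p', s) ->
  bary (tagged (point_at q)) f = 0 ->
  (forall c, bary (tagged p') (s c) = bary (tagged (point_at q)) c) ->
  exists q', [/\ S q', p' = point_at q' &
    P q' = P q + (a q.1 f (q.2 U_) - a (tag p') (s f) (s (q.2 U_)))].
Proof.
move=> Sq gl f0 ps; have [[fX HX]|[fY HY]] := zero_XY f0.
  rewrite fX in gl *.
  have [|q' [Sq' pq' PE]] := Sacross Sq HX; first by rewrite gl.
  exists q'; split=> //; first by rewrite pq'; exact: point_at_across gl erefl ps.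
  by rewrite PE /turn_jump /jump gl.
have HX := HYX HY; rewrite fY -flip_X in gl *.
have [|q' [Sq' pq' PE]] := Sflip Sq HX HY; first by rewrite -flip_X gl.
exists q'; split=> //.
  rewrite pq'; apply: (point_at_across (q := flip q) gl erefl).
  by rewrite point_at_flip // HX HY.
by rewrite PE /turn_jump /jump /= flip_U -[(tperm _ _ * _)%g]/((flip q).2) gl.
Qed.

(** The positions in [S] reach the whole fibre, and [Sinj] lets [P] descend from positions to
    points. *)
Lemma fibre_potential : exists g, potential_on
  [set p | clos_refl_sym_trans _ (@glue_step R n T) (point_at q0) p] g.
Proof.
pose C := [set p | exists2 q, S q & p = point_at q].
have CC p : clos_refl_sym_trans _ (@glue_step R n T) (point_at q0) p -> C p.
  apply: class_closed; last by exists q0.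
  move=> {}p p' [q Sq ->] [f [s [gl f0 ps]]].
  by have [q' [Sq' -> _]] := fibre_step Sq gl f0 ps; exists q'.
pose g p := P (xget q0 [set q | S q /\ p = point_at q]).
have gE q : S q -> g (point_at q) = P q.
  move=> Sq; rewrite /g; case: xgetP => [q' _ [Sq' E]|/(_ q)]; last by case.
  exact: Sinj.
exists g => p p' f s v /CC[q Sq pE] gl f0 ps pv; subst p.
have vU : q.2 U_ = v.
  apply: (near_vertex_unique pv); rewrite bary_point_at HU.
  by move: e01; lra.
have [q' [Sq' -> PE]] := fibre_step Sq gl f0 ps.
by rewrite !gE // PE vU.
Qed.

End Profile.

Lemma perm_of_uniq4 (u l x y : 'I_4) : uniq [:: u; l; x; y] ->
  exists m : 'S_4, [/\ m U_ = u, m L_ = l, m X_ = x & m Y_ = y].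
Proof.
move=> U4; pose f (c : 'I_4) := nth u [:: u; l; x; y] c.
have fI : injective f.
  move=> c d /eqP; rewrite /f nth_uniq // => /eqP; exact: val_inj.
by exists (perm fI); split; rewrite permE.
Qed.

Hypothesis matching : forall p : position n, ~~ boundary_edge T p.1 (p.2 U_) (p.2 L_) ->
  \sum_(q <- orbit (turn T) p) (a q.1 (q.2 X_) (q.2 U_) - a q.1 (q.2 Y_) (q.2 U_)) = 0.

Lemma position_profile p v : bary (tagged p) v = 1 - e ->
  exists H q, [/\ p = point_at H q, bary H U_ = 1 - e, bary H L_ != 0 &
    (bary H Y_ = 0 -> bary H X_ = 0)].
Proof.
move=> pv; case: p pv => i x /= xv.
have [l lv xl] : exists2 l, l != v & bary x l != 0.
  apply: contrapT => N; have : \sum_c bary x c = 1 - e.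
    rewrite (bigD1 v) //= xv big1 ?addr0 // => l lv.
    by apply/eqP; apply: contrapT => /negP xl; apply: N; exists l.
  by rewrite sum_bary => E; move: e01; lra.
rewrite eq_sym in lv.
have [c [d vlcd]] := uniq4_complete lv.
have [c' [d' [U' dc]]] : exists c' d', uniq [:: v; l; c'; d'] /\ (bary x d' = 0 -> bary x c' = 0).
  have [xc|xc] := eqVneq (bary x c) 0; first by exists c, d.
  exists d, c; split; last by move=> E; rewrite E eqxx in xc.
  by reorder.
have [m [mU mL mX mY]] := perm_of_uniq4 U'.
have E k : bary (perm_tetra m^-1%g x) k = bary x (m k).
  by rewrite -{1}(permK m k) bary_perm.
exists (perm_tetra m^-1%g x), (i, m); rewrite !E mU mL mX mY; split=> //.
by apply: point_at_eq => //= k; rewrite E.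
Qed.

(** An interior point is alone in its fibre, a point inside a face is identified with at most one
    other, and the points identified with a point of an edge are described by one orbit of [bounce],
    where [edge_potential] applies. *)
Lemma stalk_potential p v : bary (tagged p) v = 1 - e ->
  exists g, potential_on [set p' | clos_refl_sym_trans _ (@glue_step R n T) p p'] g.
Proof.
move=> /position_profile[H [q0 [-> HU HL HYX]]].
have [HX|HX] := eqVneq (bary H X_) 0; last first.
  apply: (@fibre_potential _ HU HL HYX [set q0] (fun=> 0)) => //.
  - by move=> q _ HX0; rewrite HX0 eqxx in HX.
  - by move=> q _ HX0; rewrite HX0 eqxx in HX.
have [HY|HY] := eqVneq (bary H Y_) 0; last first.
  have [E|gl] := eqVneq (glue T q0.1 (q0.2 X_)) None.
    apply: (@fibre_potential _ HU HL HYX [set q0] (fun=> 0)) => //.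
    - by move=> q -> _; rewrite E.
    - by move=> q _ _ HY0; rewrite HY0 eqxx in HY.
  (* Otherwise the face would be glued to itself, against [glue_neq], and one point would receive
     two values. *)
  have neq : point_at H q0 <> point_at H (across T q0).
    move=> E; have zX := bary_point_at H q0 X_; rewrite E in zX.
    have [[EX _]|[_ HY0]] := zero_XY HU HL (etrans zX HX); last by rewrite HY0 eqxx in HY.
    have := congr1 (fun p => tag p) E; move: gl EX; rewrite /across.
    case gq : (glue _ _ _) => [[j s]|//] _ /=; rewrite permM => EX ji.
    by have := glue_neq gq; rewrite -EX -ji eqxx.
  apply: (@fibre_potential _ HU HL HYX [set q | q = q0 \/ q = across T q0]
    (fun q => if q == q0 then 0 else turn_jump T a q0)); first by left.
  - move=> q [->|->] _ _.
      exists (across T q0); split=> //; first by right.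
      rewrite eqxx add0r; case: eqP => // E.
      by exfalso; apply: neq; rewrite E.
    exists q0; split=> //; [by left|by rewrite acrossK|].
    rewrite turn_jump_across eqxx; case: eqP => [E|_]; last by rewrite subrr.
    by exfalso; apply: neq; rewrite E.
  - by move=> q _ _ HY0; rewrite HY0 eqxx in HY.
  - move=> q q' [->|->] [->|->] // E; exfalso; exact: neq.
have [P [PB PF]] := edge_potential matching.
have HYX' : bary H Y_ = bary H X_ by rewrite HX HY.
pose bI := @bounce_inj n T.
have pB q : point_at H (bounce T q) = point_at H (across T q).
  by rewrite /bounce point_at_flip.
apply: (@fibre_potential _ HU HL HYX [set q | fconnect (bounce T) q0 q] P).
- exact: connect0.
- by move=> q Sq _ _; exists (bounce T q); rewrite /= fconnect_bounce_r.
- move=> q Sq _ _ _; exists (across T (flip q)); split=> //.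
    by rewrite /= -fconnect_bounce_r /bounce acrossK flipK.
  have := PB (across T (flip q)); rewrite turn_jump_across /bounce acrossK flipK.
  by move: (P q) (P _) (turn_jump _ _ _); clear=> *; lia.
move=> q q' Sq Sq' E.
have qq' : fconnect (bounce T) q q'.
  by rewrite -(same_connect (fconnect_sym bI) Sq).
(* The coordinate at [U_] is above one half, the one at [L_] is nonzero and the other two vanish, so
   the point leaves only the labels [X_] and [Y_] undetermined. *)
have [->|fE] : q = q' \/ q' = flip q; first last.
- by rewrite fE in qq' *; rewrite PF.
- by [].
have E1 : q.1 = q'.1 := congr1 (fun p => tag p) E.
have EU : q.2 U_ = q'.2 U_.
  have := bary_point_at H q' U_; rewrite -E HU => /near_vertex_unique; apply.
  by rewrite bary_point_at HU; move: e01; lra.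
have EL : q.2 L_ = q'.2 L_.
  have zq := bary_point_at H q L_; rewrite E in zq.
  have : bary (tagged (point_at H q')) (q.2 L_) != 0 by rewrite zq.
  rewrite -(permKV q'.2 (q.2 L_)) bary_point_at; set c := (_ (q.2 L_)).
  have := mem_uniq4 (s := [:: U_; L_; X_; Y_]) isT erefl c.
  rewrite !inE => /or4P[]/eqP cE; rewrite ?cE ?HX ?HY ?eqxx // => _.
  have : q.2 L_ = q'.2 U_ by rewrite -cE permKV.
  by rewrite -EU => /perm_inj.
case: q q' E1 EU EL {Sq Sq' E qq'} => i m [i' m'] /= <- EU EL.
have mm' c : m' c != m U_ -> m' c != m L_ -> m' c = m X_ \/ m' c = m Y_.
  move=> cU cL; have U4 : uniq [:: m U_; m L_; m X_; m Y_].
    by rewrite -[X in uniq X]/([seq m i | i <- [:: U_; L_; X_; Y_]]) (map_inj_uniq perm_inj).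
  have := mem_uniq4 U4 erefl (m' c); rewrite !inE (negPf cU) (negPf cL) /=.
  by case/orP => /eqP; auto.
have all4 (m1 m2 : 'S_4) : m1 U_ = m2 U_ -> m1 L_ = m2 L_ -> m1 X_ = m2 X_ ->
    m1 Y_ = m2 Y_ -> m1 = m2.
  move=> eU eL eX eY; apply/permP => c.
  by have := mem_uniq4 (s := [:: U_; L_; X_; Y_]) isT erefl c; rewrite !inE => /or4P[]/eqP ->.
have mX : m' X_ = m X_ \/ m' X_ = m Y_.
  by apply: mm'; rewrite ?EU ?EL (inj_eq perm_inj).
have mY : m' Y_ = m X_ \/ m' Y_ = m Y_.
  by apply: mm'; rewrite ?EU ?EL (inj_eq perm_inj).
have XY : m' X_ <> m' Y_ by move=> /perm_inj.
case: mX => mX; case: mY => mY; rewrite ?mX ?mY // in XY.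
- by left; congr pair; apply: all4.
- right; rewrite /flip /=; congr pair; apply: all4; rewrite permM ?tpermL ?tpermR // tpermD //.
Qed.

End Fibres.

Lemma near_forall (X : topologicalType) (x : X) (I : finType) (P : I -> X -> Prop) :
  (forall i, \forall u \near x, P i u) -> \forall u \near x, forall i, P i u.
Proof. exact: filter_forall. Qed.

(** * Topology of the tetrahedra and of the quotient *)

Section TetraTopology.
Variable R : realType.

Lemma nbhs_tetraP (x : tetra R) (U : set (tetra R)) : nbhs x U <->
  exists2 d : R, 0 < d & forall y, (forall c, `|bary y c - bary x c| < d) -> U y.
Proof.
split=> [xU|[d d0 dU]].
  have /nbhs_ballP[d d0 dU] : nbhs (x : set_type (@simplex R)) U by exact: xU.
  exists d => // y yd; apply: dU; rewrite /ball /= /initial_ball.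
  rewrite /ball /=; split=> // i c; rewrite ord1 -ball_normE /= distrC.
  exact: yd.
have H : \forall y \near x, forall c, `|bary y c - bary x c| < d.
  apply: near_forall => c.
  have := @continuous_bary R c x => /cvgrPdist_lt/(_ d d0).
  by apply: filterS => y; rewrite distrC.
by apply: filterS H.
Qed.

Lemma vtxP (v : 'I_4) : exists x : tetra R, forall c, bary x c = (c == v)%:R.
Proof.
apply: tetraP => [c|]; first exact: ler0n.
by rewrite (bigD1 v) //= eqxx big1 ?addr0 // => c /negPf ->.
Qed.

Definition vtx v := sval (cid (vtxP v)).

Lemma bary_vtx v c : bary (vtx v) c = (c == v)%:R.
Proof. by rewrite /vtx; case: cid. Qed.

Lemma open_face_vtx v (x : tetra R) : open_face [set v]%SET x <-> x = vtx v.
Proof.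
split=> [xv|-> c]; last by rewrite bary_vtx inE ltr0n; case: (c == v).
have z c : c != v -> bary x c = 0.
  by move=> cv; have := xv c; rewrite inE (negPf cv) lt_neqAle bary_ge0 andbT => /negbFE/eqP.
apply: bary_inj => c; rewrite bary_vtx; have [->|/z //] := eqVneq c v.
by rewrite -(sum_bary x) (bigD1 v) //= big1 ?addr0.
Qed.

Lemma segmentP (x y : tetra R) (t : R) : 0 <= t <= 1 ->
  exists z : tetra R, forall c, bary z c = bary x c + t * (bary y c - bary x c).
Proof.
move=> /andP[t0 t1]; apply: tetraP => [c|].
  have := bary_ge0 x c; have := bary_ge0 y c.
  by move: (bary _ _) (bary _ _) => *; nra.
by rewrite big_split /= -mulr_sumr sumrB !sum_bary subrr mulr0 addr0.
Qed.

Definition segment (x y : tetra R) (t : R) : tetra R :=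
  if pselect (0 <= t <= 1) is left t01 then sval (cid (segmentP x y t01)) else x.

Lemma bary_segment x y t c : 0 <= t <= 1 ->
  bary (segment x y t) c = bary x c + t * (bary y c - bary x c).
Proof. by rewrite /segment; case: pselect => // t01 _; case: cid. Qed.

Lemma within_continuous_tetra (X : topologicalType) (A : set X) (h : X -> tetra R)
    (g : 'I_4 -> X -> R) :
  (forall c, continuous (g c)) -> (forall u c, A u -> bary (h u) c = g c u) ->
  {within A, continuous h}.
Proof.
move=> gc hg; apply: near_within_continuous => u P Au /nbhs_tetraP[d d0 dP].
have H : \forall z \near u, forall c, `|g c z - g c u| < d.
  apply: near_forall => c.
  have := gc c u => /cvgrPdist_lt/(_ d d0).
  by apply: filterS => y; rewrite distrC.
by apply: filterS H => z zd Az; apply: dP => c; rewrite !hg.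
Qed.

Lemma segment_continuous x y : {within `[0, 1], continuous (segment x y)}.
Proof.
have gc c : continuous (fun t : R => bary x c + t * (bary y c - bary x c)).
  move=> t; apply: cvgD; first exact: cvg_cst.
  by apply: cvgM; [exact: cvg_id|exact: cvg_cst].
have hg t c : `[0, 1]%classic t ->
    bary (segment x y t) c = bary x c + t * (bary y c - bary x c).
  by rewrite /= in_itv; exact: bary_segment.
exact: within_continuous_tetra gc hg.
Qed.

Lemma segment0 x y : segment x y 0 = x.
Proof. by apply: bary_inj => c; rewrite bary_segment ?lexx ?ler01 // mul0r addr0. Qed.

Lemma segment1 x y : segment x y 1 = y.
Proof. by apply: bary_inj => c; rewrite bary_segment ?lexx ?ler01 // mul1r subrKC. Qed.

(** Turns finitely many strict conditions into one radius; an index where [k] vanishes imposes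
    nothing. *)
Lemma positive_gap (I : finType) (k : I -> R) :
  exists2 d, 0 < d & forall i, k i != 0 -> d <= `|k i|.
Proof.
suff [d d0 dk] : exists2 d, 0 < d & forall i, i \in enum I -> k i != 0 -> d <= `|k i|.
  by exists d => // i; apply: dk; rewrite mem_enum.
elim: (enum I) => [|i s [d d0 IH]]; first by exists 1.
have [ki|ki] := eqVneq (k i) 0.
  exists d => // j; rewrite inE => /orP[/eqP ->|/IH //]; by rewrite ki eqxx.
exists (Num.min d `|k i|); first by rewrite lt_min d0 normr_gt0.
move=> j; rewrite inE => /orP[/eqP ->|js] kj; rewrite ge_min ?lexx ?orbT //.
by rewrite IH.
Qed.

End TetraTopology.

Section Realization.
Variables (R : realType) (n : nat) (T : triangulation n).
Implicit Types (p q : tetrahedra R n) (y z : realization R T).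

Definition close (d : R) p q :=
  tag q = tag p /\ forall c, `|bary (tagged q) c - bary (tagged p) c| < d.

Lemma nbhs_closeP p (U : set (tetrahedra R n)) : nbhs p U <->
  exists2 d : R, 0 < d & forall q, close d p q -> U q.
Proof.
case: p => i x; split.
  move=> H; have /nbhs_tetraP[d d0 dU] : nbhs x [set y | U (existT _ i y)] := H.
  by exists d => // -[j y] [/= ji]; subst j => /dU.
move=> [d d0 dU]; have : nbhs x [set y | U (existT _ i y)].
  by apply/nbhs_tetraP; exists d => // y yd; apply: dU; split.
by [].
Qed.

Lemma nbhs_pi p (B : set (realization R T)) : nbhs (\pi_(realization R T) p) B ->
  nbhs p (\pi_(realization R T) @^-1` B).
Proof.
rewrite nbhsE; case=> O [oO Op] OB.
apply: (@filterS _ _ _ (\pi_(realization R T) @^-1` O)); first by move=> q; exact: OB.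
by apply: open_nbhs_nbhs; split; [exact: oO|exact: Op].
Qed.

Definition saturated (V : set (tetrahedra R n)) :=
  forall p p', V p -> @glue_step R n T p p' -> V p'.

Lemma saturated_class V p q : saturated V ->
  \pi_(realization R T) p = \pi_(realization R T) q -> V p -> V q.
Proof. by move=> sV /pt_eqP pq Vp; exact: class_closed sV Vp _ pq. Qed.

Lemma saturated_repr V p : saturated V -> V (generic_quotient.repr (\pi_(realization R T) p)) <-> V p.
Proof. by move=> sV; split; apply: saturated_class => //; rewrite reprK. Qed.

Lemma saturated_open V : saturated V -> open V -> open [set y : realization R T | V (generic_quotient.repr y)].
Proof.
move=> sV oV; rewrite /open /= /quotient_open.
rewrite (_ : _ @^-1` _ = V) //; apply/seteqP; split=> p /=; exact: (saturated_repr p sV).1 || exact: (saturated_repr p sV).2.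
Qed.

Lemma saturated_near V y : saturated V -> open V -> V (generic_quotient.repr y) ->
  \forall z \near y, V (generic_quotient.repr z).
Proof. by move=> sV oV Vy; apply: open_nbhs_nbhs; split=> //; exact: saturated_open. Qed.

Lemma open_closeP V : (forall p, V p -> exists2 d : R, 0 < d & forall q, close d p q -> V q) ->
  open V.
Proof. by move=> H; rewrite openE => p /H; rewrite /interior -nbhs_closeP. Qed.

Variables (e : R).
Hypothesis e01 : 0 < e < 2^-1.
Variable x : realization R T.

(** The set [r] selects a slice of the corners at [x]: [1 - e < b] gives the vertex neighbourhood
    and [b = 1 - e] its frontier. *)
Definition cone (r : set R) : set (tetrahedra R n) :=
  [set p | exists v, pt T (tag p) (vtx R v) = x /\ r (bary (tagged p) v)].

Lemma vtx_glue i f j s v : glue T i f = Some (j, s) -> f != v ->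
  pt T i (vtx R v) = pt T j (vtx R (s v)).
Proof.
move=> gl fv; apply/pt_eqP; apply: rst_step; exists f, s; split=> //=.
  by rewrite bary_vtx (negPf fv).
by move=> c; rewrite !bary_vtx (inj_eq perm_inj).
Qed.

(** Only a gluing along the face opposite to [v] could lose the vertex [v], and on that face the
    coordinate at [v] is zero. *)
Lemma cone_saturated r : ~ r 0 -> saturated (cone r).
Proof.
move=> r0 p p' [v [vx rv]] [f [s [gl pf ps]]]; exists (s v); split; last by rewrite ps.
by rewrite -vx; apply/esym/(vtx_glue gl); apply/eqP => fv; apply: r0; rewrite -pf fv.
Qed.

Lemma vertex_nbhdE y : vertex_nbhd x e y <-> cone [set b | 1 - e < b] (generic_quotient.repr y).
Proof.
have sat : saturated (cone [set b | 1 - e < b]).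
  by apply: cone_saturated => /=; move: e01; lra.
split=> [[i [v [p [q [/open_face_vtx -> xp qv ->]]]]]|].
  by apply/(saturated_repr _ sat); exists v.
case E : (generic_quotient.repr y) => [i q] [v [vx qv]]; exists i, v, (vtx R v), q; split=> //.
  by apply/open_face_vtx.
by rewrite -(reprK y) E.
Qed.

Lemma cone_gt_open : open (cone [set b | 1 - e < b]).
Proof.
apply: open_closeP => p [v [vx /= pv]]; exists (bary (tagged p) v - (1 - e)).
  by rewrite subr_gt0.
move=> q [pq qd]; exists v; rewrite pq /=; split=> //; move: (qd v).
by rewrite ltr_norml; move: (bary _ _) (bary _ _) => *; lra.
Qed.

Lemma cone_lt_open : open (~` cone [set b | 1 - e <= b]).
Proof.
apply: open_closeP => p pc.
(* A margin is needed only for the coordinates below [1 - e]; the others are at vertices not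
   identified with [x], as [p] is outside the cone. *)
pose k (v : 'I_4) := Num.min 0 (bary (tagged p) v - (1 - e)).
have [d d0 dk] := positive_gap k; exists d => // q [pq qd] [v [vx /= qv]].
apply: pc; exists v; rewrite -pq; split=> //=.
rewrite leNgt; apply/negP => lt; have kv : k v = bary (tagged p) v - (1 - e).
  by rewrite /k min_r // subr_le0 ltW.
have := dk v; rewrite kv lt_eqF ?subr_lt0 // => /(_ isT).
rewrite ltr0_norm ?subr_lt0 //; move: (qd v); rewrite ltr_norml.
by move: qv lt; move: (bary _ _) (bary _ _) => *; lra.
Qed.

Lemma cone_unique p v v' : bary (tagged p) v = 1 - e -> 1 - e <= bary (tagged p) v' -> v' = v.
Proof. by move=> pv pv'; apply: (near_vertex_unique e01 pv); move: e01; lra. Qed.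

(** A point at level [1 - e] enters the neighbourhood when it is pushed towards its vertex. It is
    not already inside through another corner, since at most one coordinate exceeds one half. *)
Lemma link_frontier y :
  frontier (vertex_nbhd x e) y <-> cone [set b | b = 1 - e] (generic_quotient.repr y).
Proof.
have sgt : saturated (cone [set b | 1 - e < b]).
  by apply: cone_saturated => /=; move: e01; lra.
have sge : saturated (~` cone [set b | 1 - e <= b]).
  have s' : saturated (cone [set b | 1 - e <= b]).
    by apply: cone_saturated => /=; move: e01; lra.
  by move=> p p' pc pp' pc'; apply: pc; exact: s' pc' (glue_step_sym pp').
split=> [[cy ny]|[v [vx yv]]].
  have ny' : ~ vertex_nbhd x e y.
    move=> /vertex_nbhdE yV; apply: ny.
    apply: filterS (saturated_near sgt cone_gt_open yV) => z.
    by move/vertex_nbhdE.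
  have [v [vx yv]] : cone [set b | 1 - e <= b] (generic_quotient.repr y).
    apply: contrapT => N.
    have [z [/vertex_nbhdE[v [vx zv]]]] := cy _ (saturated_near sge cone_lt_open N).
    by apply; exists v; split=> //; exact: ltW.
  exists v; split=> //=; apply: contrapT => /eqP ne; apply: ny'; apply/vertex_nbhdE.
  by exists v; split=> //=; rewrite lt_neqAle eq_sym ne.
split; last first.
  move=> /nbhs_singleton/vertex_nbhdE[v' [_ /= yv']].
  have E := cone_unique yv (ltW yv'); move: yv'; rewrite E yv; lra.
move=> B By.
have : nbhs (generic_quotient.repr y) (\pi_(realization R T) @^-1` B).
  by apply: nbhs_pi; rewrite reprK.
move=> /nbhs_closeP[d d0 dB].
pose t := Num.min (d / 2) 1.
have t01 : 0 < t <= 1 by rewrite lt_min divr_gt0 //= ltr01 ge_min lexx orbT.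
have td : t < d by rewrite gt_min ltr_pdivrMr // ltr_pMr // ltr1n.
have t01' : 0 <= t <= 1 by case/andP: t01 => /ltW -> ->.
pose q : tetrahedra R n := existT _ (tag (generic_quotient.repr y)) (segment (tagged (generic_quotient.repr y)) (vtx R v) t).
exists (\pi_(realization R T) q); split.
  apply/vertex_nbhdE/(saturated_repr _ sgt); exists v; split=> //=.
  rewrite bary_segment // bary_vtx eqxx yv subKr ltrDl mulr_gt0 //.
    by case/andP: t01.
  by case/andP: e01.
apply: dB; split=> //= c; rewrite bary_segment // addrAC subrr add0r.
have b1 : bary (tagged (generic_quotient.repr y)) c <= 1.
  rewrite -(sum_bary (tagged (generic_quotient.repr y))) (bigD1 c) //= lerDl.
  by apply: sumr_ge0 => *; exact: bary_ge0.
have b0 := bary_ge0 (tagged (generic_quotient.repr y)) c.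
rewrite normrM (ger0_norm (x := t)); last by case/andP: t01'.
rewrite (le_lt_trans _ td) // ler_piMr //; first by case/andP: t01'.
rewrite bary_vtx ler_norml; case: (c == v) => /=; move: b0 b1; move: (bary _ _) => *; lra.
Qed.

End Realization.

(** * Sections over a vertex link *)

Section LinkPotential.
Variables (R : realType) (n : nat) (T : triangulation n).
Variables (a : 'I_n -> 'I_4 -> 'I_4 -> int) (e : R) (x : realization R T).
Hypothesis e01 : 0 < e < 2^-1.
Hypothesis matching : forall p : position n, ~~ boundary_edge T p.1 (p.2 U_) (p.2 L_) ->
  \sum_(q <- orbit (turn T) p) (a q.1 (q.2 X_) (q.2 U_) - a q.1 (q.2 Y_) (q.2 U_)) = 0.
Implicit Types (p q : tetrahedra R n) (y z : realization R T).

Notation pi := (\pi_(realization R T)).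
Notation rep y := (generic_quotient.repr (y : realization R T) : tetrahedra R n).
Let A := frontier (vertex_nbhd x e).
Hypothesis torsorsA : trivial_torsors A.

Let eqs := cone x [set b : R | b = 1 - e].

Lemma eqs_saturated : saturated T eqs.
Proof. by apply: cone_saturated => /=; move: e01; lra. Qed.

Lemma frontier_fibre y p : A y -> pi p = y -> exists2 v, pt T (tag p) (vtx R v) = x & bary (tagged p) v = 1 - e.
Proof.
move=> /(link_frontier e01 x y) Ay py.
have [v [vx vp]] : eqs p.
  by apply: (saturated_class eqs_saturated (p := rep y)) => //; rewrite reprK.
by exists v.
Qed.

(** As the coordinates are the same up to order along a fibre, finitely many numbers have to be
    bounded. Within [d] of the fibre, the nearby point of the fibre is unique, a coordinate that
    vanishes also vanishes at that point, and the vertex at level [1 - e] keeps a coordinate above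
    one half. *)
Lemma fibre_gap y : exists d : R, [/\ 0 < d, d <= 2^-1 - e,
  (forall p p', pi p = y -> pi p' = y -> close (d + d) p p' -> p = p') &
  (forall p c, pi p = y -> bary (tagged p) c != 0 -> d <= bary (tagged p) c)].
Proof.
pose h := bary (tagged (rep y)).
have [d1 d10 d1P] := positive_gap (fun ab : 'I_4 * 'I_4 => h ab.1 - h ab.2).
have [d2 d20 d2P] := positive_gap h.
have fib p : pi p = y -> exists s : 'S_4, forall c, bary (tagged p) (s c) = h c.
  move=> py.
  pose V : set (tetrahedra R n) := [set p | exists s : 'S_4, forall c, bary (tagged p) (s c) = h c].
  have sV : saturated T V.
    move=> q q' [s sq] [f [s' [_ _ sq']]]; exists (s * s')%g => c.
    by rewrite permM sq' sq.
  apply: (saturated_class sV (p := rep y)); first by rewrite reprK.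
  by exists 1%g => c; rewrite perm1.
exists (Num.min (d1 / 2) (Num.min d2 (2^-1 - e))); split.
- by rewrite !lt_min d20 divr_gt0 //=; move: e01; lra.
- by rewrite !ge_min lexx !orbT.
- move=> p p' /fib[s sp] /fib[s' sp'] [pp' cl].
  case: p p' pp' sp sp' cl => i u [i' u'] /= ii' sp sp' cl; subst i'.
  congr existT; apply: bary_inj => c.
  have E : bary u c = h (s^-1%g c) by rewrite -sp permKV.
  have E' : bary u' c = h (s'^-1%g c) by rewrite -sp' permKV.
  have lt := cl c.
  apply/esym/eqP; rewrite -subr_eq0; apply: contraT => ne.
  rewrite E E' in lt ne.
  have := d1P (_, _) ne => /= le.
  have := le_lt_trans le lt.
  have : Num.min (d1 / 2) (Num.min d2 (2^-1 - e)) <= d1 / 2 by rewrite ge_min lexx.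
  by move: (Num.min _ _) => m; lra.
- move=> p c /fib[s sp]; rewrite -(permKV s c) sp => /d2P.
  rewrite ger0_norm ?bary_ge0 // => le; rewrite (le_trans _ le) //.
  by rewrite !ge_min lexx !orbT.
Qed.

Lemma stalk_choice y : exists g, A y -> potential_on T a e [set p | pi p = y] g.
Proof.
have [Ay|nA] := pselect (A y); last by exists (fun=> 0).
have [v _ vy] := frontier_fibre Ay (reprK y).
have [g gP] := stalk_potential e01 matching vy.
exists g => _ p p' f s v' py; apply: gP.
by rewrite /=; apply/pt_eqP; rewrite py reprK.
Qed.

Definition stalk y := sval (cid (stalk_choice y)).
Definition gap y := sval (cid (fibre_gap y)).

Lemma stalkP y : A y -> potential_on T a e [set p | pi p = y] (stalk y).
Proof. by rewrite /stalk; case: cid. Qed.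

Lemma gap_gt0 y : 0 < gap y.
Proof. by rewrite /gap; case: cid => ? []. Qed.

Lemma gap_half y : gap y <= 2^-1 - e.
Proof. by rewrite /gap; case: cid => ? []. Qed.

Lemma gap_sep y p p' q : pi p = y -> pi p' = y -> close (gap y) p q ->
  close (gap y) p' q -> p = p'.
Proof.
move=> py py' [pq cq] [pq' cq']; rewrite /gap in cq cq' *; move: cq cq'.
case: cid => d [_ _ sep _] /= cq cq'; apply: sep => //; split; first by rewrite -pq -pq'.
move=> c; move: (cq c) (cq' c); rewrite !ltr_norml.
by move: (bary _ _) (bary _ _) (bary _ _) => *; lra.
Qed.

Lemma gap_zero y p q f : pi p = y -> close (gap y) p q -> bary (tagged q) f = 0 ->
  bary (tagged p) f = 0.
Proof.
move=> py [pq cq] qf; apply/eqP; apply: contraT => pf; move: (cq f); rewrite qf sub0r normrN.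
rewrite ger0_norm ?bary_ge0 // /gap; case: cid => d [_ _ _ /(_ p f py pf)] /=.
by move=> le lt; move: (le_lt_trans le lt); rewrite ltxx.
Qed.

Definition star y : set (tetrahedra R n) :=
  [set q | exists2 p, pi p = y & close (gap y) p q].

Definition extended y q : int :=
  stalk y (xget (rep y) [set p | pi p = y /\ close (gap y) p q]).

Lemma extendedE y p q : pi p = y -> close (gap y) p q -> extended y q = stalk y p.
Proof.
move=> py pq; rewrite /extended; case: xgetP => [p' _ [py' pq']|/(_ p)]; last by case.
by rewrite (gap_sep py' py pq' pq).
Qed.

Lemma close_refl (d : R) p : 0 < d -> close d p p.
Proof. by move=> d0; split=> // c; rewrite subrr normr0. Qed.

Lemma extended_fibre y p : pi p = y -> extended y p = stalk y p.
Proof. by move=> py; apply: extendedE => //; exact: close_refl (gap_gt0 y). Qed.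

(** A face that contains [q] also contains the nearby point of the fibre, so both are glued together
    and have the same jump. The vertex is recognised by a coordinate above one half, a condition
    that makes sense off the level set. *)
Lemma extended_step y q q' f s : A y -> star y q ->
  glue T (tag q) f = Some (tag q', s) -> bary (tagged q) f = 0 ->
  (forall c, bary (tagged q') (s c) = bary (tagged q) c) ->
  star y q' /\ exists2 v, 2^-1 < bary (tagged q) v &
    extended y q' = extended y q + (a (tag q) f v - a (tag q') (s f) (s v)).
Proof.
move=> Ay [p py pq] gl qf sq.
have [v _ pv] := frontier_fibre Ay py.
have pf := gap_zero py pq qf.
have [pqt pqc] := pq.
pose p' : tetrahedra R n := existT _ (tag q') (perm_tetra s (tagged p)).
have gl' : glue T (tag p) f = Some (tag p', s) by rewrite -pqt.
have sp c : bary (tagged p') (s c) = bary (tagged p) c by exact: bary_perm.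
have py' : pi p' = y.
  rewrite -py; apply/esym/pt_eqP; apply: rst_step; exists f, s; split=> //.
have pq' : close (gap y) p' q'.
  by split=> // c; rewrite -(permKV s c) sq sp.
split; first by exists p'.
exists v.
  move: (pqc v) (gap_half y); rewrite pv ltr_norml; move: (gap y) (bary _ _).
  by move=> *; lra.
rewrite (extendedE py pq) (extendedE py' pq') pqt.
exact: (stalkP Ay py gl' pf sp pv).
Qed.

Lemma star_saturated y : A y -> saturated T (star y).
Proof. by move=> Ay q q' yq [f [s [gl qf sq]]]; have [] := extended_step Ay yq gl qf sq. Qed.

Lemma close_open d p q : close d p q -> exists2 r : R, 0 < r & forall q', close r q q' -> close d p q'.
Proof.
move=> [pq cq]; pose k c := Num.max 0 (d - `|bary (tagged q) c - bary (tagged p) c|).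
have [r r0 rk] := positive_gap k; exists r => // q' [qq' cq']; split; first by rewrite qq'.
move=> c; have kc : k c = d - `|bary (tagged q) c - bary (tagged p) c|.
  by rewrite /k max_r // subr_ge0 ltW.
have kp : 0 < k c by rewrite kc subr_gt0.
have := rk c; rewrite gt_eqF // => /(_ isT); rewrite gtr0_norm // kc => le.
rewrite (le_lt_trans (ler_distD (bary (tagged q) c) _ _)) // -ltrBrDr.
exact: lt_le_trans (cq' c) le.
Qed.

Lemma extended_near y q : star y q -> exists2 r : R, 0 < r & forall q', close r q q' ->
  star y q' /\ extended y q' = extended y q.
Proof.
move=> [p py pq]; have [r r0 rP] := close_open pq; exists r => // q' /rP pq'.
by split; [exists p|rewrite (extendedE py pq) (extendedE py pq')].
Qed.

Lemma star_open y : open (star y).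
Proof.
by apply: open_closeP => q /extended_near[r r0 rP]; exists r => // q' /rP[].
Qed.

Lemma star_self y : star y (rep y).
Proof. by exists (rep y); [exact: reprK|exact: close_refl (gap_gt0 y)]. Qed.

Lemma half_unique (u : tetra R) v v' : 2^-1 < bary u v -> 2^-1 < bary u v' -> v = v'.
Proof.
move=> uv uv'; apply: contrapT => /eqP vv'.
have : bary u v + bary u v' <= 1.
  rewrite -(sum_bary u) (bigD1 v) //= (bigD1 v') 1?eq_sym //= addrA lerDl.
  by apply: sumr_ge0 => c _; exact: bary_ge0.
by move: uv uv'; move: (bary _ _) (bary _ _) => *; lra.
Qed.

(** [extended y (rep z)] depends on the choice of representatives, but two such functions have the
    same jumps. Their difference is invariant under the gluing and locally constant, which is what a
    torsor requires. *)
Lemma link_section : exists f : realization R T -> int, forall y, A y ->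
  \forall z \near y, A z ->
    f z - extended y (rep z) = f y - extended y (rep y).
Proof.
apply: (torsorsA (W := fun y z => star y (rep z)) (F := fun y z => extended y (rep z))).
  move=> y Ay; have := saturated_near (star_saturated Ay) (@star_open y) (star_self y).
  by apply: filterS.
move=> y1 y2 z A1 A2 Az z1 z2.
pose c := extended y1 (rep z) - extended y2 (rep z).
pose O := [set q | [/\ star y1 q, star y2 q & extended y1 q - extended y2 q = c]].
have sO : saturated T O.
  move=> q q' [q1 q2 qc] [f [s [gl qf sq]]].
  have [q1' [v vq E1]] := extended_step A1 q1 gl qf sq.
  have [q2' [v' vq' E2]] := extended_step A2 q2 gl qf sq.
  split=> //; rewrite E1 E2 (half_unique vq vq') -qc.
  by move: (extended _ _) (extended _ _) (_ - a _ _ _); clear=> *; lia.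
have oO : open O.
  apply: open_closeP => q [q1 q2 qc].
  have [r1 r10 r1P] := extended_near q1; have [r2 r20 r2P] := extended_near q2.
  exists (Num.min r1 r2); first by rewrite lt_min r10.
  move=> q' [qq' cq'].
  have [|q1' E1] := r1P q'.
    by split=> // d; rewrite (lt_le_trans (cq' d)) // ge_min lexx.
  have [|q2' E2] := r2P q'.
    by split=> // d; rewrite (lt_le_trans (cq' d)) // ge_min lexx orbT.
  by split=> //; rewrite E1 E2.
have Oz : O (rep z) by [].
apply: filterS (saturated_near sO oO Oz) => u [_ _ ->] _.
by [].
Qed.

Section GlobalSection.
Variable f : realization R T -> int.
Hypothesis fP : forall y, A y -> \forall z \near y, A z ->
    f z - extended y (rep z) = f y - extended y (rep y).

(** The section [f] refers to the representative of a fibre; the potential on the fibre transfers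
    its value to the other points, with the prescribed jumps. *)
Definition global p : int := f (pi p) + (stalk (pi p) p - stalk (pi p) (rep (pi p))).

Lemma global_step p p' g s v : A (pi p) -> glue T (tag p) g = Some (tag p', s) ->
  bary (tagged p) g = 0 -> (forall c, bary (tagged p') (s c) = bary (tagged p) c) ->
  bary (tagged p) v = 1 - e ->
  global p' = global p + (a (tag p) g v - a (tag p') (s g) (s v)).
Proof.
move=> Ap gl pg sp pv.
have E : pi p' = pi p.
  by apply/esym/pt_eqP; apply: rst_step; exists g, s.
rewrite /global E (stalkP Ap (erefl _) gl pg sp pv).
by move: (f _) (stalk _ _) (stalk _ _) (_ - a _ _ _); clear=> *; lia.
Qed.

(** On a nearby fibre, its own potential and the extension of the one over [y] have the same jumps,
    so they differ by a constant. This removes the representatives from the property of [f]. *)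
Lemma global_near p : A (pi p) -> exists2 r : R, 0 < r & forall q, close r p q -> A (pi q) ->
  global q = global p.
Proof.
move=> Ap; set y := pi p.
have [p1 p2] : star y p /\ True.
  by split=> //; exists p => //; exact: close_refl (gap_gt0 y).
have /nbhs_closeP[r r0 rP] := nbhs_pi (fP Ap).
exists (Num.min r (gap y)); first by rewrite lt_min r0 gap_gt0.
move=> q [pq cq] Aq; set u := pi q.
have pqg : close (gap y) p q.
  by split=> // c; rewrite (lt_le_trans (cq c)) // ge_min lexx orbT.
have H : f u - extended y (rep u) = f y - extended y (rep y).
  apply: rP => //; split=> // c.
  by rewrite (lt_le_trans (cq c)) // ge_min lexx.
have sq : star y q by exists p.
have K q' : pi q' = u -> star y q' /\ stalk u q' - extended y q' = stalk u q - extended y q.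
  move=> q'u.
  pose V := [set q' | [/\ star y q', pi q' = u & stalk u q' - extended y q' = stalk u q - extended y q]].
  have sV : saturated T V.
    move=> q1 q2 [s1 e1 c1] [g [s [gl qg sq1]]].
    have [s2 [v vq E]] := extended_step Ap s1 gl qg sq1.
    have [v' _ qv'] := frontier_fibre Aq e1.
    have vv' : v = v' by apply: (near_vertex_unique e01 qv' vq).
    have e2 : pi q2 = u.
      by rewrite -e1; apply/esym/pt_eqP; apply: rst_step; exists g, s.
    split=> //; rewrite E -c1 (stalkP Aq e1 gl qg sq1 qv') vv'.
    by move: (extended _ _) (stalk _ _) (_ - a _ _ _); clear=> *; lia.
  by have [] : V q' by apply: (saturated_class sV (p := q)).
have [su Ku] := K (rep u) (reprK u).
rewrite /global -/u -/y.
move: H Ku; rewrite (extendedE (erefl : pi p = y) pqg) (extended_fibre (reprK y)).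
move: (f _) (f _) (extended _ _) (stalk _ _) (stalk _ _) (stalk _ _) (stalk _ _).
by clear=> *; lia.
Qed.

Lemma A_link i (u : tetra R) v : pt T i (vtx R v) = x -> bary u v = 1 - e -> A (pi (existT _ i u)).
Proof.
move=> vx uv; apply/(link_frontier e01)/(saturated_repr _ eqs_saturated).
by exists v.
Qed.

(** The slice of a corner at level [1 - e] is convex, so the locally constant [global] gives one
    integer to each corner. *)
Lemma global_triangle i v (u u' : tetra R) : pt T i (vtx R v) = x ->
  bary u v = 1 - e -> bary u' v = 1 - e ->
  global (existT _ i u) = global (existT _ i u').
Proof.
move=> vx uv u'v.
have bs (t : R) : 0 <= t <= 1 -> bary (segment u u' t) v = 1 - e.
  by move=> t01; rewrite bary_segment // uv u'v subrr mulr0 addr0.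
pose h (t : R) := global (existT _ i (segment u u' t)).
have loc (t : R) : `[0, 1]%classic t -> \forall t' \near t, `[0, 1]%classic t' -> h t' = h t.
  move=> t01; have t01' : 0 <= t <= 1 by move: t01; rewrite /= in_itv.
  have [r r0 rP] := global_near (A_link vx (bs t t01')).
  have H : \forall w \near segment u u' t, forall c, `|bary w c - bary (segment u u' t) c| < r.
    by apply/nbhs_tetraP; exists r.
  have := within_continuous_near (@segment_continuous R u u') t01 H.
  apply: filterS => t' {}H t'01; apply: rP.
    by split=> //; exact: H.
  by apply: (A_link vx); apply: bs; move: t'01; rewrite /= in_itv.
have := locally_constant_connected (@segment_connected R 0 1) loc (x := 0) (y := 1).
rewrite /h segment0 segment1; apply; by rewrite /= in_itv /= lexx ler01.
Qed.

End GlobalSection.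

Lemma vertex_potential : exists t : 'I_n -> 'I_4 -> int, forall i g j s v,
  pt T i (vtx R v) = x -> glue T i g = Some (j, s) -> g != v ->
  t j (s v) = t i v + (a i g v - a j (s g) (s v)).
Proof.
have [f fP] := link_section.
have e01' : 0 <= e <= 1 by move: e01; lra.
have ctr v : exists u : tetra R, bary u v = 1 - e.
  have [u uE] := @segmentP R (vtx R v) (vtx R (if v == U_ then L_ else U_)) e e01'.
  exists u; rewrite uE !bary_vtx eqxx.
  have -> : (v == if v == U_ then L_ else U_) = false.
    by case: (eqVneq v U_) => [->|/negPf].
  by rewrite sub0r mulrN1.
pose t i v := global f (existT _ i (sval (cid (ctr v)))).
exists t => i g j s v vx gl gv.
have tE i' v' (u : tetra R) : pt T i' (vtx R v') = x -> bary u v' = 1 - e ->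
    t i' v' = global f (existT _ i' u).
  move=> vx' uv; rewrite /t; case: cid => w wv /=.
  exact: (global_triangle fP vx' wv uv).
have [l [c glvc]] := uniq4_complete gv.
have vl : v != l by move: glvc; rewrite /= !inE !negb_or => /and3P[_ /andP[]].
have gl' : g != l by move: glvc; rewrite /= !inE !negb_or => /and3P[/and3P[]].
(* A point of the slice at [v] that lies in the face opposite to [g], where the jump can be read. *)
have [u uE] := @segmentP R (vtx R v) (vtx R l) e e01'.
have uv : bary u v = 1 - e.
  by rewrite uE !bary_vtx eqxx (negPf vl) sub0r mulrN1.
have ug : bary u g = 0.
  by rewrite uE !bary_vtx (negPf gv) (negPf gl') subrr mulr0 addr0.
rewrite (tE i v u) // (tE j (s v) (perm_tetra s u)); last by rewrite bary_perm.
  apply: (@global_step f (existT _ i u) (existT _ j (perm_tetra s u)) g s v) => //.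
    exact: A_link vx uv.
  by move=> k; rewrite bary_perm.
by rewrite -vx; apply/esym/(vtx_glue R gl gv).
Qed.

End LinkPotential.

(** A gluing relates only corners at the same vertex of the quotient, so the solutions on the
    different links are independent and combine. *)
Lemma triangle_potential (R : realType) n (T : triangulation n) (a : 'I_n -> 'I_4 -> 'I_4 -> int) :
  manifold_triangulation R T ->
  (forall p : position n, ~~ boundary_edge T p.1 (p.2 U_) (p.2 L_) ->
  \sum_(q <- orbit (turn T) p) (a q.1 (q.2 X_) (q.2 U_) - a q.1 (q.2 Y_) (q.2 U_)) = 0) ->
  exists t : 'I_n -> 'I_4 -> int, forall i g j s v, glue T i g = Some (j, s) -> g != v ->
  t j (s v) = t i v + (a i g v - a j (s g) (s v)).
Proof.
move=> [_ links] matching.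
have H (x : realization R T) : exists t : 'I_n -> 'I_4 -> int, forall i g j s v,
  pt T i (vtx R v) = x -> glue T i g = Some (j, s) -> g != v ->
  t j (s v) = t i v + (a i g v - a j (s g) (s v)).
  have [xv|nxv] := pselect (is_vertex x); last first.
    exists (fun _ _ => 0) => i g j s v vx; exfalso; apply: nxv.
    by exists i, v, (vtx R v); split=> //; exact/open_face_vtx.
  have [e [e01 homeo]] := links x xv.
  apply: (@vertex_potential R n T a e x e01 matching).
  case: homeo => /trivial_torsors_homeomorphic; apply.
    exact: unit_sphere_torsors.
  exact: unit_ball_torsors.
have [t tP] := choice H.
exists (fun i v => t (pt T i (vtx R v)) i v) => i g j s v gl gv.
by rewrite -(vtx_glue R gl gv) (tP _ _ _ _ _ _ erefl gl gv).
Qed.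

(** * Discs in a tetrahedron *)

Section StarDisc.
Variable R : realType.
Variables (x0 : 'I_4 -> R) (L : 'rV[R]_2 -> 'I_4 -> R).
Hypotheses (x0_gt0 : forall c, 0 < x0 c) (x0_sum : \sum_c x0 c = 1).
Hypothesis L_continuous : forall c, continuous (fun v => L v c).
Hypothesis L_homogeneous : forall (r : R) v c, 0 <= r -> L (r *: v) c = r * L v c.
Hypothesis L_sum : forall v, \sum_c L v c = 0.
Hypothesis L_inj : forall v w, L v =1 L w -> v = w.

(** The Minkowski gauge of the region that [L] maps into the tetrahedron around [x0]: the point
    [x0 + L v] is in the tetrahedron when [gauge v <= 1], and on its boundary when equality holds.
    Homogeneity for nonnegative factors suffices, so [L] may be piecewise linear. *)
Let gauge v := \big[Num.max/0]_c (- L v c / x0 c).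

Lemma continuous_max (X : topologicalType) (f g : X -> R) :
  continuous f -> continuous g -> continuous (fun u => Num.max (f u) (g u)).
Proof.
move=> fc gc; rewrite (_ : (fun _ => _) = fun u => (f u + g u + `|f u - g u|) / 2); last first.
  by apply/funext => u; rewrite maxr_absE.
move=> u; apply: cvgMl; apply: (@cvgD _ _ _ (nbhs u)).
  by apply: (@cvgD _ _ _ (nbhs u)); [exact: fc|exact: gc].
by apply: cvg_norm; apply: (@cvgB _ _ _ (nbhs u)); [exact: fc|exact: gc].
Qed.

Lemma continuous_bigmax (X : topologicalType) (I : Type) (r : seq I) (f : I -> X -> R) :
  (forall i, continuous (f i)) -> continuous (fun u => \big[Num.max/0]_(i <- r) f i u).
Proof.
move=> fc; elim: r => [|i r IH].
  rewrite (_ : (fun _ => _) = fun=> 0); first exact: cst_continuous.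
  by apply/funext => u; rewrite big_nil.
rewrite (_ : (fun _ => _) = fun u => Num.max (f i u) (\big[Num.max/0]_(i <- r) f i u)).
  exact: continuous_max.
by apply/funext => u; rewrite big_cons.
Qed.

Lemma gauge_continuous : continuous gauge.
Proof.
apply: continuous_bigmax => c.
rewrite (_ : (fun _ => _) = fun v => - (x0 c)^-1 * L v c); last first.
  by apply/funext => v; rewrite !mulNr mulrC.
by move=> u; apply: (@cvgM _ _ (nbhs u)); [exact: cvg_cst|exact: L_continuous].
Qed.

Lemma L0 c : L 0 c = 0.
Proof. by rewrite -(scale0r 0) L_homogeneous // mul0r. Qed.

Lemma gauge_ge v c : - (x0 c * gauge v) <= L v c.
Proof.
rewrite lerNl mulrC -ler_pdivrMr //.
exact: (le_bigmax _ (fun c => - L v c / x0 c)).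
Qed.

Lemma gauge_ge0 v : 0 <= gauge v.
Proof. exact: bigmax_ge_id. Qed.

Lemma gaugeZ (r : R) v : 0 <= r -> gauge (r *: v) = r * gauge v.
Proof.
move=> r0; rewrite /gauge.
elim/big_ind2: _ => [|x y x' y' -> ->|c _]; first by rewrite mulr0.
- by rewrite maxr_pMr.
- by rewrite L_homogeneous // -mulrN mulrA.
Qed.

Lemma gauge0 : gauge 0 = 0.
Proof. by rewrite -(scale0r 0) gaugeZ // mul0r. Qed.

(** The coordinates of [L v] add up to zero: if none is negative they all vanish, and [L] is
    injective. *)
Lemma gauge_gt0 v : v != 0 -> 0 < gauge v.
Proof.
move=> v0; rewrite lt_neqAle gauge_ge0 andbT eq_sym; apply: contra v0 => /eqP g0.
have Lge c : 0 <= L v c by have := gauge_ge v c; rewrite g0 mulr0 oppr0.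
apply/eqP/L_inj => c; rewrite L0.
have /eqP := L_sum v; rewrite psumr_eq0 // => /allP/(_ c).
by rewrite mem_index_enum => /(_ isT) /eqP.
Qed.

Lemma gauge_attained v : v != 0 -> exists c, L v c = - (x0 c * gauge v).
Proof.
move=> v0; apply: contrapT => N; suff : gauge v < gauge v by rewrite ltxx.
rewrite {1}/gauge; apply: bigmax_lt => [|c _]; first exact: gauge_gt0.
rewrite ltr_pdivrMr // mulrC lt_neqAle; apply/andP; split; last first.
  by rewrite lerNl; exact: gauge_ge.
by apply/eqP => E; apply: N; exists c; rewrite -E opprK.
Qed.

Let norm v := Num.sqrt (\sum_c (v : 'rV[R]_2) 0 c ^+ 2).

Lemma norm_ge0 v : 0 <= norm v.
Proof. exact: sqrtr_ge0. Qed.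

Lemma norm_continuous : continuous norm.
Proof.
move=> v; apply: (@continuous_comp _ _ _ (fun x : 'rV[R]_2 => \sum_c x 0 c ^+ 2) Num.sqrt).
  exact: continuous_sumsq.
exact: sqrt_continuous.
Qed.

Lemma sqr_norm v : norm v ^+ 2 = \sum_c v 0 c ^+ 2.
Proof. by rewrite sqr_sqrtr // sumr_ge0 // => c _; exact: sqr_ge0. Qed.

Lemma norm_gt0 v : v != 0 -> 0 < norm v.
Proof.
move=> v0; rewrite sqrtr_gt0 lt_neqAle sumr_ge0 ?andbT => [|c _]; last exact: sqr_ge0.
apply: contra v0; rewrite eq_sym psumr_eq0 => [/allP H|c _]; last exact: sqr_ge0.
apply/eqP/rowP => c; rewrite mxE; have := H c; rewrite mem_index_enum => /(_ isT).
by rewrite sqrf_eq0 => /eqP.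
Qed.

Lemma normZ (r : R) v : 0 <= r -> norm (r *: v) = r * norm v.
Proof.
move=> r0; rewrite /norm -{2}(ger0_norm r0) -sqrtr_sqr -sqrtrM ?sqr_ge0 //.
by congr Num.sqrt; rewrite mulr_sumr; apply: eq_bigr => c _; rewrite mxE exprMn.
Qed.

Lemma norm0 : norm 0 = 0.
Proof. by rewrite -(scale0r 0) normZ // mul0r. Qed.

Lemma ball_norm v : unit_ball v <-> norm v <= 1.
Proof.
rewrite /unit_ball /= -sqr_norm; split=> [|H]; last by rewrite exprn_ile1 ?norm_ge0.
by rewrite -[X in _ <= X](expr1n _ 2) ler_pXn2r ?nnegrE ?norm_ge0.
Qed.

Lemma sphere_norm v : unit_sphere v <-> norm v = 1.
Proof.
rewrite /unit_sphere /= -sqr_norm; split=> [|->]; last exact: expr1n.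
by move/eqP; rewrite sqrf_eq1 => /orP[/eqP //|/eqP E]; have := norm_ge0 v; rewrite E oppr_ge0 ler10.
Qed.

(** The radial rescaling that takes the round disc to the region [gauge v <= 1]; its value at the
    origin is the conventional 0 / 0 = 0. *)
Let scale v := norm v / gauge v.

Lemma scale_ge0 v : 0 <= scale v.
Proof. by rewrite divr_ge0 ?norm_ge0 ?gauge_ge0. Qed.

Let coord v c := x0 c + L (scale v *: v) c.

Lemma coordE v c : coord v c = x0 c + scale v * L v c.
Proof. by rewrite /coord L_homogeneous ?scale_ge0. Qed.

Lemma gauge_scale v : gauge (scale v *: v) = norm v.
Proof.
rewrite gaugeZ ?scale_ge0 // /scale; have [->|v0] := eqVneq v 0.
  by rewrite gauge0 norm0 mulr0.
by rewrite divfK // gt_eqF // gauge_gt0.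
Qed.

Lemma coord_continuous_disc c : continuous (fun v => coord v c).
Proof.
move=> v; rewrite (_ : (fun _ => _) = fun v => x0 c + scale v * L v c); last first.
  by apply/funext => w; exact: coordE.
have [->|v0] := eqVneq v 0; last first.
  apply: (@cvgD _ _ _ (nbhs v)); first exact: cvg_cst.
  apply: (@cvgM _ _ (nbhs v)); last exact: L_continuous.
  apply: (@cvgM _ _ (nbhs v)); first exact: norm_continuous.
  by apply: (@cvgV _ _ (nbhs v)); [rewrite gt_eqF // gauge_gt0|exact: gauge_continuous].
(* [scale] need not have a limit at the origin, but each coordinate of [L] is at most the gauge, so
   the product tends to zero. *)
have bound w : `|scale w * L w c| <= norm w.
  have [->|w0] := eqVneq w 0; first by rewrite L0 mulr0 normr0 norm_ge0.
  have g0 := gauge_gt0 w0.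
  have Lw : `|L w c| <= gauge w.
    have x1 d : x0 d <= 1.
      by rewrite -x0_sum (bigD1 d) //= lerDl sumr_ge0 // => d' _; exact: ltW.
    have Ld d : - (x0 d * gauge w) <= L w d by exact: gauge_ge.
    rewrite ler_norml; apply/andP; split.
      by rewrite (le_trans _ (Ld c)) // lerN2 ler_piMl // ltW.
    have := L_sum w; rewrite (bigD1 c) //= => /eqP; rewrite addr_eq0 => /eqP ->.
    rewrite lerNl (@le_trans _ _ (\sum_(d | d != c) - (x0 d * gauge w))) //; last first.
      by apply: ler_sum => d _; exact: Ld.
    rewrite sumrN lerN2 -mulr_suml ler_piMl ?(ltW g0) //.
    by rewrite -x0_sum [leRHS](bigD1 c) //= lerDr ltW.
  rewrite normrM ger0_norm ?scale_ge0 // /scale.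
  by rewrite -mulrA ler_piMr ?norm_ge0 // mulrC ler_pdivrMr // mul1r.
move=> P /nbhs_ballP[d d0 dP].
have /cvgrPdist_lt/(_ d d0) := @norm_continuous 0.
rewrite norm0.
apply: filterS => w; rewrite sub0r normrN ger0_norm ?norm_ge0 // => wd.
apply: dP; rewrite -ball_normE /= L0 mulr0 addr0.
by rewrite opprD addrA subrr sub0r normrN (le_lt_trans (bound w)).
Qed.

Lemma disc_pointP v : exists x : tetra R, norm v <= 1 -> forall c, bary x c = coord v c.
Proof.
have [v1|_] := leP (norm v) 1; last by exists (vtx R ord0).
have c0 c : 0 <= coord v c.
  rewrite /coord -lerBlDl sub0r; apply: le_trans (gauge_ge _ _).
  by rewrite gauge_scale lerN2 ler_piMr // ltW.
have c1 : \sum_c coord v c = 1 by rewrite big_split /= x0_sum L_sum addr0.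
by have [x xE] := tetraP c0 c1; exists x.
Qed.

Let disc_point v := sval (cid (disc_pointP v)).

Lemma bary_disc_point v c : unit_ball v -> bary (disc_point v) c = coord v c.
Proof. by move=> /ball_norm v1; rewrite /disc_point; case: cid => x /= /(_ v1). Qed.

Variable D : set (tetra R).
Hypothesis DP : forall x, D x <-> exists v, forall c, bary x c = x0 c + L v c.

Lemma disc_point_surj v : gauge v <= 1 -> exists w, norm w = gauge v /\ scale w *: w = v.
Proof.
have [->|v0] := eqVneq v 0.
  move=> _; by exists 0; rewrite scaler0 norm0 gauge0.
have g0 := gauge_gt0 v0; have n0 := norm_gt0 v0.
move=> _; have r0 : 0 <= gauge v / norm v by rewrite divr_ge0 ?ltW.
exists ((gauge v / norm v) *: v); split; first by rewrite normZ // divfK ?gt_eqF.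
rewrite /scale normZ // gaugeZ // scalerA divfK ?gt_eqF //.
rewrite -[RHS]scale1r; congr (_ *: _).
by field; rewrite !gt_eqF.
Qed.

Lemma star_disc : proper_disc D (D `&` @tetra_boundary R).
Proof.
have ballD v : unit_ball v -> D (disc_point v).
  by move=> vb; apply/DP; exists (scale v *: v) => c; rewrite bary_disc_point.
have inner v : unit_ball v -> tetra_boundary (disc_point v) <-> unit_sphere v.
  move=> vb; split=> [[c]|/sphere_norm v1].
    rewrite bary_disc_point // /coord => /eqP; rewrite addr_eq0 => /eqP xL.
    apply/sphere_norm/eqP; rewrite eq_le (ball_norm v).1 //=.
    have := gauge_ge (scale v *: v) c; rewrite gauge_scale -(opprK (L _ _)) -xL lerN2.
    by rewrite ler_pMr.
  have v0 : scale v *: v != 0.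
    by apply/eqP => E; have := gauge_scale v; rewrite E gauge0 v1 => /eqP; rewrite eq_sym oner_eq0.
  have [c Lc] := gauge_attained v0; exists c.
  by rewrite bary_disc_point // /coord Lc gauge_scale v1 mulr1 subrr.
have onto x : D x -> exists2 v, unit_ball v & disc_point v = x.
  move=> /DP[v xv]; have gv : gauge v <= 1.
    apply: bigmax_le => // c _; rewrite ler_pdivrMr // mul1r lerNl -subr_ge0 opprK addrC.
    by rewrite -xv bary_ge0.
  have [w [nw wv]] := disc_point_surj gv.
  have wb : unit_ball w by apply/ball_norm; rewrite nw.
  exists w => //; apply: bary_inj => c.
  by rewrite bary_disc_point // /coord wv xv.
exists disc_point; split.
- have gc c : continuous (fun v => coord v c) by exact: coord_continuous_disc.
  have hg v c : unit_ball v -> bary (disc_point v) c = coord v c by exact: bary_disc_point.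
  exact: within_continuous_tetra gc hg.
- move=> v w; rewrite !inE => vb wb E.
  have Evw : scale v *: v = scale w *: w.
    apply: L_inj => c; apply: (addrI (x0 c)).
    by rewrite -[LHS]/(coord v c) -[RHS]/(coord w c) -!bary_disc_point // E.
  have nvw : norm v = norm w by rewrite -!gauge_scale Evw.
  have [v0|v0] := eqVneq v 0.
    rewrite v0; apply/esym/eqP; apply: contraT => /norm_gt0.
    by rewrite -nvw v0 norm0 ltxx.
  have w0 : w != 0.
    apply/eqP => w0; have := norm_gt0 v0; rewrite nvw w0 norm0.
    by rewrite ltxx.
  have sv : 0 < scale v by rewrite divr_gt0 ?norm_gt0 ?gauge_gt0.
  have sw : 0 < scale w by rewrite divr_gt0 ?norm_gt0 ?gauge_gt0.
  have Ew : w = (scale v / scale w) *: v.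
    by rewrite mulrC -scalerA Evw scalerA mulVf ?gt_eqF // scale1r.
  have k0 : 0 <= scale v / scale w by rewrite divr_ge0 ?ltW.
  have : (scale v / scale w) * norm v = norm v by rewrite -normZ // -Ew nvw.
  move=> /(canRL (mulfK (lt0r_neq0 (norm_gt0 v0)))); rewrite divff ?gt_eqF ?norm_gt0 //.
  by move=> k1; rewrite Ew k1 scale1r.
- apply/seteqP; split=> [x /onto[v vb <-]|x [v vb <-]]; first by exists v.
  exact: ballD.
- apply/seteqP; split=> [x [/onto[v vb <-] /(inner v vb) vs]|x [v vs <-]]; first by exists v.
  have vb : unit_ball v by apply/ball_norm; rewrite (sphere_norm v).1.
  by split; [exact: ballD|exact/inner].
- by [].
Qed.

End StarDisc.

Lemma card_set2 (A : Type) (x y : A) : x <> y -> ([set x; y] #= `I_2)%card.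
Proof.
move=> xy; pose f (k : nat) := if k == 0%N then x else y.
have -> : [set x; y] = f @` `I_2.
  apply/seteqP; split=> [z [->|->]|z [[|[|//]] _ <-]]; [by exists 0%N|by exists 1%N|by left|by right].
apply: inj_card_eq => k l; rewrite !inE /f.
by case: k => [|[|//]]; case: l => [|[|//]] //= _ _ E; exfalso; apply: xy.
Qed.

Section NormalDiscs.
Variable R : realType.

(* The arc is { x_f = 0, wa x_a + wb x_b = l }, the two remaining coordinates
   being those of a and b.                                                   *)
Lemma straight_arc (f v a b : 'I_4) (wa wb l : R) : uniq [:: f; v; a; b] ->
  0 < l -> l < wa -> l < wb ->
  normal_arc f [set x : tetra R | bary x f = 0 /\ wa * bary x a + wb * bary x b = l].
Proof.
move=> fvab l0 la lb.
have wa0 : 0 < wa by exact: lt_trans la.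
have wb0 : 0 < wb by exact: lt_trans lb.
move: (fvab); rewrite /= !inE !negb_or !andbT => /and3P[/and3P[fv fa fb] /andP[va vb] ab].
have l01 (w : R) : l < w -> 0 <= l / w <= 1.
  move=> lw; have w0 := lt_trans l0 lw.
  by rewrite (divr_ge0 (ltW l0) (ltW w0)) /= ler_pdivrMr // mul1r ltW.
have [p pE] := segmentP (vtx R v) (vtx R a) (l01 _ la).
have [q qE] := segmentP (vtx R v) (vtx R b) (l01 _ lb).
have vtxE (c d : 'I_4) : c != d -> bary (vtx R d) c = 0 by rewrite bary_vtx => /negPf ->.
have vtx1 c : bary (vtx R c) c = 1 by rewrite bary_vtx eqxx.
have [av bv ba] : [/\ a != v, b != v & b != a] by rewrite !(eq_sym _ v) (eq_sym b).
have pa : bary p a = l / wa by rewrite pE vtx1 vtxE // subr0 mulr1 add0r.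
have pb : bary p b = 0 by rewrite pE !vtxE // subrr mulr0 addr0.
have pf : bary p f = 0 by rewrite pE !vtxE // subrr mulr0 addr0.
have pv : bary p v = 1 - l / wa by rewrite pE vtx1 vtxE // sub0r mulrN1.
have qa : bary q a = 0 by rewrite qE !vtxE // subrr mulr0 addr0.
have qb : bary q b = l / wb by rewrite qE vtx1 vtxE // subr0 mulr1 add0r.
have qf : bary q f = 0 by rewrite qE !vtxE // subrr mulr0 addr0.
have qv : bary q v = 1 - l / wb by rewrite qE vtx1 vtxE // sub0r mulrN1.
have la0 : 0 < l / wa by rewrite divr_gt0.
have lb0 : 0 < l / wb by rewrite divr_gt0.
have la1 : 0 < 1 - l / wa by rewrite subr_gt0 ltr_pdivrMr // mul1r.
have lb1 : 0 < 1 - l / wb by rewrite subr_gt0 ltr_pdivrMr // mul1r.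
have u1 : uniq [:: v; a; b; f] by reorder.
have u2 : uniq [:: v; b; a; f] by reorder.
have sa (t : R) : 0 <= t <= 1 -> bary (segment p q t) a = (1 - t) * (l / wa).
  by move=> t01; rewrite bary_segment // pa qa; ring.
have sb (t : R) : 0 <= t <= 1 -> bary (segment p q t) b = t * (l / wb).
  by move=> t01; rewrite bary_segment // pb qb; ring.
have sf (t : R) : 0 <= t <= 1 -> bary (segment p q t) f = 0.
  by move=> t01; rewrite bary_segment // pf qf; ring.
have sv (t : R) : 0 <= t <= 1 ->
    bary (segment p q t) v = (1 - t) * (1 - l / wa) + t * (1 - l / wb).
  by move=> t01; rewrite bary_segment // pv qv; ring.
exists [set v; a]%SET, [set v; b]%SET, (segment p q); split.
- split; rewrite ?cards2 ?va ?vb ?inE ?negb_or ?fv ?fa ?fb //.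
  apply/eqP => /setP/(_ a); rewrite !inE eqxx orbT => /esym.
  by rewrite (negPf av) (negPf ab).
- exact: segment_continuous.
- move=> s t; rewrite !inE /= !in_itv /= => s01 t01 st.
  have := congr1 (fun x => bary x b) st; rewrite /= !sb // => /mulIf; apply.
  by rewrite gt_eqF.
- apply/seteqP; split=> [x [xf xab]|x [t]]; last first.
    rewrite /= in_itv /= => t01 <-; split; first exact: sf.
    by rewrite sa // sb //; field; rewrite !gt_eqF.
  have xE := sum_bary4 x fvab; rewrite xf add0r in xE.
  have xa0 := bary_ge0 x a; have xb0 := bary_ge0 x b.
  have t01 : 0 <= bary x b * wb / l <= 1.
    rewrite divr_ge0 ?mulr_ge0 ?(ltW wb0) ?(ltW l0) //= ler_pdivrMr // mul1r -xab.
    by rewrite mulrC lerDr mulr_ge0 // ltW.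
  exists (bary x b * wb / l); first by rewrite /= in_itv.
  have Ea : bary x a = (1 - bary x b * wb / l) * (l / wa).
    have -> : bary x a = (l - wb * bary x b) / wa.
      by rewrite -xab addrK mulrC mulKf // gt_eqF.
    by field; rewrite !gt_eqF.
  have Eb : bary x b = bary x b * wb / l * (l / wb) by field; rewrite !gt_eqF.
  apply: bary_inj => c; have := mem_uniq4 fvab erefl c.
  rewrite !inE => /or4P[]/eqP ->; [by rewrite sf| |by rewrite sa|by rewrite sb].
  rewrite sv //.
  have -> : bary x v = 1 - bary x a - bary x b by rewrite -xE; ring.
  have key (z A B : R) : (1 - z) * (1 - A) + z * (1 - B) = 1 - (1 - z) * A - z * B.
    ring.
  rewrite key -Ea -Eb.
  by [].
- split.
  + rewrite segment0; apply/(open_faceP _ u1).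
    by rewrite pv pa pb pf.
  + rewrite segment1; apply/(open_faceP _ u2).
    by rewrite qv qa qb qf.
  + move=> t /andP[t0 t1] c.
    have t01 : 0 <= t <= 1 by rewrite !ltW.
    have t1' : 0 < 1 - t by rewrite subr_gt0.
    have := mem_uniq4 fvab erefl c; rewrite !inE => /or4P[]/eqP ->.
    * by rewrite sf // ltxx eqxx.
    * by rewrite sv // (eq_sym v) fv addr_gt0 // mulr_gt0.
    * by rewrite sa // (eq_sym a) fa mulr_gt0.
    * by rewrite sb // (eq_sym b) fb mulr_gt0.
Qed.

(** In a face at [v], a small positive level of this form is a segment across the corner; it meets
    the edge [vc] where the coordinate of [c] is the level divided by [M v c]. *)
Definition weighted (M : 'I_4 -> 'I_4 -> R) v (x : tetra R) : R :=
  \sum_(c | c != v) M v c * bary x c.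

Lemma weighted4 M (x : tetra R) f v a b : uniq [:: f; v; a; b] -> bary x f = 0 ->
  weighted M v x = M v a * bary x a + M v b * bary x b.
Proof.
move=> fvab xf; rewrite /weighted big_mkcond (sum_uniq4 _ fvab) eqxx xf.
move: (fvab); rewrite /= !inE !negb_or !andbT => /and3P[/and3P[-> _ _] /andP[va vb] _].
by rewrite !(eq_sym _ v) va vb mulr0 addr0 add0r.
Qed.

Variables (t : disc_type) (D : set (tetra R)) (M : 'I_4 -> 'I_4 -> R) (lev : 'I_4 -> R).
Hypothesis M_sym : forall a b, M a b = M b a.
Hypothesis D_proper : proper_disc D (D `&` @tetra_boundary R).
Hypothesis D_face : forall f x, bary x f = 0 ->
  (D x <-> exists v, cuts t f v /\ weighted M v x = lev v).
Hypothesis lev_pos : forall f v, cuts t f v -> 0 < lev v.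
Hypothesis lev_lt : forall f v c, cuts t f v -> c != f -> c != v -> lev v < M v c.
Hypothesis lev_add : forall f v v', cuts t f v -> cuts t f v' -> v != v' ->
  lev v + lev v' < M v v'.

Let arc f v : set (tetra R) := [set x | bary x f = 0 /\ weighted M v x = lev v].

Lemma arc_normal f v : cuts t f v -> normal_arc f (arc f v).
Proof.
move=> c; have fv : f != v by case/andP: c.
have [a [b fvab]] := uniq4_complete fv.
move: (fvab); rewrite /= !inE !negb_or !andbT => /and3P[/and3P[_ fa fb] /andP[va vb] ab].
rewrite (_ : arc f v = [set x : tetra R | bary x f = 0 /\
   M v a * bary x a + M v b * bary x b = lev v]); last first.
  by apply/seteqP; split=> x [xf]; rewrite /= ?(weighted4 M fvab xf) // => E; split=> //;
    rewrite (weighted4 M fvab xf).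
by apply: (straight_arc fvab (lev_pos c)); apply: (lev_lt c); rewrite eq_sym.
Qed.

(** At a common point the sum of the two levels would be a convex combination of [M v v'] and
    [M v d + M v' d], where [d] is the third vertex of the face; both exceed it. *)
Lemma arc_disjoint f v v' : cuts t f v -> cuts t f v' -> v != v' ->
  arc f v `&` arc f v' = set0.
Proof.
move=> c c' vv'; apply/seteqP; split=> // x [[xf xv] [_ xv']].
have fv : f != v by case/andP: c.
have fv' : f != v' by case/andP: c'.
have [a [b fvab]] := uniq4_complete fv.
have [d u] : exists d, uniq [:: f; v; v'; d].
  have [E|E] : a = v' \/ b = v'.
    have := mem_uniq4 fvab erefl v'; rewrite !inE !(eq_sym v') (negPf fv') (negPf vv') /=.
    by case/orP => /eqP; auto.
    by exists b; rewrite -E.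
  by exists a; rewrite -E; reorder.
have u' : uniq [:: f; v'; v; d] by reorder.
have [fd vd vd'] : [/\ d != f, d != v & d != v'].
  by move: u; rewrite /= !inE !negb_or !(eq_sym _ d) => /and4P[/and3P[_ _ ->] /andP[_ ->] ->].
move: xv xv'; rewrite /= (weighted4 M u xf) (weighted4 M u' xf).
have := sum_bary4 x u; rewrite xf (M_sym v' v).
have := lev_add c c' vv'; have := lev_lt c fd vd; have := lev_lt c' fd vd'.
have := bary_ge0 x v; have := bary_ge0 x v'; have := bary_ge0 x d.
have := lev_pos c; have := lev_pos c'.
move: (bary x v) (bary x v') (bary x d) (lev v) (lev v') (M v v') (M v d) (M v' d).
move=> xv xv' xd l l' m md md' l'0 l0 xd0 xv'0 xv0 ld' ld lm s E E'.
have : l + l' = m * (xv + xv') + (md + md') * xd by rewrite -E -E'; ring.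
have -> : xv + xv' = 1 - xd by rewrite -s; ring.
have [->|xdn] := eqVneq xd 0; first by lra.
have xd0' : 0 < xd by rewrite lt_neqAle eq_sym xdn.
have xd1 : xd <= 1 by lra.
have h1 : (l + l') * xd < (md + md') * xd by rewrite ltr_pM2r //; lra.
have h2 : (l + l') * (1 - xd) <= m * (1 - xd) by rewrite ler_wpM2r //; lra.
lra.
Qed.

Let S := [set fv : 'I_4 * 'I_4 | cuts t fv.1 fv.2]%SET.

Lemma card_cuts : #|S| = sides t.
Proof.
rewrite -sum_cuts pair_big /= -sum1_card big_mkcond /=.
by apply: eq_bigr => fv _; rewrite inE; case: (cuts _ _ _).
Qed.

(** The arc at the third vertex [g] of the face does not reach the edge [ab], on which its form
    exceeds its level. *)
Lemma arc_edge f g a b x : uniq [:: f; g; a; b] -> bary x f = 0 -> bary x g = 0 ->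
  D x <-> (cuts t f a /\ M a b * bary x b = lev a) \/
          (cuts t f b /\ M a b * bary x a = lev b).
Proof.
move=> u xf xg.
have ua : uniq [:: f; a; g; b] by reorder.
have ub : uniq [:: f; b; g; a] by reorder.
have wa : weighted M a x = M a b * bary x b by rewrite (weighted4 M ua xf) xg mulr0 add0r.
have wb : weighted M b x = M a b * bary x a by rewrite (weighted4 M ub xf) xg mulr0 add0r M_sym.
rewrite (D_face xf); split=> [[v [c]]|]; last first.
  by case=> -[c E]; [exists a; rewrite wa|exists b; rewrite wb].
have fv : f != v by case/andP: c.
have := mem_uniq4 u erefl v; rewrite !inE eq_sym (negPf fv) /= => /or3P[]/eqP vE; subst v.
- rewrite (weighted4 M u xf) => E; exfalso.
  have [af ag bf bg] : [/\ a != f, a != g, b != f & b != g].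
    by move: u; rewrite /= !inE !negb_or !(eq_sym _ f) !(eq_sym _ g) => /and4P[/and3P[_ -> ->] /andP[-> ->]].
  have := lev_lt c af ag; have := lev_lt c bf bg; have := lev_pos c.
  have := sum_bary4 x u; rewrite xf xg; move: E (bary_ge0 x a) (bary_ge0 x b).
  move: (bary x a) (bary x b) (M g a) (M g b) (lev g) => xa xb ma mb l E xa0 xb0 s l0 lb la.
  have xbE : xb = 1 - xa by lra.
  rewrite xbE in E xb0.
  have h1 : l * xa <= ma * xa by rewrite ler_wpM2r // ltW.
  have h2 : l * (1 - xa) <= mb * (1 - xa) by rewrite ler_wpM2r // ltW.
  have [xa00|xan] := eqVneq xa 0; first by rewrite xa00 in E; lra.
  have xa0' : 0 < xa by rewrite lt_neqAle eq_sym xan.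
  have h3 : l * xa < ma * xa by rewrite ltr_pM2r.
  lra.
- by rewrite wa; left.
- by rewrite wb; right.
Qed.

Lemma edge_pointP (a b : 'I_4) (r : R) : a != b -> 0 < r < 1 ->
  exists x : tetra R, [/\ bary x b = r, bary x a = 1 - r & closed_face [set a; b]%SET x].
Proof.
move=> ab r01; have r01' : 0 <= r <= 1 by move: r01; lra.
have [x xE] := segmentP (vtx R a) (vtx R b) r01'.
exists x; split; rewrite ?xE ?bary_vtx ?eqxx ?(negPf ab).
- by rewrite eq_sym (negPf ab) subr0 mulr1 add0r.
- by rewrite sub0r mulrN1.
- move=> c; rewrite xE !bary_vtx !inE negb_or => /andP[/negPf -> /negPf ->].
  by rewrite subrr mulr0 addr0.
Qed.

Lemma edge_point_inj (a b : 'I_4) (x y : tetra R) : a != b ->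
  closed_face [set a; b]%SET x -> closed_face [set a; b]%SET y ->
  bary x b = bary y b -> x = y.
Proof.
move=> ab xc yc xy; have [c [d u]] := uniq4_complete ab.
have [ca da] : c \notin [set a; b]%SET /\ d \notin [set a; b]%SET.
  move: u; rewrite /= !inE !negb_or !(eq_sym c) !(eq_sym d).
  by move=> /and4P[/and3P[_ -> ->] /andP[-> ->]].
have xs := sum_bary4 x u; have ys := sum_bary4 y u.
rewrite (xc c) // (xc d) // in xs; rewrite (yc c) // (yc d) // in ys.
apply: bary_inj => i; have := mem_uniq4 u erefl i; rewrite !inE => /or4P[]/eqP ->.
- by move: xs ys; rewrite xy; move: (bary _ _) (bary _ _) (bary _ _) => *; lra.
- by [].
- by rewrite (xc c) // (yc c).
- by rewrite (xc d) // (yc d).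
Qed.

Lemma card_edge a b : a != b ->
  (D `&` @closed_face R [set a; b]%SET #= `I_(crossings t a b))%card.
Proof.
move=> ab; have [f [g u']] := uniq4_complete ab.
have u : uniq [:: f; g; a; b] by reorder.
move: (u); rewrite /= !inE !negb_or !andbT => /and3P[/and3P[fg fa fb] /andP[ga gb] _].
rewrite (crossingsE t ab fa fb).
have zero (x : tetra R) : closed_face [set a; b]%SET x -> bary x f = 0 /\ bary x g = 0.
  by move=> xc; split; apply: xc; rewrite !inE negb_or ?fa ?fb ?ga ?gb.
have DE (x : tetra R) : closed_face [set a; b]%SET x -> D x <->
    (cuts t f a /\ M a b * bary x b = lev a) \/ (cuts t f b /\ M a b * bary x a = lev b).
  by move=> /zero[xf xg]; exact: arc_edge u xf xg.
have ratio v w : cuts t f v -> w != f -> w != v -> 0 < lev v / M v w < 1 /\ M v w != 0.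
  move=> c wf wv; have l0 := lev_pos c; have lw := lev_lt c wf wv.
  have m0 := lt_trans l0 lw; rewrite divr_gt0 //= ltr_pdivrMr // mul1r.
  by split; rewrite ?gt_eqF.
have [af bf ba] : [/\ a != f, b != f & b != a] by rewrite !(eq_sym _ f) (eq_sym b).
have one (x : tetra R) : (forall y, closed_face [set a; b]%SET y -> D y <-> bary y b = bary x b) ->
    closed_face [set a; b]%SET x -> (D `&` @closed_face R [set a; b]%SET #= `I_1)%card.
  move=> H xc; rewrite (_ : D `&` _ = [set x]); first exact: card_set1.
  apply/seteqP; split=> [y [Dy yc]|y ->] /=; last by split=> //; exact/(H _ xc).
  by apply: (edge_point_inj ab yc xc); apply/(H _ yc).
have bE (x : tetra R) : closed_face [set a; b]%SET x -> bary x a = 1 - bary x b.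
  move=> xc; have [xf xg] := zero _ xc; have := sum_bary4 x u; rewrite xf xg.
  by move: (bary _ _) (bary _ _) => *; lra.
have [ca|nca] := boolP (cuts t f a); have [cb|ncb] := boolP (cuts t f b).
- have [r1 m1] := ratio a b ca bf ba; have [r2 m2] := ratio b a cb af ab.
  have [x [xb xa xc]] := edge_pointP ab r1.
  have [y [ya yb yc]] := edge_pointP ba r2; rewrite finset.setUC in yc.
  rewrite (M_sym b a) in ya yb m2 r2.
  have xy : x <> y.
    move=> E; rewrite E yb in xb.
    have := lev_add ca cb ab; move: xb => /(congr1 (fun z => z * M a b)).
    by rewrite mulrBl mul1r !divfK // => E2 lt; lra.
  have Dx : D x by apply/(DE _ xc); left; rewrite xb mulrC divfK.
  have Dy : D y by apply/(DE _ yc); right; rewrite ya mulrC divfK.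
  have -> : D `&` closed_face [set a; b]%SET = [set x; y].
    apply/seteqP; split=> [z [Dz zc]|z [->|->]] //.
    case/(DE _ zc): Dz => -[_ zE]; [left|right].
      by apply: (edge_point_inj ab zc xc); rewrite xb -zE mulrC mulKf.
    apply: (edge_point_inj ab zc yc); rewrite yb.
    have := bE _ zc; rewrite -zE mulrC mulKf // => ->; ring.
  exact: card_set2.
- have [r1 m1] := ratio a b ca bf ba.
  have [x [xb xa xc]] := edge_pointP ab r1.
  apply: (one x) => // y yc; rewrite (DE _ yc) xb; split.
    by case=> -[c E]; [rewrite -E mulrC mulKf|rewrite c in ncb].
  by move=> yE; left; rewrite yE mulrC divfK.
- have [r2 m2] := ratio b a cb af ab.
  have [x [xa xb xc]] := edge_pointP ba r2; rewrite finset.setUC in xc.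
  rewrite (M_sym b a) in xa xb m2 r2.
  apply: (one x) => // y yc; rewrite (DE _ yc) xb; split.
    case=> -[c E]; first by rewrite c in nca.
    by rewrite -E mulrC mulKf // (bE _ yc) opprB addrC subrK.
  by move=> yE; right; rewrite (bE _ yc) yE opprB addrC subrK mulrC divfK.
- rewrite (_ : D `&` _ = set0); first by rewrite II0.
  apply/seteqP; split=> // x [Dx xc]; by case: ((DE _ xc).1 Dx) => -[c _]; rewrite c in nca ncb.
Qed.

(** A properly embedded disc is recognised as normal from its traces on the faces. The condition
    [lev_lt] makes the arcs end inside the edges, and [lev_add] keeps two arcs of an octagon apart
    on a common edge. *)
Lemma normal_disc_intro : normal_disc t D.
Proof.
pose idx k : 'I_4 * 'I_4 := enum_val (cast_ord (esym card_cuts) k).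
have idxS k : cuts t (idx k).1 (idx k).2 by have := enum_valP (cast_ord (esym card_cuts) k); rewrite inE.
have idx_inj : injective idx by move=> k l /enum_val_inj/cast_ord_inj.
have idx_surj f v : cuts t f v -> exists k, idx k = (f, v).
  move=> c; have cS : (f, v) \in S by rewrite inE.
  exists (cast_ord card_cuts (enum_rank_in cS (f, v))).
  by rewrite /idx cast_ordK enum_rankK_in.
exists (fun k => arc (idx k).1 (idx k).2), (fun k => (idx k).1); split.
- rewrite (_ : \bigcup_k _ = D `&` @tetra_boundary R) //.
  apply/seteqP; split=> [x [k _ [xf xv]]|x [Dx [f xf]]].
    split; last by exists (idx k).1.
    by apply/(D_face xf); exists (idx k).2; split=> //; exact: idxS.
  have [v [c xv]] := (D_face xf).1 Dx; have [k kE] := idx_surj f v c.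
  by exists k => //; rewrite kE.
- by move=> k; exact: arc_normal.
- move=> k l kl fE; rewrite fE; apply: arc_disjoint; rewrite -?fE //.
    by rewrite fE.
  apply: contra kl => /eqP vE; apply/eqP/idx_inj.
  by rewrite (surjective_pairing (idx k)) (surjective_pairing (idx l)) fE vE.
- move=> noct k l fE; apply: idx_inj.
  rewrite (surjective_pairing (idx k)) (surjective_pairing (idx l)) fE; congr pair.
  have := idxS l; have := idxS k; rewrite fE; move: (idx l).1 (idx k).2 (idx l).2.
  case: t noct => [u|j|j] // _ f v v'; rewrite /cuts.
    by move=> /andP[_ /eqP ->] /andP[_ /eqP ->].
  rewrite !pairedE; case: j => [[|[|[|//]]] ?]; case: f => [[|[|[|[|//]]]] ?];
  case: v => [[|[|[|[|//]]]] ?] // ; case: v' => [[|[|[|[|//]]]] ?] // _ _; exact/val_inj.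
- exact: card_edge.
Qed.

End NormalDiscs.

Section Discs.
Variable R : realType.

Lemma sum4_if (V : nmodType) (a b c d : 'I_4) (A B C E : V) : uniq [:: a; b; c; d] ->
  \sum_i (if i == a then A else if i == b then B else if i == c then C else E) = A + B + C + E.
Proof.
move=> u; rewrite (sum_uniq4 _ u) !eqxx.
move: u; rewrite /= !inE !negb_or !andbT => /and3P[/and3P[ab ac ad] /andP[bc bd] cd].
by rewrite !(eq_sym b) !(eq_sym c) !(eq_sym d) (negPf ab) (negPf ac) (negPf ad)
  (negPf bc) (negPf bd) (negPf cd).
Qed.

Lemma forall4 (a b c d : 'I_4) (P : 'I_4 -> Prop) : uniq [:: a; b; c; d] ->
  P a -> P b -> P c -> P d -> forall i, P i.
Proof.
by move=> u Pa Pb Pc Pd i; have := mem_uniq4 u erefl i; rewrite !inE => /or4P[]/eqP ->.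
Qed.

Definition split4 (V : Type) (a b c : 'I_4) (A B C E : V) (i : 'I_4) : V :=
  if i == a then A else if i == b then B else if i == c then C else E.

Lemma split4E V (a b c d : 'I_4) (A B C E : V) : uniq [:: a; b; c; d] ->
  [/\ split4 a b c A B C E a = A, split4 a b c A B C E b = B,
     split4 a b c A B C E c = C & split4 a b c A B C E d = E].
Proof.
rewrite /split4 !eqxx /= !inE !negb_or !andbT => /and3P[/and3P[ab ac ad] /andP[bc bd] cd].
by rewrite !(eq_sym b) !(eq_sym c) !(eq_sym d) (negPf ab) (negPf ac) (negPf ad)
  (negPf bc) (negPf bd) (negPf cd).
Qed.

Lemma continuous_v0 : continuous (fun v : 'rV[R]_2 => v 0 0).
Proof. exact: coord_continuous. Qed.
Lemma continuous_v1 : continuous (fun v : 'rV[R]_2 => v 0 1).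
Proof. exact: coord_continuous. Qed.

Lemma continuous_add (X : topologicalType) (f g : X -> R) :
  continuous f -> continuous g -> continuous (fun x => f x + g x).
Proof. by move=> fc gc x; apply: (@cvgD _ _ _ (nbhs x)); [exact: fc|exact: gc]. Qed.
Lemma continuous_scale (X : topologicalType) (k : R) (f : X -> R) :
  continuous f -> continuous (fun x => k * f x).
Proof. by move=> fc x; apply: (@cvgM _ _ (nbhs x)); [exact: cvg_cst|exact: fc]. Qed.

(** The weight of [i] is the inverse of [|g i|], divided by the number of indices of the same sign:
    the two signs then contribute -1 and 1. The weights are finally normalised. *)
Lemma balanced_point (g : 'I_4 -> R) a b : (forall i, g i != 0) -> g a < 0 -> 0 < g b ->
  exists x0 : 'I_4 -> R, [/\ forall i, 0 < x0 i, \sum_i x0 i = 1 & \sum_i g i * x0 i = 0].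
Proof.
move=> g0 ga gb.
pose nn : R := #|[pred i | g i < 0]|%:R; pose np : R := #|[pred i | ~~ (g i < 0)]|%:R.
have nn0 : 0 < nn by rewrite ltr0n; apply/card_gt0P; exists a.
have np0 : 0 < np by rewrite ltr0n; apply/card_gt0P; exists b; rewrite inE lt_gtF.
pose y i := (`|g i| * (if g i < 0 then nn else np))^-1.
have y0 i : 0 < y i by rewrite invr_gt0 mulr_gt0 ?normr_gt0 //; case: ifP.
have gy : \sum_i g i * y i = 0.
  rewrite (bigID (fun i => g i < 0)) /=.
  rewrite (eq_bigr (fun=> - nn^-1)); last first.
    move=> i gi; rewrite /y gi ltr0_norm // invfM invrN mulrA mulrN.
    by rewrite divff ?g0 // mulN1r.
  rewrite [X in _ + X](eq_bigr (fun=> np^-1)); last first.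
    move=> i gi; rewrite /y (negPf gi) ger0_norm; last by rewrite leNgt.
    by rewrite invfM mulrA divff ?g0 // mul1r.
  by rewrite !sumr_const mulNrn -(mulr_natr nn^-1) -(mulr_natr np^-1) !mulVf ?gt_eqF // addNr.
have sy : 0 < \sum_i y i by rewrite (bigD1 a) //= ltr_pwDl // sumr_ge0 // => i _; exact: ltW.
exists (fun i => y i / \sum_i y i); split=> [i||].
- by rewrite divr_gt0.
- by rewrite -mulr_suml divff // gt_eqF.
- under eq_bigr do rewrite mulrA.
  by rewrite -mulr_suml gy mul0r.
Qed.

(** The plane section is parametrised by the displacements of the coordinates at [c] and [d]; [beta]
    is the displacement at [b] that the equation and the constant sum then force. *)
Lemma flat_disc (g : 'I_4 -> R) a b c d : uniq [:: a; b; c; d] ->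
  (forall i, g i != 0) -> g a < 0 -> 0 < g b ->
  let D := [set x : tetra R | \sum_i g i * bary x i = 0] in
  proper_disc D (D `&` @tetra_boundary R).
Proof.
move=> u g0 ga gb D; have [x0 [x00 x01 gx0]] := balanced_point g0 ga gb.
have gba : 0 < g b - g a by rewrite subr_gt0 (lt_trans ga).
pose beta (v : 'rV[R]_2) := (g a - g c) / (g b - g a) * v 0 0 + (g a - g d) / (g b - g a) * v 0 1.
pose L (v : 'rV[R]_2) := split4 a b c (- 1 * v 0 0 + (- 1 * v 0 1 + - 1 * beta v)) (beta v) (v 0 0) (v 0 1).
have LE (v : 'rV[R]_2) := split4E (- 1 * v 0 0 + (- 1 * v 0 1 + - 1 * beta v)) (beta v) (v 0 0) (v 0 1) u.
have betac : continuous beta.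
  by apply: continuous_add; apply: continuous_scale; [exact: continuous_v0|exact: continuous_v1].
apply: (@star_disc R x0 L) => //.
- apply: (forall4 u); rewrite /L.
  + rewrite (_ : (fun _ => _) = fun v : 'rV[R]_2 => - 1 * v 0 0 + (- 1 * v 0 1 + - 1 * beta v)); last first.
      by apply/funext => v; have [-> _ _ _] := LE v.
    apply: continuous_add; first by apply: continuous_scale; exact: continuous_v0.
    by apply: continuous_add; apply: continuous_scale => //; exact: continuous_v1.
  + by rewrite (_ : (fun _ => _) = beta) //; apply/funext => v; have [_ -> _ _] := LE v.
  + rewrite (_ : (fun _ => _) = fun v : 'rV[R]_2 => v 0 0); first exact: continuous_v0.
    by apply/funext => v; have [_ _ -> _] := LE v.
  + rewrite (_ : (fun _ => _) = fun v : 'rV[R]_2 => v 0 1); first exact: continuous_v1.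
    by apply/funext => v; have [_ _ _ ->] := LE v.
- move=> r v i r0; move: i; have [la lb lc ld] := LE v; have [ra rb rc rd] := LE (r *: v).
  by apply: (forall4 u); rewrite /L ?la ?lb ?lc ?ld ?ra ?rb ?rc ?rd /beta !mxE; ring.
- by move=> v; rewrite /L /split4 (sum4_if _ _ _ _ u); ring.
- move=> v w vw; rewrite (row2E v) (row2E w).
  have [_ _ vc vd] := LE v; have [_ _ wc wd] := LE w.
  by congr row2; [rewrite -vc -wc; exact: vw|rewrite -vd -wd; exact: vw].
- move=> x; rewrite /D /= (sum_uniq4 _ u); move: gx0 x01; rewrite !(sum_uniq4 _ u) => gx0 x01.
  have xs := sum_bary4 x u.
  split=> [gx|[v xv]].
    exists (row2 (bary x c - x0 c) (bary x d - x0 d)).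
    set v := row2 _ _.
    have v0 : v 0 0 = bary x c - x0 c by exact: row2_0.
    have v1 : v 0 1 = bary x d - x0 d by exact: row2_1.
    have [la lb lc ld] := LE v.
    have B : beta v = bary x b - x0 b.
      rewrite /beta v0 v1; apply: (mulfI (lt0r_neq0 gba)).
      have -> : (g b - g a) * ((g a - g c) / (g b - g a) * (bary x c - x0 c) +
        (g a - g d) / (g b - g a) * (bary x d - x0 d)) =
        (g a - g c) * (bary x c - x0 c) + (g a - g d) * (bary x d - x0 d).
        by field; rewrite gt_eqF.
      have Ea : bary x a = 1 - bary x b - bary x c - bary x d by rewrite -xs; ring.
      have Ea0 : x0 a = 1 - x0 b - x0 c - x0 d by rewrite -x01; ring.
      move: gx gx0; rewrite Ea Ea0; move: (bary x b) (bary x c) (bary x d) (x0 b) (x0 c) (x0 d).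
      move=> xb xc xd yb yc yd E1 E2.
      have : g a * (1 - xb - xc - xd) + g b * xb + g c * xc + g d * xd -
        (g a * (1 - yb - yc - yd) + g b * yb + g c * yc + g d * yd) = 0.
        by rewrite E1 E2 subrr.
      by move=> /eqP; rewrite -subr_eq0 => /eqP E; apply/eqP; rewrite -subr_eq0; apply/eqP;
        rewrite -[RHS]oppr0 -[in RHS]E; ring.
    apply: (forall4 u); rewrite /L ?la ?lb ?lc ?ld ?B ?v0 ?v1.
    + have -> : bary x a = 1 - bary x b - bary x c - bary x d by rewrite -xs; ring.
      have -> : x0 a = 1 - x0 b - x0 c - x0 d by rewrite -x01; ring.
      ring.
    + by ring.
    + by ring.
    + by ring.
  have [la lb lc ld] := LE v; rewrite !xv /L la lb lc ld.
  rewrite (_ : _ + _ = (g a * x0 a + g b * x0 b + g c * x0 c + g d * x0 d) +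
    (g a * (-1 * v 0 0 + (-1 * v 0 1 + -1 * beta v)) + g b * beta v + g c * v 0 0 + g d * v 0 1)); last by ring.
  rewrite gx0 add0r /beta; field.
  by rewrite gt_eqF.
Qed.

End Discs.

(** * The octagon *)

Section OctagonDisc.
Variable R : realType.

Definition pos (y : R) := Num.max y 0.

Lemma pos_ge0 z : 0 <= z -> pos z = z. Proof. exact: max_l. Qed.
Lemma pos_le0 z : z <= 0 -> pos z = 0. Proof. exact: max_r. Qed.

Lemma posP y : pos y - pos (- y) = y.
Proof.
have [y0|/ltW y0] := leP y 0.
  by rewrite pos_le0 // pos_ge0 ?oppr_ge0 // sub0r opprK.
by rewrite pos_ge0 // pos_le0 ?oppr_le0 // subr0.
Qed.

Lemma min_pos (m y : R) : Num.min (m + pos y) (m + pos (- y)) = m.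
Proof.
have [y0|/ltW y0] := leP y 0.
  by rewrite pos_le0 // pos_ge0 ?oppr_ge0 // addr0 min_l // lerDl oppr_ge0.
by rewrite pos_ge0 // pos_le0 ?oppr_le0 // addr0 min_r // lerDl.
Qed.

(** Two numbers are known from their minimum and their difference; this change of variables makes
    the minima in the equation of the octagon linear. *)
Lemma pos_min (x y : R) : x = Num.min x y + pos (x - y) /\ y = Num.min x y + pos (- (x - y)).
Proof.
have [xy|/ltW yx] := leP x y.
  by rewrite pos_le0 ?(pos_ge0 (z := - _)); [split; ring|lra|lra].
by rewrite pos_ge0 ?(pos_le0 (z := - _)); [split; ring|lra|lra].
Qed.

Lemma posZ (r y : R) : 0 <= r -> pos (r * y) = r * pos y.
Proof. by move=> r0; rewrite /pos maxr_pMr // mulr0. Qed.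

Lemma continuous_pos (X : topologicalType) (f : X -> R) :
  continuous f -> continuous (fun x => pos (f x)).
Proof. by move=> fc; apply: continuous_max => //; exact: cst_continuous. Qed.

Variables (a b c d : 'I_4).
Hypothesis u : uniq [:: a; b; c; d].
Variable tau : 'I_4 -> R.
Hypothesis tau0 : forall i, 0 < tau i.

(** With this factor the point nearer to [a] on the edge [ab] satisfies
    [(tau b + 1) * x_b = tau a * x_a], so that [x_b] is [tau a] divided by [tau a + tau b + 1]. This
    is the spacing wanted on an edge met twice, with [tau] one more than the number of triangles. *)
Let mu i := 2 * tau i + 1.

(* The equation is linear on the edges other than ab and cd, where both minima
   vanish. Along ab the right side is 0, and the left side is negative at both
   ends but positive where [mu a * x_a = mu b * x_b]: there are two points.   *)
Definition octagon : set (tetra R) :=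
  [set x | Num.min (mu a * bary x a) (mu b * bary x b) - tau a * bary x a - tau b * bary x b =
    Num.min (mu c * bary x c) (mu d * bary x d) - tau c * bary x c - tau d * bary x d].

Let mu0 i : 0 < mu i. Proof. by have := tau0 i; rewrite /mu; lra. Qed.
Let mun i : mu i != 0. Proof. by rewrite gt_eqF. Qed.
Let al i := tau i / mu i.
Let al_half i : al i < 2^-1.
Proof. by rewrite /al ltr_pdivrMr // /mu; lra. Qed.
Let tauE i (x : R) : tau i * x = al i * (mu i * x).
Proof. by rewrite /al; field. Qed.

(** With the differences of the scaled coordinates as parameters, the minima M1 and M2 solve p M1 -
    q M2 = U (the equation of the octagon) and r M1 + s M2 = 1 - W (the sum of the coordinates).
    Since every [al] is below one half, the determinant is positive. The centre [x0] is the solution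
    for zero parameters, and [m1], [m2] are the homogeneous parts. *)
Let p := 1 - al a - al b.
Let q := 1 - al c - al d.
Let r := (mu a)^-1 + (mu b)^-1.
Let s := (mu c)^-1 + (mu d)^-1.
Let det := p * s + q * r.
Let p0 : 0 < p. Proof. by have := al_half a; have := al_half b; rewrite /p; lra. Qed.
Let q0 : 0 < q. Proof. by have := al_half c; have := al_half d; rewrite /q; lra. Qed.
Let r0 : 0 < r. Proof. by rewrite addr_gt0 ?invr_gt0. Qed.
Let s0 : 0 < s. Proof. by rewrite addr_gt0 ?invr_gt0. Qed.
Let det0 : 0 < det. Proof. by rewrite addr_gt0 ?mulr_gt0. Qed.
Let detn : det != 0. Proof. by rewrite gt_eqF. Qed.

Let yp (v : 'rV[R]_2) := pos (v 0 0).
Let yn (v : 'rV[R]_2) := pos (- 1 * v 0 0).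
Let zp (v : 'rV[R]_2) := pos (v 0 1).
Let zn (v : 'rV[R]_2) := pos (- 1 * v 0 1).
Let U v := al a * yp v + (al b * yn v + ((- al c) * zp v + (- al d) * zn v)).
Let W v := (mu a)^-1 * yp v + ((mu b)^-1 * yn v + ((mu c)^-1 * zp v + (mu d)^-1 * zn v)).
Let m1 v := s / det * U v + (- (q / det)) * W v.
Let m2 v := (- (p / det)) * W v + (- (r / det)) * U v.
Let La v := (mu a)^-1 * (m1 v + yp v).
Let Lb v := (mu b)^-1 * (m1 v + yn v).
Let Lc v := (mu c)^-1 * (m2 v + zp v).
Let Ld v := (mu d)^-1 * (m2 v + zn v).
Let L v := split4 a b c (La v) (Lb v) (Lc v) (Ld v).
Let LE v := split4E (La v) (Lb v) (Lc v) (Ld v) u.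
Let x0 := split4 a b c (q / det / mu a) (q / det / mu b) (p / det / mu c) (p / det / mu d).
Let x0E := split4E (q / det / mu a) (q / det / mu b) (p / det / mu c) (p / det / mu d) u.

Let ypc : continuous yp. Proof. by apply: continuous_pos; exact: continuous_v0. Qed.
Let ync : continuous yn.
Proof. by apply: continuous_pos; apply: continuous_scale; exact: continuous_v0. Qed.
Let zpc : continuous zp. Proof. by apply: continuous_pos; exact: continuous_v1. Qed.
Let znc : continuous zn.
Proof. by apply: continuous_pos; apply: continuous_scale; exact: continuous_v1. Qed.

Let comb (f1 f2 f3 f4 : 'rV[R]_2 -> R) k1 k2 k3 k4 : continuous f1 -> continuous f2 ->
  continuous f3 -> continuous f4 ->
  continuous (fun v => k1 * f1 v + (k2 * f2 v + (k3 * f3 v + k4 * f4 v))).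
Proof.
move=> c1 c2 c3 c4; apply: continuous_add; first exact: continuous_scale.
apply: continuous_add; first exact: continuous_scale.
by apply: continuous_add; exact: continuous_scale.
Qed.
Let Uc : continuous U. Proof. exact: comb. Qed.
Let Wc : continuous W. Proof. exact: comb. Qed.
Let m1c : continuous m1.
Proof. by apply: continuous_add; exact: continuous_scale. Qed.
Let m2c : continuous m2.
Proof. by apply: continuous_add; exact: continuous_scale. Qed.

Let hom (k : R) v : 0 <= k -> [/\ yp (k *: v) = k * yp v, yn (k *: v) = k * yn v,
  zp (k *: v) = k * zp v & zn (k *: v) = k * zn v].
Proof.
by move=> k0; rewrite /yp /yn /zp /zn !mxE !(mulrCA (-1)) !(posZ _ k0).
Qed.

Let ypn v : yp v - yn v = v 0 0.
Proof. by rewrite /yp /yn mulN1r posP. Qed.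
Let zpn v : zp v - zn v = v 0 1.
Proof. by rewrite /zp /zn mulN1r posP. Qed.

Let mE v : p * m1 v - q * m2 v = U v /\ r * m1 v + s * m2 v = - W v.
Proof.
rewrite /m1 /m2; move: (U v) (W v) => U0 W0.
have dE : p * s + q * r != 0 by exact: detn.
by split; rewrite /det; field.
Qed.

Lemma octagon_disc : proper_disc octagon (octagon `&` @tetra_boundary R).
Proof.
have [xa xb xc xd] := x0E.
apply: (@star_disc R x0 L).
- by apply: (forall4 u); rewrite /x0 ?xa ?xb ?xc ?xd !divr_gt0.
- rewrite /x0 /split4 (sum4_if _ _ _ _ u).
  have -> : q / det / mu a + q / det / mu b + p / det / mu c + p / det / mu d = det / det.
    by rewrite /det /r /s; ring.
  exact: divff.
- apply: (forall4 u); rewrite /L.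
  + rewrite (_ : (fun _ => _) = La); last by apply/funext => v; have [-> _ _ _] := LE v.
    by apply: continuous_scale; exact: continuous_add.
  + rewrite (_ : (fun _ => _) = Lb); last by apply/funext => v; have [_ -> _ _] := LE v.
    by apply: continuous_scale; exact: continuous_add.
  + rewrite (_ : (fun _ => _) = Lc); last by apply/funext => v; have [_ _ -> _] := LE v.
    by apply: continuous_scale; exact: continuous_add.
  + rewrite (_ : (fun _ => _) = Ld); last by apply/funext => v; have [_ _ _ ->] := LE v.
    by apply: continuous_scale; exact: continuous_add.
- move=> k v i k0; move: i; have [la lb lc ld] := LE v; have [ra rb rc rd] := LE (k *: v).
  have [e1 e2 e3 e4] := hom v k0.
  by apply: (forall4 u); rewrite /L ?la ?lb ?lc ?ld ?ra ?rb ?rc ?rd /La /Lb /Lc /Ld /m1 /m2 /U /W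
    e1 e2 e3 e4; ring.
- move=> v; rewrite /L /split4 (sum4_if _ _ _ _ u).
  have [_ E] := mE v.
  have -> : La v + Lb v + Lc v + Ld v = (r * m1 v + s * m2 v) + W v.
    by rewrite /La /Lb /Lc /Ld /W /r /s; ring.
  by rewrite E addNr.
- move=> v w vw; rewrite (row2E v) (row2E w).
  have [va vb vc vd] := LE v; have [wa wb wc wd] := LE w.
  have Ea : La v = La w by rewrite -va -wa; exact: vw.
  have Eb : Lb v = Lb w by rewrite -vb -wb; exact: vw.
  have Ec : Lc v = Lc w by rewrite -vc -wc; exact: vw.
  have Ed : Ld v = Ld w by rewrite -vd -wd; exact: vw.
  have y (t : 'rV[R]_2) : t 0 0 = mu a * La t - mu b * Lb t.
    by rewrite /La /Lb !mulVKf // -ypn; ring.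
  have z (t : 'rV[R]_2) : t 0 1 = mu c * Lc t - mu d * Ld t.
    by rewrite /Lc /Ld !mulVKf // -zpn; ring.
  by congr row2; rewrite ?y ?z ?Ea ?Eb ?Ec ?Ed.
- move=> x; rewrite /octagon /=.
  have xs := sum_bary4 x u.
  rewrite !tauE; set Xa := mu a * _; set Xb := mu b * _; set Xc := mu c * _; set Xd := mu d * _.
  have BE i : bary x i = (mu i)^-1 * (mu i * bary x i) by rewrite mulKf.
  split=> [oct|[v xv]]; last first.
    have [la lb lc ld] := LE v.
    have Ea : Xa = (q / det + m1 v) + yp v by rewrite /Xa xv /x0 /L xa la /La mulrDr mulrCA divff // mulr1 mulVKf // addrA.
    have Eb : Xb = (q / det + m1 v) + yn v by rewrite /Xb xv /x0 /L xb lb /Lb mulrDr mulrCA divff // mulr1 mulVKf // addrA.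
    have Ec : Xc = (p / det + m2 v) + zp v by rewrite /Xc xv /x0 /L xc lc /Lc mulrDr mulrCA divff // mulr1 mulVKf // addrA.
    have Ed : Xd = (p / det + m2 v) + zn v by rewrite /Xd xv /x0 /L xd ld /Ld mulrDr mulrCA divff // mulr1 mulVKf // addrA.
    have my m : Num.min (m + yp v) (m + yn v) = m by rewrite /yp /yn mulN1r min_pos.
    have mz m : Num.min (m + zp v) (m + zn v) = m by rewrite /zp /zn mulN1r min_pos.
    rewrite Ea Eb Ec Ed my mz; have [E _] := mE v.
    have F : p * (q / det) - q * (p / det) = 0 by ring.
    have G : p * m1 v - q * m2 v - U v + (p * (q / det) - q * (p / det)) = 0.
      by rewrite E F subrr addr0.
    apply/eqP; rewrite -subr_eq0 -[X in _ == X]G; apply/eqP.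
    move: (q / det) (p / det) (m1 v) (m2 v) => k1 k2 M1 M2.
    by rewrite /U /p /q; ring.
  pose v := row2 (Xa - Xb) (Xc - Xd).
  have v0 : v 0 0 = Xa - Xb by exact: row2_0.
  have v1 : v 0 1 = Xc - Xd by exact: row2_1.
  have [Ea Eb] := pos_min Xa Xb; have [Ec Ed] := pos_min Xc Xd.
  have Eyp : yp v = pos (Xa - Xb) by rewrite /yp v0.
  have Eyn : yn v = pos (- (Xa - Xb)) by rewrite /yn v0 mulN1r.
  have Ezp : zp v = pos (Xc - Xd) by rewrite /zp v1.
  have Ezn : zn v = pos (- (Xc - Xd)) by rewrite /zn v1 mulN1r.
  rewrite -Eyp in Ea; rewrite -Eyn in Eb; rewrite -Ezp in Ec; rewrite -Ezn in Ed.
  set M1 := Num.min Xa Xb in Ea Eb oct; set M2 := Num.min Xc Xd in Ec Ed oct.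
  have E1 : p * M1 - q * M2 = U v.
    have O : (M1 - al a * Xa - al b * Xb) - (M2 - al c * Xc - al d * Xd) = 0.
      by rewrite oct subrr.
    apply/eqP; rewrite -subr_eq0 -[X in _ == X]O Ea Eb Ec Ed; apply/eqP.
    by rewrite /U /p /q; ring.
  have E2 : r * M1 + s * M2 = 1 - W v.
    move: xs; rewrite (BE a) (BE b) (BE c) (BE d) -/Xa -/Xb -/Xc -/Xd Ea Eb Ec Ed => <-.
    by rewrite /W /r /s; ring.
  have [F1 F2] := mE v.
  have D1 : M1 = q / det + m1 v.
    apply: (mulfI detn); rewrite mulrDr mulrCA divff // mulr1 {1}/det.
    have -> : (p * s + q * r) * M1 = s * (p * M1 - q * M2) + q * (r * M1 + s * M2) by ring.
    have -> : det * m1 v = s * (p * m1 v - q * m2 v) + q * (r * m1 v + s * m2 v) by rewrite /det; ring.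
    by rewrite E1 E2 F1 F2; ring.
  have D2 : M2 = p / det + m2 v.
    apply: (mulfI detn); rewrite mulrDr mulrCA divff // mulr1 {1}/det.
    have -> : (p * s + q * r) * M2 = p * (r * M1 + s * M2) - r * (p * M1 - q * M2) by ring.
    have -> : det * m2 v = p * (r * m1 v + s * m2 v) - r * (p * m1 v - q * m2 v) by rewrite /det; ring.
    by rewrite E1 E2 F1 F2; ring.
  exists v; have [la lb lc ld] := LE v.
  apply: (forall4 u); rewrite /L /x0 ?la ?lb ?lc ?ld ?xa ?xb ?xc ?xd BE.
  + by rewrite -/Xa Ea D1 /La; ring.
  + by rewrite -/Xb Eb D1 /Lb; ring.
  + by rewrite -/Xc Ec D2 /Lc; ring.
  + by rewrite -/Xd Ed D2 /Ld; ring.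
Qed.

End OctagonDisc.

(** * Parallel pieces in one tetrahedron *)

Section Pieces.
Variable R : realType.

(* What a tetrahedron contains besides triangles. *)
Variant core := QuadCore of 'I_3 & nat | OctCore of 'I_3.

Definition core_arcs (k : core) (f v : 'I_4) : nat :=
  match k with
  | QuadCore j q => if paired j f v then q else 0
  | OctCore j => ~~ paired j f v
  end.

Definition core_crossings (k : core) (a b : 'I_4) : nat :=
  match k with
  | QuadCore j q => if paired j a b then 0 else q
  | OctCore j => if paired j a b then 2 else 1
  end.

Lemma core_crossingsE k f a b : a != b -> f != a -> f != b ->
  core_crossings k a b = (core_arcs k f a + core_arcs k f b)%N.
Proof.
case: k => [j q|j] ab fa fb /=.
  have := @crossingsE (Quad j) f a b ab fa fb; rewrite /= /cuts fa fb /=.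
  by case: (paired j a b); case: (paired j f a); case: (paired j f b) => //=; rewrite ?addn0.
by have := @crossingsE (Oct j) f a b ab fa fb; rewrite /= /cuts fa fb.
Qed.

Variables (t : 'I_4 -> nat) (k : core).

Definition arcs_at f v := (t v + core_arcs k f v)%N.
(* The surface divides the edge ab into [weight a b] segments of equal length. *)
Definition weight a b : R := (t a + t b + core_crossings k a b + 1)%:R.

Lemma core_crossingsC a b : core_crossings k a b = core_crossings k b a.
Proof. by rewrite /core_crossings; case: k => [j q|j]; rewrite pairedC. Qed.

Lemma weightC a b : weight a b = weight b a.
Proof. by rewrite /weight core_crossingsC (addnC (t a)). Qed.

Let T i : R := (t i)%:R.
Let T0 i : 0 <= T i. Proof. exact: ler0n. Qed.

Lemma weightE a b : weight a b = T a + T b + (core_crossings k a b)%:R + 1.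
Proof. by rewrite /weight !natrD. Qed.

Lemma weighted_sum (M : 'I_4 -> 'I_4 -> R) (x : tetra R) v a b c : uniq [:: v; a; b; c] ->
  weighted M v x = M v a * bary x a + M v b * bary x b + M v c * bary x c.
Proof.
move=> u; rewrite /weighted big_mkcond (sum_uniq4 _ u) eqxx add0r.
by move: u; rewrite /= !inE !negb_or !(eq_sym v) => /and4P[/and3P[-> -> ->]].
Qed.

Definition side (j : 'I_3) (v : 'I_4) : bool := (v == ord0) || (v == lift ord0 j).

Lemma pairedS j a b : paired j a b = (side j a == side j b).
Proof. exact: pairedE. Qed.

(** The [q] parallel quadrilaterals are the levels 1 to [q]. Level [m] meets an edge from [v] in the
    side to [w] outside it where the coordinate of [w] is (t v + m) / (t v + t w + q + 1): after the
    triangles at [v], with equal spacing. *)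
Definition quad_form j q (x : tetra R) : R :=
  \sum_i (if side j i then - T i else T i + q%:R + 1) * bary x i.

Lemma partnerP j f : exists g c d, [/\ uniq [:: f; g; c; d], side j g = side j f,
  side j c = ~~ side j f & side j d = ~~ side j f].
Proof.
have [j' jj'] : exists j', j != j' by case: j => [[|i] ?]; [exists (@Ordinal 3 1 isT)|exists ord0].
have [a [b [c [d [u [ab cd ac ad [bc bd]] _]]]]] := pairing_labels jj'.
move: ab cd ac ad bc bd; rewrite !pairedS => ab cd ac ad bc bd.
have := mem_uniq4 u erefl f; rewrite !inE => /or4P[]/eqP ->.
- exists b, c, d; split; first exact: u;
  by move: ab cd ac ad bc bd; case: (side j a); case: (side j b); case: (side j c); case: (side j d).
- exists a, c, d; split; first reorder;
  by move: ab cd ac ad bc bd; case: (side j a); case: (side j b); case: (side j c); case: (side j d).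
- exists d, a, b; split; first reorder;
  by move: ab cd ac ad bc bd; case: (side j a); case: (side j b); case: (side j c); case: (side j d).
- exists c, a, b; split; first reorder;
  by move: ab cd ac ad bc bd; case: (side j a); case: (side j b); case: (side j c); case: (side j d).
Qed.

Definition oct_tau i : R := T i + 1.

Lemma oct_labels j : exists abcd : 'I_4 * 'I_4 * 'I_4 * 'I_4,
  let: (a, b, c, d) := abcd in
  [/\ uniq [:: a; b; c; d], side j b = side j a, side j c = ~~ side j a & side j d = ~~ side j a].
Proof. by have [b [c [d H]]] := partnerP j ord0; exists (ord0, b, c, d). Qed.

Definition oct_set j : set (tetra R) :=
  let: (a, b, c, d) := sval (cid (oct_labels j)) in octagon a b c d oct_tau.

Lemma octagon_swap a b c d x : octagon a b c d oct_tau x -> octagon b a c d oct_tau x.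
Proof. by rewrite /octagon /= => E; rewrite minC -E; ring. Qed.

Lemma octagon_flip a b c d x : octagon a b c d oct_tau x -> octagon c d a b oct_tau x.
Proof. by rewrite /octagon /= => ->. Qed.

(** The labels in [oct_set] come from a choice. The equation is symmetric under the relabellings
    that preserve the pair of opposite edges, so all admissible labels give the same set. *)
Lemma oct_setP j f g c d x : uniq [:: f; g; c; d] -> side j g = side j f ->
  side j c = ~~ side j f -> side j d = ~~ side j f ->
  oct_set j x <-> octagon f g c d oct_tau x.
Proof.
rewrite /oct_set; case: cid => -[[[a b] c'] d'] /= [u sb sc sd] u' sg sc' sd'.
have key a1 b1 c1 d1 f1 g1 c2 d2 : uniq [:: a1; b1; c1; d1] -> side j b1 = side j a1 ->
    side j c1 = ~~ side j a1 -> side j d1 = ~~ side j a1 ->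
    uniq [:: f1; g1; c2; d2] -> side j g1 = side j f1 ->
    side j c2 = ~~ side j f1 -> side j d2 = ~~ side j f1 ->
    octagon a1 b1 c1 d1 oct_tau x -> octagon f1 g1 c2 d2 oct_tau x.
  move=> {u sb sc sd u' sg sc' sd'} u sb sc sd u' sg sc' sd' H.
  wlog fa : a1 b1 c1 d1 u sb sc sd H / side j f1 = side j a1.
    move=> W; have [fa|fa] := eqVneq (side j f1) (side j a1); first exact: (W a1 b1 c1 d1).
    apply: (W c1 d1 a1 b1).
    - by reorder.
    - by rewrite sc sd.
    - by rewrite sc negbK.
    - by rewrite sb sc negbK.
    - exact: octagon_flip.
    - by rewrite sc; move: fa; case: (side _ _); case: (side _ _).
  have U4 := mem_uniq4 u erefl.
  move: u u'; rewrite /= !inE !negb_or !andbT => /and3P[/and3P[ab ac ad] /andP[bc bd] cd]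
    /and3P[/and3P[fg fc fd] /andP[gc gd] cd'].
  have inab i : side j i = side j a1 -> (i == a1) || (i == b1).
    move=> si; have := U4 i; rewrite !inE => /or4P[]/eqP iE; rewrite iE ?eqxx ?orbT //;
    by move: si; rewrite iE ?sc ?sd; case: (side j a1).
  have incd i : side j i = ~~ side j a1 -> (i == c1) || (i == d1).
    move=> si; have := U4 i; rewrite !inE => /or4P[]/eqP iE; rewrite iE ?eqxx ?orbT //;
    by move: si; rewrite iE ?sb; case: (side j a1).
  have H1 : octagon f1 g1 c1 d1 oct_tau x.
    have := inab f1 fa; have := inab g1; rewrite sg => /(_ fa).
    case/orP => /eqP gE; case/orP => /eqP fE; rewrite gE fE ?eqxx // in fg *.
    exact: octagon_swap.
  apply: octagon_flip; move/octagon_flip: H1 => H1.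
  have := incd c2; have := incd d2; rewrite sc' sd' fa => /(_ erefl) + /(_ erefl).
  case/orP => /eqP dE; case/orP => /eqP cE; rewrite cE dE ?eqxx // in cd' *.
  exact: octagon_swap.
by split; apply: key.
Qed.

Definition piece_set (p : disc_type * nat) : set (tetra R) :=
  match p.1 with
  | Tri v => [set x | weighted weight v x = p.2%:R]
  | Quad j => [set x | quad_form j (if k is QuadCore _ q then q else 0%N) x = p.2%:R]
  | Oct j => oct_set j
  end.

Definition valid_piece (p : disc_type * nat) : bool :=
  match p.1 with
  | Tri v => (0 < p.2 <= t v)%N
  | Quad j => if k is QuadCore j' q then (j == j') && (0 < p.2 <= q)%N else false
  | Oct j => if k is OctCore j' then (j == j') && (p.2 == 0)%N else false
  end.

(* The trace of the piece p on the arc at v: along each edge at v, the surface is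
   met for the [level p v]-th time, counting from v.                         *)
Definition level (p : disc_type * nat) (v : 'I_4) : nat :=
  match p.1 with
  | Tri _ => p.2
  | Quad j => if side j v then t v + p.2
              else t v + (if k is QuadCore _ q then q else 0) + 1 - p.2
  | Oct _ => t v + 1
  end%N.

Lemma quad_form4 j q x v v' c d : uniq [:: v; v'; c; d] -> side j v' = side j v ->
  side j c = ~~ side j v -> side j d = ~~ side j v ->
  (if side j v then quad_form j q x else q%:R + 1 - quad_form j q x) =
  - T v * bary x v - T v' * bary x v' + (T c + q%:R + 1) * bary x c + (T d + q%:R + 1) * bary x d.
Proof.
move=> u sv' sc sd; have := sum_bary4 x u; rewrite /quad_form (sum_uniq4 _ u) sv' sc sd.
case: (side j v) => /= s; first by ring.
rewrite -[X in X - _]mulr1 -[X in _ * X - _]s; ring.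
Qed.

Lemma level_pos p f v : valid_piece p -> cuts p.1 f v -> (0 < level p v)%N.
Proof.
case: p => -[u|j|j] m; rewrite /valid_piece /level /=.
- by case/andP.
- case: k => // j' q /andP[_ /andP[m0 mq]] _; case: ifP => _; first by rewrite addn_gt0 m0 orbT.
  by lia.
- by move=> _ _; rewrite addn1.
Qed.

Lemma level_lt p f v c : valid_piece p -> cuts p.1 f v -> c != f -> c != v ->
  (level p v < t v + t c + core_crossings k v c + 1)%N.
Proof.
case: p => -[u|j|j] m; rewrite /valid_piece /level /cuts /=.
- by move=> /andP[_ mt] /andP[_ /eqP ->] _ _; lia.
- case: k => // j' q /andP[/eqP <- /andP[m0 mq]] /andP[fv pf] cf cv /=.
  have vc : paired j v c = false.
    have := @crossingsE (Quad j) f v c; rewrite eq_sym => /(_ cv fv).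
    rewrite eq_sym => /(_ cf); rewrite /= /cuts fv pf /=.
    by case: (paired j v c) => //=; rewrite add1n.
  by rewrite vc; case: ifP => _; lia.
- case: k => // j' /andP[/eqP <- _] _ _ _ /=; by case: ifP => _; lia.
Qed.

Lemma level_add p f v v' : valid_piece p -> cuts p.1 f v -> cuts p.1 f v' -> v != v' ->
  (level p v + level p v' < t v + t v' + core_crossings k v v' + 1)%N.
Proof.
case: p => -[u|j|j] m; rewrite /valid_piece /level /cuts /=.
- by move=> _ /andP[_ /eqP ->] /andP[_ /eqP ->]; rewrite eqxx.
- move=> _ /andP[fv pv] /andP[fv' pv'] vv'.
  have := @crossingsE (Quad j) f v v' vv' fv fv'; rewrite /= /cuts fv fv' pv pv' /=.
  by case: (paired j v v').
- case: k => // j' /andP[/eqP <- _] /andP[fv pv] /andP[fv' pv'] vv' /=.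
  have := @crossingsE (Oct j) f v v' vv' fv fv'; rewrite /= /cuts fv fv' pv pv' /=.
  by case: (paired j v v') => //; lia.
Qed.

Lemma weighted_expand x v a b c : uniq [:: v; a; b; c] ->
  weighted weight v x = T v - T v * bary x v +
    (T a * bary x a + (core_crossings k v a)%:R * bary x a + bary x a) +
    (T b * bary x b + (core_crossings k v b)%:R * bary x b + bary x b) +
    (T c * bary x c + (core_crossings k v c)%:R * bary x c + bary x c).
Proof.
move=> u; rewrite (weighted_sum _ _ u) !weightE -[X in _ = X - _ + _ + _ + _]mulr1.
by rewrite -[X in _ = _ * X - _ + _ + _ + _](sum_bary4 x u); ring.
Qed.

(** Modulo [bary x f = 0] and the sum of the coordinates, the equation of a piece becomes that of
    its arcs: at most one for a triangle, one for a quadrilateral, and two for an octagon according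
    to which argument attains the remaining minimum. *)
Lemma piece_face p f x : valid_piece p -> bary x f = 0 ->
  piece_set p x <-> exists v, cuts p.1 f v /\ weighted weight v x = (level p v)%:R.
Proof.
case: p => -[v|j|j] m; rewrite /valid_piece /piece_set /level /cuts /=.
- move=> /andP[m0 mt] xf; split=> [E|[_ [/andP[_ /eqP ->]]] //].
  (* A triangle at [f] does not reach the opposite face, where its form is at least [T f + 1]. *)
  exists v; split=> //; rewrite eqxx andbT; apply/eqP => fv; subst v.
  have [f' ff'] : exists f', f != f' by exists (if f == ord0 then @Ordinal 4 1 isT else ord0); case: ifP => [/eqP ->|->].
  have [a [b u]] := uniq4_complete ff'.
  move: E; rewrite (weighted_expand _ u) xf => E.
  have := sum_bary4 x u; rewrite xf.
  have H i : 0 <= T i * bary x i by rewrite mulr_ge0 ?bary_ge0.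
  have H' c i : 0 <= (core_crossings k f c)%:R * bary x i by rewrite mulr_ge0 ?bary_ge0.
  have mT : m%:R <= T f by rewrite ler_nat.
  move: E (H f') (H a) (H b) (H' f' f') (H' a a) (H' b b) mT; clear=> *; lra.
- case kE : k => [j' q|//] /andP[/eqP jj' /andP[m0 mq]] xf; subst j'.
  have [g [c [d [u sg sc sd]]]] := partnerP j f.
  have u' : uniq [:: g; f; c; d] by reorder.
  have fg : f != g by move: u; rewrite /= !inE !negb_or => /andP[/andP[]].
  have pg : paired j g f by rewrite pairedS sg.
  have pc : paired j g c = false by rewrite pairedS sg sc; case: (side _ _).
  have pd : paired j g d = false by rewrite pairedS sg sd; case: (side _ _).
  have key : weighted weight g x = T g +
      (if side j f then quad_form j q x else q%:R + 1 - quad_form j q x).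
    by rewrite (quad_form4 _ _ u sg sc sd) (weighted_expand _ u') kE /= pg pc pd xf; ring.
  have E : quad_form j q x = m%:R <-> weighted weight g x = (level (Quad j, m) g)%:R.
    rewrite key /level kE /= sg; case: (side j f).
      by rewrite natrD; split=> [->//|/addrI].
    rewrite natrB ?natrD; last by (clear -m0 mq; lia).
    rewrite -/(T g); split=> [->|]; first ring.
    by move: (quad_form _ _ _) (T g) => G Tg; clear=> *; lra.
  move: E; rewrite /level kE /= => E.
  split=> [/E F|[v [/andP[fv pv] F]]]; first by exists g; split; [rewrite fg pairedC pg|exact: F].
  apply/E; rewrite (_ : g = v) //; apply/eqP.
  have := mem_uniq4 u erefl v; rewrite !inE eq_sym (negPf fv) /= => /or3P[/eqP ->//|/eqP vE|/eqP vE].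
    by move: pv; rewrite vE pairedS sc; case: (side _ _).
  by move: pv; rewrite vE pairedS sd; case: (side _ _).
- case kE : k => [//|j'] /andP[/eqP jj' _] xf; subst j'.
  have [g [c [d [u sg sc sd]]]] := partnerP j f.
  have uc : uniq [:: c; f; g; d] by reorder.
  have ud : uniq [:: d; f; g; c] by reorder.
  have [fc fd] : f != c /\ f != d.
    by move: u; rewrite /= !inE !negb_or => /andP[/and3P[_ -> ->]].
  have pfc : paired j f c = false by rewrite pairedS sc; case: (side _ _).
  have pfd : paired j f d = false by rewrite pairedS sd; case: (side _ _).
  have pcg : paired j c g = false by rewrite pairedS sc sg; case: (side _ _).
  have pdg : paired j d g = false by rewrite pairedS sd sg; case: (side _ _).
  have pcd : paired j c d by rewrite pairedS sc sd.
  have := bary_ge0 x g; have := bary_ge0 x c; have := bary_ge0 x d.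
  have H i : 0 <= T i * bary x i by rewrite mulr_ge0 ?bary_ge0.
  have := H g; have := H c; have := H d; move=> Td Tc Tg xd xc xg.
  have xs := sum_bary4 x u; rewrite xf add0r in xs.
  have Wc : weighted weight c x = (t c + 1)%:R <->
      T c * bary x c + bary x c = T g * bary x g + T d * bary x d + bary x g + 2 * bary x d.
    rewrite (weighted_expand _ uc) kE /= pcg pcd xf natrD.
    split=> E; move: E xs; rewrite -/(T c); clear=> E xs; lra.
  have Wd : weighted weight d x = (t d + 1)%:R <->
      T d * bary x d + bary x d = T g * bary x g + T c * bary x c + bary x g + 2 * bary x c.
    rewrite (weighted_expand _ ud) kE /= pdg (pairedC j d c) pcd xf natrD.
    split=> E; move: E xs; rewrite -/(T d); clear=> E xs; lra.
  rewrite (oct_setP _ u sg sc sd) /octagon /= xf !mulr0 min_l; last first.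
    by rewrite mulr_ge0 // /oct_tau; have := T0 g; clear; lra.
  rewrite /oct_tau.
  have [Ec Ed] : (exists v, [&& f != v & ~~ paired j f v] /\ weighted weight v x = (t v + 1)%:R)
      <-> weighted weight c x = (t c + 1)%:R \/ weighted weight d x = (t d + 1)%:R.
    split=> [[v [/andP[fv pv] E]]|[]E]; last 2 first.
    + by exists c; rewrite fc pfc.
    + by exists d; rewrite fd pfd.
    have := mem_uniq4 u erefl v; rewrite !inE eq_sym (negPf fv) /= => /or3P[]/eqP vE; subst v; auto.
    by move: pv; rewrite pairedS sg eqxx.
  split=> [E|/Ec]; first (apply: Ed; rewrite Wc Wd); last rewrite Wc Wd.
    move: E; case: leP => _ E; [right|left]; move: E xs; clear=> E xs; lra.
  case=> E; [rewrite min_r|rewrite min_l]; move: Td Tc Tg xd xc xg xs E; clear=> *; lra.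
Qed.

Lemma piece_proper p : valid_piece p ->
  proper_disc (piece_set p) (piece_set p `&` @tetra_boundary R).
Proof.
case: p => -[v|j|j] m; rewrite /valid_piece /piece_set /=.
- move=> /andP[m0 mt].
  have [f' ff'] : exists f', v != f' by exists (if v == ord0 then @Ordinal 4 1 isT else ord0); case: ifP => [/eqP ->|->].
  have [a [b u]] := uniq4_complete ff'.
  have mT : m%:R <= T v by rewrite ler_nat.
  have m0' : 0 < m%:R :> R by rewrite ltr0n.
  have W c : m%:R < weight v c.
    rewrite weightE; have := T0 c; have := ler0n R (core_crossings k v c).
    by move: mT; clear; lra.
  pose g c := (if c == v then 0 else weight v c) - m%:R.
  have gv : g v < 0 by rewrite /g eqxx sub0r oppr_lt0.
  have gc c : c != v -> 0 < g c by move=> /negPf cv; rewrite /g cv subr_gt0.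
  rewrite (_ : [set x | _] = [set x : tetra R | \sum_i g i * bary x i = 0]).
    apply: (flat_disc u) => // [c|]; last by rewrite gc // eq_sym.
    by have [->|/gc/lt0r_neq0//] := eqVneq c v; rewrite lt_eqF.
  apply/funext => x /=; rewrite (weighted_sum _ _ u) (sum_uniq4 _ u) /g eqxx.
  move: (u); rewrite /= !inE !negb_or !(eq_sym v) => /and4P[/and3P[/negPf-> /negPf-> /negPf->] _ _ _].
  have xs := sum_bary4 x u.
  rewrite (_ : (0 - _) * _ + _ + _ + _ = weight v f' * bary x f' + weight v a * bary x a +
    weight v b * bary x b - m%:R * (bary x v + bary x f' + bary x a + bary x b)); last by ring.
  by rewrite xs mulr1; apply/propext; split=> [->|/subr0_eq //]; rewrite subrr.
- case kE : k => [j' q|//] /andP[/eqP jj' /andP[m0 mq]]; subst j'.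
  have [h [c [d [u sh sc sd]]]] := partnerP j ord0.
  have u' : uniq [:: ord0; c; h; d] by reorder.
  have m0' : 0 < m%:R :> R by rewrite ltr0n.
  have mq' : m%:R <= q%:R :> R by rewrite ler_nat.
  pose g i := (if side j i then - T i else T i + q%:R + 1) - m%:R.
  have s0 : side j ord0 by rewrite /side eqxx.
  have g0 i : if side j i then g i < 0 else 0 < g i.
    by have := T0 i; rewrite /g; case: (side j i); move: m0' mq'; clear; lra.
  have ga : g ord0 < 0 by have := g0 ord0; rewrite s0.
  have gb : 0 < g c by have := g0 c; rewrite sc s0.
  rewrite (_ : [set x | _] = [set x : tetra R | \sum_i g i * bary x i = 0]).
    apply: (flat_disc u') => // i.
    by have := g0 i; case: ifP => _ gi; [rewrite lt_eqF|rewrite gt_eqF].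
  apply/funext => x /=.
  have -> : \sum_i g i * bary x i = quad_form j q x - m%:R.
    rewrite -[X in _ = _ - X]mulr1 -[X in _ = _ - _ * X](sum_bary4 x u) -(sum_uniq4 _ u) mulr_sumr -sumrB.
    by apply: eq_bigr => i _; rewrite mulrBl.
  by apply/propext; split=> [->|/subr0_eq //]; rewrite subrr.
- move=> _; rewrite /oct_set; case: cid => -[[[a b] c] d] /= [u _ _ _].
  by apply: octagon_disc => // i; rewrite /oct_tau ltr_wpDl.
Qed.

Lemma piece_normal_disc p : valid_piece p -> normal_disc p.1 (piece_set p).
Proof.
move=> vp; apply: (@normal_disc_intro R _ _ weight (fun v => (level p v)%:R)).
- exact: weightC.
- exact: piece_proper.
- by move=> f x xf; apply: piece_face.
- by move=> f v c; rewrite ltr0n (level_pos vp c).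
- by move=> f v c cu cf cv; rewrite ltr_nat (level_lt vp cu).
- by move=> f v v' c c' vv'; rewrite -natrD ltr_nat (level_add vp c c').
Qed.

(** Parallel pieces are different levels of one form. The triangles at [a] lie where the form of [a]
    is at most [t a]; quadrilaterals and octagons stay where it is larger, and the bounds for two
    different vertices cannot hold together. *)
Lemma piece_set_disjoint (p p' : disc_type * nat) : valid_piece p -> valid_piece p' -> p <> p' ->
  piece_set p `&` piece_set p' = set0.
Proof.
move=> vp vp' pp'; apply/seteqP; split=> // x [].
have H i : 0 <= T i * bary x i by rewrite mulr_ge0 ?bary_ge0.
have H' (a b i : 'I_4) : 0 <= (core_crossings k a b)%:R * bary x i by rewrite mulr_ge0 ?bary_ge0.
(* By symmetry a triangle, if there is one, comes first. *)
wlog : p p' vp vp' pp' / if p.1 is Tri _ then True else if p'.1 is Tri _ then False else True.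
  move=> W; case E : p.1 => [a|j|j].
  - by apply: W => //; rewrite E.
  - case E' : p'.1 => [a|j1|j1]; [|by apply: W; rewrite ?E ?E'|by apply: W; rewrite ?E ?E'].
    by move=> px px'; apply: (W p' p) => //; [exact/nesym|rewrite E'].
  - case E' : p'.1 => [a|j1|j1]; [|by apply: W; rewrite ?E ?E'|by apply: W; rewrite ?E ?E'].
    by move=> px px'; apply: (W p' p) => //; [exact/nesym|rewrite E'].
case: p vp pp' => -[a|j|j] m.
- rewrite /valid_piece /= => /andP[m0 mt].
  have mT : m%:R <= T a by rewrite ler_nat.
  case: p' vp' => -[b|j|j] m'; rewrite /valid_piece /piece_set /=.
  + move=> /andP[m0' mt'] ab _ E E'.
    have m'T : m'%:R <= T b by rewrite ler_nat.
    have [abE|nab] := eqVneq a b.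
      subst b; apply: ab; congr (_, _).
      by apply/eqP; rewrite -(eqr_nat R) -E -E'.
    have [c [d u]] := uniq4_complete nab.
    have u' : uniq [:: b; a; c; d] by reorder.
    move: E E'; rewrite (weighted_expand _ u) (weighted_expand _ u').
    have := sum_bary4 x u; move: (H a) (H b) (H c) (H d) (H' a b b) (H' a c c) (H' a d d)
      (H' b a a) (H' b c c) (H' b d d) mT m'T (bary_ge0 x c) (bary_ge0 x d); clear=> *; lra.
  + case kE : k => [j' q|//] /andP[/eqP jj' /andP[m0' mq]] _ _ E E'; subst j'.
    have [g [c [d [u sg sc sd]]]] := partnerP j a.
    have := quad_form4 q x u sg sc sd; rewrite E'.
    have L : 0 < if side j a then m'%:R else q%:R + 1 - m'%:R :> R.
      case: ifP => _; first by rewrite ltr0n.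
      have : m'%:R <= q%:R :> R by rewrite ler_nat.
      by move: (m'%:R : R) (q%:R : R) => r1 r2; clear=> *; lra.
    have pg : paired j a g by rewrite pairedS sg.
    have pc : paired j a c = false by rewrite pairedS sc; case: (side _ _).
    have pd : paired j a d = false by rewrite pairedS sd; case: (side _ _).
    move: E; rewrite (weighted_expand _ u) kE /= pg pc pd.
    move: L mT (H g) (bary_ge0 x g).
    move: (if _ then _ else _) => L; clear=> *; lra.
  + case kE : k => [//|j'] /andP[/eqP jj' _] _ _ E; subst j'.
    have [g [c [d [u sg sc sd]]]] := partnerP j a.
    have pg : paired j a g by rewrite pairedS sg.
    have pc : paired j a c = false by rewrite pairedS sc; case: (side _ _).
    have pd : paired j a d = false by rewrite pairedS sd; case: (side _ _).
    rewrite (oct_setP _ u sg sc sd) /octagon /oct_tau /=.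
    move: E; rewrite (weighted_expand _ u) kE /= pg pc pd.
    have := sum_bary4 x u; move: (H a) (H g) (H c) (H d) mT (bary_ge0 x a) (bary_ge0 x g)
      (bary_ge0 x c) (bary_ge0 x d) => Ha Hg Hc Hd mT xa xg xc xd s E.
    have : Num.min ((2 * (T a + 1) + 1) * bary x a) ((2 * (T g + 1) + 1) * bary x g) <=
        2 * (T g * bary x g) + 3 * bary x g by rewrite ge_min; apply/orP; right; clear; lra.
    have : 0 <= Num.min ((2 * (T c + 1) + 1) * bary x c) ((2 * (T d + 1) + 1) * bary x d).
      by rewrite le_min !mulr_ge0 ?(bary_ge0 x) //; move: (T0 c) (T0 d); clear=> *; lra.
    move: (Num.min _ _) (Num.min _ _) E s xa xg xc xd mT Ha Hg Hc Hd; clear=> *; lra.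
- case: p' vp' => -[b|j'|j'] m'; rewrite /valid_piece /piece_set //=; case: k => // j1 q.
  by move=> /andP[/eqP -> _] /andP[/eqP -> _] jm _ /= -> /eqP; rewrite eqr_nat => /eqP mm; apply: jm; rewrite mm.
- case: p' vp' => -[b|j'|j'] m'; rewrite /valid_piece /piece_set //=; case: k => // j1.
  by move=> /andP[/eqP -> /eqP ->] /andP[/eqP -> /eqP ->].
Qed.

(** Around each vertex the levels 1 to [arcs_at f v] are all occupied, by the triangles and then by
    the other pieces. The right side mentions only arc numbers and weights, which is what allows
    pieces to be matched across a face. *)
Lemma pieces_face f x : bary x f = 0 ->
  (exists2 p, valid_piece p & piece_set p x) <->
  exists v m, [/\ f != v, (0 < m <= arcs_at f v)%N & weighted weight v x = m%:R].
Proof.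
move=> xf; split=> [[p vp /(piece_face vp xf)[v [c E]]]|[v [m [fv mv E]]]].
  exists v, (level p v); split=> //; first by case/andP: c.
  rewrite (level_pos vp c) /=; move: vp c; rewrite /valid_piece /level /arcs_at /cuts.
  case: (p) => -[u|j|j] m /=.
  - by move=> /andP[_ mt] /andP[_ /eqP ->]; lia.
  - case: k => // j' q /andP[/eqP <- /andP[m0 mq]] /andP[_ pv]; rewrite /= pv.
    by case: ifP => _; lia.
  - by case: k => // j' /andP[/eqP <- _] /andP[_ pv]; rewrite /= pv.
have [mt|tm] := leqP m (t v).
  by case/andP: mv => m0 _; exists (Tri v, m) => //; rewrite /valid_piece /= m0.
case kE : k => [j q|j].
- have pf : paired j f v.
    by move: mv tm; rewrite /arcs_at kE /=; case: ifP => //; lia.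
  move: mv; rewrite /arcs_at kE /= pf => /andP[_ mtq].
  (* Quadrilaterals are numbered from the side of [ord0]; at a vertex of the other side the levels
     run backwards. *)
  pose m' := (if side j v then m - t v else q + 1 - (m - t v))%N.
  have vp : valid_piece (Quad j, m').
    by rewrite /valid_piece kE /= eqxx /= /m'; case: ifP => _; lia.
  exists (Quad j, m') => //; apply/(piece_face vp xf); exists v.
  rewrite /cuts /= fv pf E; split=> //; congr (_%:R); rewrite /level /= kE /m'.
  by case: (side j v); lia.
- have pf : ~~ paired j f v.
    by move: mv tm; rewrite /arcs_at kE /=; case: (paired _ _ _) => //=; lia.
  move: mv; rewrite /arcs_at kE /= pf => /andP[_ mtq].
  have vp : valid_piece (Oct j, 0%N) by rewrite /valid_piece kE /= eqxx.
  exists (Oct j, 0%N) => //; apply/(piece_face vp xf); exists v.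
  rewrite /cuts /= fv pf E; split=> //; congr (_%:R); rewrite /level /=.
  by lia.
Qed.

End Pieces.

Definition core_count (P : pred disc_type) (k : core) : nat :=
  match k with
  | QuadCore j q => if P (Quad j) then q else 0
  | OctCore j => P (Oct j)
  end.

(** * Construction of the surface *)

Lemma tetra_pieces (R : realType) (t : 'I_4 -> nat) (k : core) :
  exists (np : nat) (ty : 'I_np -> disc_type) (D : 'I_np -> set (tetra R)),
  [/\ forall l, normal_disc (ty l) (D l),
      forall l m, l != m -> D l `&` D m = set0,
      forall f x, bary x f = 0 -> ((exists l, D l x) <->
        exists v m, [/\ f != v, (0 < m <= arcs_at t k f v)%N & weighted (weight R t k) v x = m%:R]) &
      forall P : pred disc_type, (forall v, ~~ P (Tri v)) ->
        #|[set l | P (ty l)]%SET| = core_count P k].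
Proof.
have [nc [cf [cfV cfI cfS cfP]]] : exists nc (cf : 'I_nc -> disc_type * nat),
    [/\ forall m, valid_piece t k (cf m) /\ (forall v, (cf m).1 <> Tri v), injective cf,
      forall p, valid_piece t k p -> (exists v, p.1 = Tri v) \/ exists m, p = cf m &
      forall P : pred disc_type, (\sum_(m | P (cf m).1) 1 = core_count P k)%N].
  case: k => [j q|j].
  - exists q, (fun m => (Quad j, m.+1)); split.
    + by move=> m; rewrite /valid_piece /= eqxx ltn_ord.
    + by move=> m m' [/val_inj].
    + move=> [[v|j'|j'] m]; rewrite /valid_piece //=; first by left; exists v.
      move=> /andP[/eqP ->]; case: m => // m mq.
      by right; exists (Ordinal mq).
    + by move=> P /=; case: (P _); [rewrite sum1_card card_ord|rewrite big_pred0].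
  - exists 1%N, (fun=> (Oct j, 0%N)); split.
    + by move=> m; rewrite /valid_piece /= !eqxx.
    + by move=> m m' _; rewrite !ord1.
    + move=> [[v|j'|j'] m]; rewrite /valid_piece //=; first by left; exists v.
      by move=> /andP[/eqP -> /eqP ->]; right; exists ord0.
    + by move=> P /=; case: (P _); [rewrite sum1_card card_ord|rewrite big_pred0].
pose F := ({v : 'I_4 & 'I_(t v)} + 'I_nc)%type.
pose pc (y : F) : disc_type * nat := match y with
  | inl vm => (Tri (tag vm), (tagged vm).+1)
  | inr m => cf m
  end.
have pcV y : valid_piece t k (pc y).
  by case: y => [[v m]|m] /=; [exact: ltn_ord|have [] := cfV m].
have pcI : injective pc.
  move=> [[v m]|m] [[v' m']|m'] //=.
  - by move=> [vv]; subst v' => /val_inj ->.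
  - by move=> E; have [_ /(_ v)] := cfV m'; rewrite -E.
  - by move=> E; have [_ /(_ v')] := cfV m; rewrite E.
  - by move=> /cfI ->.
have pcS p : valid_piece t k p -> exists y, p = pc y.
  move=> vp; have [[v pv]|[m ->]] := cfS _ vp; last by exists (inr m).
  case: p pv vp => _ m /= ->; rewrite /valid_piece /=; case: m => // m mt.
  by exists (inl (existT _ v (Ordinal mt))).
exists #|{: F}|, (fun l => (pc (enum_val l)).1), (fun l => piece_set t k (pc (enum_val l))).
split.
- by move=> l; apply: piece_normal_disc.
- move=> l m lm; apply: piece_set_disjoint => // /pcI/enum_val_inj E.
  by rewrite E eqxx in lm.
- move=> f x xf; rewrite -(pieces_face t k xf); split=> [[l Dl]|[p vp px]].
    by exists (pc (enum_val l)).
  have [y yE] := pcS p vp; exists (enum_rank y); rewrite enum_rankK -yE.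
  exact: px.
- move=> P Ptri; rewrite -sum1_card.
  rewrite (eq_bigl (fun l => P (pc (enum_val l)).1)); last by move=> l; rewrite inE.
  rewrite -(reindex (@enum_val _ (mem {: F})) (P := fun y => P (pc y).1) (F := fun=> 1%N)) /=; last first.
    by apply: onW_bij; exact: enum_val_bij.
  rewrite big_sumType /= big1 ?add0n; last by move=> [v m]; rewrite (negPf (Ptri v)).
  exact: cfP.
Qed.

(** The weight of an edge is one more than the sum of the two arc numbers at its ends in a face, so
    weights agree across the gluing as arc numbers do. The traces on both sides coincide by
    [pieces_face], and the union of the pieces is saturated. *)
Lemma glued_pieces (R : realType) n (T : triangulation n) (t : 'I_n -> 'I_4 -> nat)
    (k : 'I_n -> core) :
  (forall i f j s v, glue T i f = Some (j, s) -> f != v ->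
    arcs_at (t j) (k j) (s f) (s v) = arcs_at (t i) (k i) f v) ->
  (\sum_i core_count octagonal (k i) = 1)%N ->
  exists S : octagonal_surface R T, forall i (P : pred disc_type), (forall v, ~~ P (Tri v)) ->
    #|[set l | P (@piece_type _ _ _ S i l)]%SET| = core_count P (k i).
Proof.
move=> arcs_glue one_oct.
pose H0 i := tetra_pieces R (t i) (k i).
pose np i := sval (cid (H0 i)); pose H1 i := svalP (cid (H0 i)).
pose ty i : 'I_(np i) -> disc_type := sval (cid (H1 i)); pose H2 i := svalP (cid (H1 i)).
pose D i : 'I_(np i) -> set (tetra R) := sval (cid (H2 i)).
have HD i : [/\ forall l, normal_disc (ty i l) (D i l), forall l m, l != m -> D i l `&` D i m = set0,
      forall f x, bary x f = 0 -> ((exists l, D i l x) <->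
        exists v m, [/\ f != v, (0 < m <= arcs_at (t i) (k i) f v)%N &
          weighted (weight R (t i) (k i)) v x = m%:R]) &
      forall P : pred disc_type, (forall v, ~~ P (Tri v)) ->
        #|[set l | P (ty i l)]%SET| = core_count P (k i)] := svalP (cid (H2 i)).
have weight_glue i f j s a b : glue T i f = Some (j, s) -> a != b -> f != a -> f != b ->
    weight R (t j) (k j) (s a) (s b) = weight R (t i) (k i) a b.
  move=> gl ab fa fb.
  have E l (f' a' b' : 'I_4) : a' != b' -> f' != a' -> f' != b' ->
      weight R (t l) (k l) a' b' = (arcs_at (t l) (k l) f' a' + arcs_at (t l) (k l) f' b' + 1)%:R.
    by move=> ab' fa' fb'; rewrite /weight (core_crossingsE _ ab' fa' fb') /arcs_at addnACA.
  by rewrite (E i f) // (E j (s f)) ?(inj_eq perm_inj) // !(arcs_glue _ _ _ _ _ gl).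
pose C := [set p : tetrahedra R n | exists l, D (tag p) l (tagged p)].
have CS p p' : C p -> @glue_step R n T p p' -> C p'.
  case: p p' => [i x] [j y] Cp [f [s [/= gl xf yx]]].
  have [_ _ Fi _] := HD i; have [_ _ Fj _] := HD j.
  have yf : bary y (s f) = 0 by rewrite yx.
  have [v [m [fv mn E]]] := (Fi _ _ xf).1 Cp.
  apply/(Fj _ _ yf); exists (s v), m; split.
  - by rewrite (inj_eq perm_inj).
  - by rewrite (arcs_glue _ _ _ _ _ gl fv).
  rewrite -E /weighted (reindex_inj (@perm_inj _ s)) /=.
  apply: eq_big => [c|c]; first by rewrite (inj_eq perm_inj).
  rewrite (inj_eq perm_inj) yx => cv.
  have [->|cf] := eqVneq c f; first by rewrite xf !mulr0.
  by rewrite (weight_glue _ _ _ _ _ _ gl) // eq_sym.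
pose carr := [set z : realization R T | exists i l x, D i l x /\ z = pt T i x].
have cover i : [set x | carr (pt T i x)] = \bigcup_l D i l.
  apply/seteqP; split=> x /=; last by move=> [l _ Dx]; exists i, l, x.
  move=> [j [l [y [Dy E]]]].
  have H : C (existT _ j y) by exists l.
  have [l' Dx] := class_closed CS H ((pt_eqP T _ _).1 (esym E)).
  by exists l'.
have one : (\sum_i #|[set l | octagonal (ty i l)]%SET| = 1)%N.
  by rewrite -one_oct; apply: eq_bigr => i _; have [_ _ _ ->] := HD i.
have nD i l : normal_disc (ty i l) (D i l) by have [] := HD i.
have dD i l m : l != m -> D i l `&` D i m = set0 by have [_ H _ _] := HD i; exact: H.
exists (OctagonalSurface nD dD cover one) => i P PT /=.
by have [_ _ _ ->] := HD i.
Qed.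

Section Realize.
Variables (R : realType) (n : nat) (T : triangulation n) (w : 'rV[R]_(n * (3 + 3)%N)).
Hypothesis w_int : w \is a mxOver Num.int.
Hypothesis w_ge0 : forall c, 0 <= w 0 c.
Hypothesis w_cons : qo_constraints w.
Hypothesis w_oct : one_unit_octagon w.

Lemma coord_nat i c : exists q : nat, vec_mx w i c = q%:R.
Proof.
have /natrP[q E] : w 0 (mxvec_index i c) \is a Num.nat.
  by rewrite natrEint w_ge0 andbT (mxOverP w_int).
by exists q; rewrite -E mxE.
Qed.

Lemma core_exists i : exists k : core,
  (forall j, quad_coord w i j = (core_count (is_quad j) k)%:R) /\
  (forall j, oct_coord w i j = (core_count (is_oct j) k)%:R).
Proof.
have [uni _] := w_cons; have [i0 [j0 [one oct]]] := w_oct.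
have ne j j' : lshift 3 j != rshift 3 j' by rewrite eq_lrshift.
have quad0 j j' : oct_coord w i j != 0 -> quad_coord w i j' = 0.
  move=> nz; apply/eqP; apply: contraT => nz'.
  by have := uni i _ _ nz' nz => E; have := ne j' j; rewrite E eqxx.
have [[j nz]|no] := pselect (exists j, oct_coord w i j != 0).
  have [iE jE] := oct _ _ nz; subst i j.
  exists (OctCore j0); split=> j /=; first exact: quad0 nz.
  have [<-|jj] := eqVneq j0 j; first by rewrite one.
  by apply/eqP; apply: contraT => /oct[E]; rewrite E eqxx in jj.
have oct0 j : oct_coord w i j = 0.
  by apply/eqP; apply: contraT => nz; exfalso; apply: no; exists j.
have [[j nz]|noq] := pselect (exists j, quad_coord w i j != 0).
  have [q qE] := coord_nat i (lshift 3 j).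
  exists (QuadCore j q); split=> j' /=; last exact: oct0.
  have [<-|jj] := eqVneq j j'; first exact: qE.
  apply/eqP; apply: contraT => nz'; have := uni i _ _ nz' nz => /lshift_inj E.
  by rewrite E eqxx in jj.
(* A tetrahedron that contains only triangles is given zero quadrilaterals of an arbitrary type. *)
exists (QuadCore ord0 0); split=> j /=; last exact: oct0.
rewrite if_same; apply/eqP; apply: contraT => nz; exfalso; apply: noq; by exists j.
Qed.

End Realize.

Lemma arc_coord_core (R : realType) n (w : 'rV[R]_(n * (3 + 3)%N)) i k f v : f != v ->
  (forall j, quad_coord w i j = (core_count (is_quad j) k)%:R) ->
  (forall j, oct_coord w i j = (core_count (is_oct j) k)%:R) ->
  arc_coord w i f v = (core_arcs k f v)%:R.
Proof.
move=> fv Q O; rewrite /arc_coord Q.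
under eq_bigr do rewrite O.
rewrite -natr_sum -natrD; congr (_%:R).
case: k {Q O} => [j q|j] /=; rewrite pairingP //.
  by rewrite big1 ?addn0.
case: eqVneq => [->|jj] /=; rewrite add0n.
  by apply: big1 => j'; rewrite eq_sym => /negPf ->.
by rewrite (bigD1 j) //= eqxx big1 // => j' /andP[_]; rewrite eq_sym => /negPf ->.
Qed.

Lemma surface_exists (R : realType) n (T : triangulation n) (w : 'rV[R]_(n * (3 + 3)%N)) :
  manifold_triangulation R T -> w \is a mxOver Num.int -> (forall c, 0 <= w 0 c) ->
  qo_matching T w -> qo_constraints w -> one_unit_octagon w ->
  exists S : octagonal_surface R T, qo_vector S = w.
Proof.
move=> mT w_int w_ge0 w_match w_cons w_oct.
pose k i := sval (cid (core_exists w_int w_ge0 w_cons w_oct i)).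
have kP i : (forall j, quad_coord w i j = (core_count (is_quad j) (k i))%:R) /\
  (forall j, oct_coord w i j = (core_count (is_oct j) (k i))%:R) := svalP (cid (core_exists w_int w_ge0 w_cons w_oct i)).
pose a i f v : int := Posz (core_arcs (k i) f v).
have [t0 t0P] : exists t : 'I_n -> 'I_4 -> int, forall i g j s v,
    glue T i g = Some (j, s) -> g != v -> t j (s v) = t i v + (a i g v - a j (s g) (s v)).
  apply: (triangle_potential mT) => -[i m] nb.
  have := w_match i m nb => /eqP; rewrite -subr_eq0 -sumrB => /eqP.
  under eq_bigr => q _ do rewrite upward_downward.
  (* The matching equation holds in [R] while the potential is sought in [int]; the terms are images
     of integers, and the embedding is injective. *)
  have E (q : position n) : arc_coord w q.1 (q.2 X_) (q.2 U_) - arc_coord w q.1 (q.2 Y_) (q.2 U_) =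
      (a q.1 (q.2 X_) (q.2 U_) - a q.1 (q.2 Y_) (q.2 U_))%:~R.
    have [Q O] := kP q.1.
    by rewrite !(arc_coord_core _ Q O) ?(inj_eq perm_inj) // rmorphB /= !pmulrn.
  under eq_bigr => q _ do rewrite E.
  by rewrite -rmorph_sum /= => /eqP; rewrite intr_eq0 => /eqP.
pose N := (\sum_i \sum_v `|t0 i v|)%N.
pose t i v := `|(t0 i v + N%:Z)%R|%N.
have tE i v : Posz (t i v) = t0 i v + N%:Z.
  rewrite gez0_abs //; suff : (`|t0 i v| <= N)%N by clear; lia.
  by rewrite /N (bigD1 i) //= (bigD1 v) //= -addnA leq_addr.
have arcs i f j s v : glue T i f = Some (j, s) -> f != v ->
    arcs_at (t j) (k j) (s f) (s v) = arcs_at (t i) (k i) f v.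
  move=> gl fv; apply/eqP; rewrite -eqz_nat /arcs_at !PoszD !tE (t0P _ _ _ _ _ gl fv) /a.
  by apply/eqP; ring.
have one : (\sum_i core_count octagonal (k i) = 1)%N.
  have [i0 [j0 [unit oct]]] := w_oct.
  have octE i : core_count octagonal (k i) = (i == i0).
    have [_ O] := kP i; case E : (k i) O => [j q|j] O /=.
      by case: eqVneq => // iE; subst i; have := O j0; rewrite unit => /eqP; rewrite oner_eq0.
    have : oct_coord w i j != 0 by rewrite O /= eqxx oner_neq0.
    by move=> /oct [-> _]; rewrite eqxx.
  by rewrite (eq_bigr _ (fun i _ => octE i)) (bigD1 i0) //= eqxx big1 // => i /negPf ->.
have [S SP] := @glued_pieces R n T t k arcs one.
exists S; apply: (can_inj vec_mxK); apply/matrixP => i c; have [Q O] := kP i.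
case: (split_ordP c) => j ->.
- by rewrite -!/(quad_coord _ _ _) qo_quad Q SP.
- by rewrite -!/(oct_coord _ _ _) qo_oct O SP.
Qed.

Theorem theorem4p5 (R : realType) (n : nat) (T : triangulation n)
    (hT : manifold_triangulation R T)
    (w : 'rV[R]_(n * (3 + 3))%N) (hw : w \is a mxOver Num.int) :
  (exists S : octagonal_surface R T, qo_vector S = w) <->
  [/\ forall c, 0 <= w 0 c, qo_matching T w, qo_constraints w &
      one_unit_octagon w].
Proof.
split=> [[S <-]|[w_ge0 w_match w_cons w_oct]].
  by split; [exact: qo_ge0|exact: surface_matching|exact: surface_constraints|exact: surface_one_octagon].
exact: surface_exists.
Qed.
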